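(* Let $n\ge 2$, let $\Omega$ be an open domain in $\mathbb{R}^n$, let $0<K_1<+\infty$, $0\le K_2<+\infty$ and $0\le M<+\infty$, and let $F(\Omega,K_1,K_2,M)$ be the collection of all $(K_1,K_2)$-quasiregular mappings $f$ on $\Omega$ (each identified with its continuous representative) such that $$\int_\Omega |Df(x)|^n\,dx\le M .$$ Then the set of functions $F(\Omega,K_1,K_2,M)$ is equi-uniformly continuous on every compact subset of $\Omega$; that is, for every compact $V\subset\Omega$ and every $\varepsilon>0$ there is $\delta>0$ such that $|f(x)-f(y)|<\varepsilon$ for all $f\in F(\Omega,K_1,K_2,M)$ and all $x,y\in V$ with $|x-y|<\delta$.
   Context: For an $n\times n$ matrix $A$, $|A|=\sup_{|\xi|=1}|A\xi|$. $W^{1,n}(\Omega,\mathbb{R}^n)$ is the Sobolev space of mappings $f=(f^1,\dots,f^n):\Omega\to\mathbb{R}^n$ whose components and their first distributional derivatives belong to $L^n(\Omega)$. For such $f$, $Df(x)=(\partial f^i/\partial x_j)_{1\le i,j\le n}$ is the weak derivative matrix, defined for almost all $x\in\Omega$, and $\mathcal{J}(x,f)=\det Df(x)$ is the Jacobian. A function $u$ does not change sign in $\Omega$ if either $u\ge 0$ almost everywhere in $\Omega$ or $u\le 0$ almost everywhere in $\Omega$. A mapping $f:\Omega\to\mathbb{R}^n$ is $(K_1,K_2)$-quasiregular, with $0<K_1<+\infty$ and $0\le K_2<+\infty$, if (i) $f\in W^{1,n}(\Omega,\mathbb{R}^n)$; (ii) $\mathcal{J}(x,f)$ does not change sign in $\Omega$,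 and $|Df(x)|^n\le K_1|\mathcal{J}(x,f)|+K_2$ for almost all $x\in\Omega$. Every $(K_1,K_2)$-quasiregular mapping coincides almost everywhere with a continuous mapping, and is identified with it. *)

(* Defs.v *)
From HB Require Import structures.
From mathcomp Require Import all_boot all_order all_algebra.
From mathcomp Require Import all_classical all_reals all_analysis.

Set Implicit Arguments.
Unset Strict Implicit.
Unset Printing Implicit Defensive.

Import Order.TTheory GRing.Theory Num.Theory.
Import numFieldNormedType.Exports.

Local Open Scope classical_set_scope.
Local Open Scope ring_scope.

(* Points of R^n are row vectors 'rV[R]_n; topology
   and derivatives on 'rV[R]_n are the library's (its norm is the sup norm,
   equivalent to the Euclidean one, which is [enorm] below). *)

(* The sigma-algebra on R^n generated by the coordinates, i.e. the Borel sets *)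
Definition rV_display : measure_display. Proof. exact. Qed.

Section rV_measurable.
Variables (R : realType) (n : nat).

Let coord (i : 'I_n) (x : 'rV[R]_n) : measurableTypeR R := x ord0 i.

Let rV_set0 : g_sigma_preimage coord set0.
Proof. exact: sigma_algebra0. Qed.

Let rV_setC A : g_sigma_preimage coord A -> g_sigma_preimage coord (~` A).
Proof. exact: sigma_algebraC. Qed.

Let rV_bigcup (F : (set 'rV[R]_n)^nat) : (forall i, g_sigma_preimage coord (F i)) ->
  g_sigma_preimage coord (\bigcup_i F i).
Proof. exact: sigma_algebra_bigcup. Qed.

HB.instance Definition _ := @isMeasurable.Build rV_display 'rV[R]_n
  (g_sigma_preimage coord) rV_set0 rV_setC rV_bigcup.

Lemma measurable_coord (i : 'I_n) : measurable_fun [set: 'rV[R]_n] (coord i).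
Proof.
move=> _ Y mY; rewrite setTI; apply: sub_sigma_algebra => /=.
rewrite -bigcup_seq/=; exists i => /=; first by rewrite mem_index_enum.
by exists Y => //; rewrite setTI.
Qed.

Lemma measurable_fun_rV d (T : measurableType d) (f : T -> 'rV[R]_n) :
  (forall i, measurable_fun [set: T] (coord i \o f)) ->
  measurable_fun [set: T] f.
Proof.
move=> mf _ A mA.
suff : g_sigma_preimage coord `<=` [set B | measurable ([set: T] `&` f @^-1` B)].
  exact.
apply: smallest_sub => /=.
  split=> [|B mB|F mF] /=.
  - by rewrite preimage_set0 setI0.
  - by rewrite setTD preimage_setC setTI; apply: measurableC; rewrite -[X in measurable X]setTI.
  - rewrite preimage_bigcup setTI; apply: bigcup_measurable => k _.
    by rewrite -[X in measurable X]setTI; exact: mF.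
rewrite -bigcup_seq => B [i _ [C mC <-]] /=.
by rewrite setTI; exact: mf.
Qed.

End rV_measurable.

Definition rV_cons (R : realType) (n : nat) (p : 'rV[R]_n * measurableTypeR R) :
  'rV[R]_n.+1 := row_mx (const_mx p.2 : 'rV_1) p.1.

Lemma measurable_rV_cons (R : realType) (n : nat) :
  measurable_fun setT (@rV_cons R n).
Proof.
apply: measurable_fun_rV => i.
have [j ->|->] := unliftP ord0 i; last first.
  rewrite (_ : _ \o _ = snd); first exact: measurable_snd.
  apply/funext => p /=; rewrite /rV_cons.
  have := row_mxEl (const_mx p.2 : 'rV_1) p.1 ord0 ord0.
  by rewrite [RHS]mxE => e; rewrite -[RHS]e; congr fun_of_matrix; apply/val_inj.
rewrite (_ : _ \o _ = (fun x : 'rV[R]_n => x ord0 j : measurableTypeR R) \o fst).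
  by apply: measurableT_comp; [exact: measurable_coord|exact: measurable_fst].
apply/funext => p /=; rewrite /rV_cons.
have := row_mxEr (const_mx p.2 : 'rV_1) p.1 ord0 j.
by move=> <-; congr fun_of_matrix; apply/val_inj.
Qed.

Section cons_measure.
Local Open Scope ereal_scope.
Variables (R : realType) (n : nat) (mu : {measure set 'rV[R]_n -> \bar R}).

Definition cons_measure : set 'rV[R]_n.+1 -> \bar R :=
  pushforward (mu \x @lebesgue_measure R) (@rV_cons R n).

Let cons_measurable (A : set 'rV[R]_n.+1) : measurable A ->
  measurable (@rV_cons R n @^-1` A).
Proof. by move=> mA; rewrite -[X in measurable X]setTI; exact: measurable_rV_cons. Qed.

Let cons_measure0 : cons_measure set0 = 0.
Proof. by rewrite /cons_measure /pushforward preimage_set0 measure0. Qed.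

Let cons_measure_ge0 A : 0 <= cons_measure A.
Proof. by rewrite /cons_measure /pushforward; apply: measure_ge0. Qed.

Let cons_measure_sigma_additive : semi_sigma_additive cons_measure.
Proof.
move=> F mF tF mUF; rewrite /cons_measure /pushforward preimage_bigcup.
apply: measure_semi_sigma_additive.
- by move=> k; exact: cons_measurable.
- apply/trivIsetP => /= i j _ _ ij; rewrite -preimage_setI.
  by move/trivIsetP : tF => /(_ _ _ _ _ ij) ->//; rewrite preimage_set0.
- by rewrite -preimage_bigcup; exact: cons_measurable.
Qed.

HB.instance Definition _ := isMeasure.Build _ _ _ cons_measure
  cons_measure0 cons_measure_ge0 cons_measure_sigma_additive.

End cons_measure.

(* The n-dimensional Lebesgue measure, restricted to Borel sets: the iterated
   product of one-dimensional Lebesgue measures.  Up to modification on null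
   sets, Lebesgue and Borel measurable functions are the same. *)
Fixpoint lebesgue_rV_rec (R : realType) (n : nat) :
    {measure set 'rV[R]_n -> \bar R} :=
  match n with
  | 0 => \d_(0 : 'rV[R]_0)
  | n'.+1 => cons_measure (lebesgue_rV_rec R n')
  end.

Definition lebesgue_rV (R : realType) (n : nat) : set 'rV[R]_n -> \bar R :=
  lebesgue_rV_rec R n.

HB.instance Definition _ (R : realType) (n : nat) :=
  Measure.copy (@lebesgue_rV R n) (lebesgue_rV_rec R n).

Section definitions.
Variables (R : realType) (n : nat).
Implicit Types (U : set 'rV[R]_n) (f : 'rV[R]_n -> 'rV[R]_n).
Local Notation mu := (@lebesgue_rV R n).

Definition enorm (x : 'rV[R]_n) : R := Num.sqrt (\sum_i x ord0 i ^+ 2).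

(* sup of |A xi| over |xi| = 1; the row vector xi *m A^T is (A xi)^T *)
Definition opnorm (A : 'M[R]_n) : R :=
  sup [set enorm (xi *m A^T) | xi in [set xi | enorm xi = 1]].

Definition partial (j : 'I_n) (phi : 'rV[R]_n -> R) : 'rV[R]_n -> R :=
  fun x => 'D_(delta_mx ord0 j) phi x.

Definition smooth (phi : 'rV[R]_n -> R) : Prop :=
  forall s : seq 'I_n, let psi := foldr partial phi s in
    continuous psi /\ forall j x, derivable psi x (delta_mx ord0 j).

Definition test_function U (phi : 'rV[R]_n -> R) : Prop :=
  [/\ smooth phi, compact (closure [set x | phi x != 0])
    & closure [set x | phi x != 0] `<=` U].

Definition loc_integrable U (u : 'rV[R]_n -> R) : Prop :=
  forall K, compact K -> K `<=` U -> mu.-integrable K (EFin \o u).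

Definition weak_partial U (j : 'I_n) (u g : 'rV[R]_n -> R) : Prop :=
  [/\ loc_integrable U u, loc_integrable U g &
    forall phi, test_function U phi ->
      (\int[mu]_(x in U) (u x * partial j phi x)%:E
       = - \int[mu]_(x in U) (g x * phi x)%:E)%E].

Definition weak_derivative U f (D : 'rV[R]_n -> 'M[R]_n) : Prop :=
  forall i j, weak_partial U j (fun x => f x ord0 i) (fun x => D x i j).

(* The weak derivative matrix Df, unique up to a null set: an arbitrary
   representative if there is one, 0 otherwise *)
Definition weakD U f : 'rV[R]_n -> 'M[R]_n :=
  xget (fun=> 0) [set D | weak_derivative U f D].

Definition Jac U f (x : 'rV[R]_n) : R := \det (weakD U f x).

(* The exponent n of L^n(U) is the dimension *)
Definition Ln U (u : 'rV[R]_n -> R) : Prop :=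
  measurable_fun U u /\ (\int[mu]_(x in U) (`|u x| ^+ n)%:E < +oo)%E.

Definition W1n U f : Prop :=
  [/\ exists D, weak_derivative U f D,
      forall i, Ln U (fun x => f x ord0 i)
    & forall i j, Ln U (fun x => weakD U f x i j)].

Definition no_sign_change U (u : 'rV[R]_n -> R) : Prop :=
  {ae mu, forall x, U x -> 0 <= u x} \/ {ae mu, forall x, U x -> u x <= 0}.

Definition quasiregular U (K1 K2 : R) f : Prop :=
  [/\ W1n U f, no_sign_change U (Jac U f)
    & {ae mu, forall x, U x ->
        opnorm (weakD U f x) ^+ n <= K1 * `|Jac U f x| + K2}].

(* The collection F(U, K1, K2, M), a mapping being represented by its
   continuous representative on U; values outside U are irrelevant *)
Definition qr_class U (K1 K2 M : R) : set ('rV[R]_n -> 'rV[R]_n) :=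
  [set f | [/\ quasiregular U K1 K2 f, {within U, continuous f}
     & (\int[mu]_(x in U) (opnorm (weakD U f x) ^+ n)%:E <= M%:E)%E]].

Definition equi_uniformly_continuous (V : set 'rV[R]_n)
    (F : set ('rV[R]_n -> 'rV[R]_n)) : Prop :=
  forall e : R, 0 < e -> exists2 d : R, 0 < d &
    forall f x y, F f -> V x -> V y -> enorm (x - y) < d ->
      enorm (f x - f y) < e.

End definitions.

(* Main.v *)
Require Import Defs.
From HB Require Import structures.
From mathcomp Require Import all_boot all_order all_algebra.
From mathcomp Require Import all_classical all_reals all_analysis.
From mathcomp Require Import measurable_realfun ring lra.
From mathcomp Require fingroup perm.
Set Implicit Arguments.
Unset Strict Implicit.
Unset Printing Implicit Defensive.
Import Order.TTheory GRing.Theory Num.Theory.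
Import numFieldNormedType.Exports.
Local Open Scope classical_set_scope.
Local Open Scope ring_scope.

(** The proof is Morrey's. The integral of the n-th power of the gradient over
    a small cube decays geometrically with the size of the cube, at a rate
    that depends on the class only, and such a decay forces a modulus of
    continuity.

    Decay. Let phi r be the integral over the cube of half-side r about z of
    the sum of the n-th powers of the entries of Df. By the distortion
    inequality phi r is at most a multiple of the integral of |J| plus a
    multiple of r^n, and J does not change sign, so that the integral of |J|
    over the cube is at most the modulus of the integral of eta J for a cut-off
    eta equal to 1 on the cube and to 0 off the doubled cube. The Jacobian is a null
    Lagrangian: for every constant c the integral of eta J is the opposite of
    the integral of (f_0 - c) det N, where N is Df with its first row replaced
    by the gradient of eta ([jacobian_by_parts]). This integrand lives on the
    annulus between the two cubes, where it is bounded by a multiple of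
    |f_0 - c|^n / r^n + |Df|^n; Poincare's inequality on the annulus, which is
    connected because n >= 2, bounds the integral of the first term by that of
    the second ([jacobian_estimate]). Hence phi r <= C (phi (2 r) - phi r + r^n)
    ([hole_filling]), and moving C phi r to the left-hand side makes the
    numbers phi (2^-k r) decay geometrically ([hole_filling_decay]).

    Continuity. By Poincare's inequality each cube about x of half-side 2^-k r
    contains a point y at which f_i y is a good constant: the n-th power of
    f_i - f_i y has an integral over the cube that is small with respect to its
    measure ([good_constants]). Good constants of two overlapping cubes of
    consecutive sizes are compared on the smaller cube. Telescoping from x to a
    given scale, crossing there from x to y, and telescoping back bounds
    f_i x - f_i y ([modulus_of_continuity]).

    Both parts rest on identities for smooth maps. They are carried over to f
    along mollifications of f, which converge to f on a smaller cube and whose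
    first derivatives converge almost everywhere with an integrable majorant of
    their n-th powers ([approx_exists]).

    Cubes, the balls of the sup norm, are used throughout: their measure and
    their cut-offs factor over the coordinates. *)

(** * Affine changes of variables and cubes *)

Section affine_change.
Variable R : realType.
Local Open Scope ereal_scope.

(** Both sides are measures in A that agree on half-open intervals. *)
Lemma lebesgue_measure_affine (a b : R) (A : set (measurableTypeR R)) :
  (0 < a)%R -> measurable A ->
  @lebesgue_measure R ((fun s => a * s + b)%R @^-1` A) =
  (a^-1)%:E * @lebesgue_measure R A.
Proof.
move=> a0 mA.
pose T : measurableTypeR R -> measurableTypeR R := fun s => (a * s + b)%R.
have mT : measurable_fun setT T.
  by apply: measurable_funD => //; exact: measurable_funM.
have a0' : (0 <= a)%R by exact: ltW.
pose nu : {measure set (measurableTypeR R) -> \bar R} :=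
  mscale (NngNum a0')
  (measure_function_pushforward__canonical__measure_function_Measure
     (@lebesgue_measure R) mT).
have E : forall X, ocitv X -> lebesgue_measure X = nu X.
  move=> _ [[u v]] _ <- /=.
  rewrite /nu /mscale /= /pushforward.
  have -> : T @^-1` `]u, v]%classic = [set` `](u - b) / a, (v - b) / a]%R].
    apply/seteqP; split => s; rewrite /= /T !in_itv /= ltr_pdivrMr// ler_pdivlMr//.
      by rewrite ltrBlDr lerBrDr mulrC.
    by rewrite ltrBlDr lerBrDr mulrC.
  rewrite !lebesgue_measure_itv /= !lte_fin ltr_pM2r ?invr_gt0// ltrD2r.
  case: ifP => _; last by rewrite mule0.
  rewrite -!EFinD -EFinM; congr EFin.
  by field; rewrite gt_eqF.
have := lebesgue_measure_unique E mA => /= ->.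
rewrite /nu /mscale /= /pushforward muleA -EFinM mulVf ?gt_eqF// mul1e.
by [].
Qed.

Lemma measurable_affine (n : nat) (a : R) (b : 'rV[R]_n) :
  measurable_fun setT (fun x : 'rV[R]_n => a *: x + b)%R.
Proof.
apply: measurable_fun_rV => i.
rewrite (_ : _ \o _ = (fun x : 'rV[R]_n => a * (x ord0 i : measurableTypeR R) + b ord0 i)%R).
  apply: measurable_funD => //; apply: measurable_funM => //.
  exact: measurable_coord.
by apply/funext => x /=; rewrite !mxE.
Qed.

Lemma rV_consE (n : nat) (p : 'rV[R]_n * measurableTypeR R) :
  (rV_cons p ord0 ord0 = p.2) * (forall j, rV_cons p ord0 (lift ord0 j) = p.1 ord0 j).
Proof.
split=> [|j]; rewrite /rV_cons.
  have := row_mxEl (const_mx p.2 : 'rV_1) p.1 ord0 ord0.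
  by rewrite [RHS]mxE => e; rewrite -[RHS]e; congr fun_of_matrix; apply/val_inj.
have := row_mxEr (const_mx p.2 : 'rV_1) p.1 ord0 j.
by move=> <-; congr fun_of_matrix; apply/val_inj.
Qed.

Lemma rV_cons_affine (n : nat) (a : R) (b : 'rV[R]_n.+1) (p : 'rV[R]_n * measurableTypeR R) :
  (a *: rV_cons p + b)%R =
  rV_cons ((a *: p.1 + \row_j b ord0 (lift ord0 j))%R, (a * p.2 + b ord0 ord0)%R).
Proof.
have lin (X : 'rV[R]_n.+1) i : (a *: X + b)%R ord0 i = (a * X ord0 i + b ord0 i)%R.
  by rewrite !mxE.
apply/rowP => j; rewrite lin; have [k ->|->] := unliftP ord0 j.
  by rewrite !rV_consE /= !mxE.
by rewrite !rV_consE.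
Qed.

(** The recursive definition of the measure in terms of sections: the starting
    point of every induction on the dimension. *)
Lemma lebesgue_rVS (n : nat) (A : set 'rV[R]_n.+1) :
  @lebesgue_rV R n.+1 A = \int[@lebesgue_rV R n]_x
    @lebesgue_measure R (xsection (@rV_cons R n @^-1` A) x).
Proof. by []. Qed.

Lemma measurable_rV_cons_preimage n (A : set 'rV[R]_n.+1) : measurable A ->
  measurable (@rV_cons R n @^-1` A).
Proof. by move=> mA; rewrite -[X in measurable X]setTI; exact: measurable_rV_cons. Qed.

(** The last hypothesis on phi makes the image measure of mu a multiple of mu.
    *)
Lemma ge0_integral_image_measure d (T : measurableType d) (mu : {measure set T -> \bar R})
  (phi : T -> T) (k : R) (f : T -> \bar R) : measurable_fun setT phi -> (0 <= k)%R ->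
  (forall A, measurable A -> mu (phi @^-1` A) = k%:E * mu A) ->
  measurable_fun setT f -> (forall x, 0 <= f x) ->
  \int[mu]_x f (phi x) = k%:E * \int[mu]_x f x.
Proof.
move=> mphi k0 H mf f0.
transitivity (\int[pushforward mu phi]_x f x).
  by rewrite ge0_integral_pushforward//; apply: eq_integral.
rewrite -(ge0_integral_mscale _ _ (NngNum k0))//.
by apply: (@eq_measure_integral _ _ _ _ (mscale (NngNum k0) mu)
  (measure_function_pushforward__canonical__measure_function_Measure mu mphi)) => A mA _; exact: (H _ mA).
Qed.

(** By induction on the dimension: the map acts on the last factor of the
    product as an affine map of the line, and on the others as the induction
    hypothesis describes. *)
Lemma lebesgue_rV_affine (n : nat) (a : R) (b : 'rV[R]_n) (A : set 'rV[R]_n) :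
  (0 < a)%R -> measurable A ->
  @lebesgue_rV R n ((fun x => a *: x + b)%R @^-1` A) =
  (a^-1 ^+ n)%:E * @lebesgue_rV R n A.
Proof.
move=> a0; elim: n b A => [|n IH] b A mA.
  rewrite expr0 mul1e; congr lebesgue_rV.
  have H (x : 'rV[R]_0) : (a *: x + b)%R = x by apply/rowP => -[].
  by rewrite /preimage; apply/seteqP; split => x /=; rewrite H.
rewrite !lebesgue_rVS.
pose b' : 'rV[R]_n := (\row_j b ord0 (lift ord0 j))%R.
pose g x := @lebesgue_measure R (xsection (@rV_cons R n @^-1` A) x).
have mA' := measurable_rV_cons_preimage mA.
have mg : measurable_fun setT g by exact: measurable_fun_xsection.
transitivity (\int[@lebesgue_rV R n]_x (a^-1%:E * g (a *: x + b')%R)).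
  apply: eq_integral => x _.
  rewrite /g -(lebesgue_measure_affine (b ord0 ord0))//; last exact: measurable_xsection.
  congr lebesgue_measure; rewrite /xsection/=; apply/seteqP.
  by split => s; rewrite /= !inE /= rV_cons_affine.
have ai0 : (0 <= a^-1)%R by rewrite invr_ge0 ltW.
rewrite ge0_integralZl//; last first.
  by apply: measurableT_comp => //; exact: measurable_affine.
rewrite (@ge0_integral_image_measure _ _ _ _ (a^-1 ^+ n) g)//.
- by rewrite muleA -EFinM -exprS.
- exact: measurable_affine.
- by rewrite exprn_ge0.
- by move=> B mB; exact: IH.
Qed.

Lemma ge0_integral_affine (n : nat) (a : R) (b : 'rV[R]_n) (f : 'rV[R]_n -> \bar R) :
  (0 < a)%R -> measurable_fun setT f -> (forall x, 0 <= f x) ->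
  \int[@lebesgue_rV R n]_x f (a *: x + b)%R =
  (a^-1 ^+ n)%:E * \int[@lebesgue_rV R n]_x f x.
Proof.
move=> a0 mf f0; rewrite (@ge0_integral_image_measure _ _ _ _ (a^-1 ^+ n) f)//.
- exact: measurable_affine.
- by rewrite exprn_ge0// invr_ge0 ltW.
- by move=> B mB; exact: lebesgue_rV_affine.
Qed.

Definition cube (n : nat) (z : 'rV[R]_n) (r : R) : set 'rV[R]_n :=
  [set x | forall i, `|x ord0 i - z ord0 i| < r]%R.

Lemma measurable_coord_preimage (n : nat) (i : 'I_n) (B : set (measurableTypeR R)) :
  measurable B -> measurable [set x : 'rV[R]_n | B (x ord0 i)].
Proof. by move=> mB; have := @measurable_coord R n i measurableT _ mB; rewrite setTI. Qed.

Lemma measurable_coord_forall (n : nat) (B : 'I_n -> set (measurableTypeR R)) :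
  (forall i, measurable (B i)) -> measurable [set x : 'rV[R]_n | forall i, B i (x ord0 i)].
Proof.
move=> mB.
rewrite (_ : [set _ | _] = \bigcap_(i in [set: 'I_n]) [set x : 'rV[R]_n | B i (x ord0 i)]).
  apply: fin_bigcap_measurable => // i _; exact: measurable_coord_preimage.
by apply/seteqP; split => x /= H i => [_|]; exact: H.
Qed.

Lemma measurable_cube (n : nat) (z : 'rV[R]_n) (r : R) : measurable (cube z r).
Proof.
apply: (@measurable_coord_forall n (fun i => [set t | `|t - z ord0 i| < r]%R)) => i.
rewrite (_ : [set _ | _] = ball (z ord0 i) r); first exact: measurable_ball.
by apply/seteqP; split => t /=; rewrite /ball /= distrC.
Qed.

(** A section of a box is a fixed factor of the box or empty. *)
Lemma lebesgue_rV_box (n : nat) (B : 'I_n -> set (measurableTypeR R)) (l : 'I_n -> R) :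
  (forall i, measurable (B i)) -> (forall i, @lebesgue_measure R (B i) = (l i)%:E) ->
  @lebesgue_rV R n [set x | forall i, B i (x ord0 i)] = (\prod_i l i)%:E.
Proof.
elim: n B l => [|n IH] B l mB lB.
  rewrite big_ord0 /lebesgue_rV /= /dirac indicE mem_set//.
  by case.
pose B' i := B (lift ord0 i).
have mB' : measurable [set x : 'rV[R]_n | forall i, B' i (x ord0 i)].
  by apply: measurable_coord_forall => i; exact: mB.
rewrite lebesgue_rVS.
transitivity (\int[@lebesgue_rV R n]_x ((l ord0)%:E *
    (\1_[set x : 'rV[R]_n | forall i, B' i (x ord0 i)] x)%:E)).
  apply: eq_integral => x _; rewrite indicE.
  have [xz|xz] := pselect (forall i, B' i (x ord0 i)).
    rewrite mem_set// mule1 -lB; congr lebesgue_measure.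
    rewrite /xsection; apply/seteqP; split => s; rewrite /= inE /=.
      by move=> /(_ ord0); rewrite rV_consE.
    by move=> Bs j; have [k ->|->] := unliftP ord0 j; rewrite rV_consE //=; exact: xz.
  rewrite memNset// mule0 (_ : xsection _ _ = set0) ?measure0//.
  rewrite /xsection; apply/seteqP; split => s //=; rewrite inE /= => H; apply: xz => j.
  by have := H (lift ord0 j); rewrite rV_consE.
rewrite ge0_integralZl//.
- rewrite integral_indic// setIT; have /= -> := IH B' (fun i => l (lift ord0 i)).
  + by rewrite -EFinM big_ord_recl.
  + by move=> i; exact: mB.
  + by move=> i; exact: lB.
- exact/measurable_EFinP/measurable_indic.
- by rewrite -lB measure_ge0.
Qed.

Lemma lebesgue_rV_cube (n : nat) (z : 'rV[R]_n) (r : R) : (0 <= r)%R ->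
  @lebesgue_rV R n (cube z r) = ((2 * r) ^+ n)%:E.
Proof.
move=> r0.
have E i : [set t : measurableTypeR R | `|t - z ord0 i| < r]%R = ball (z ord0 i) r.
  by apply/seteqP; split => t /=; rewrite /ball /= distrC.
have := @lebesgue_rV_box n (fun i => [set t | `|t - z ord0 i| < r]%R) (fun=> 2 * r)%R.
rewrite prodr_const card_ord; apply => i; rewrite E; first exact: measurable_ball.
by rewrite lebesgue_measure_ball// mulr_natl.
Qed.

Lemma coord_le_norm (n : nat) (x : 'rV[R]_n) i : (`|x ord0 i| <= `|x|)%R.
Proof.
rewrite [leRHS]/Num.norm/= mx_normrE.
exact: (le_bigmax _ (fun ij => `|x ij.1 ij.2|%R) (ord0, i)).
Qed.

Lemma cube_cover (n : nat) : \bigcup_k cube (0 : 'rV[R]_n) k%:R = setT.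
Proof.
apply/seteqP; split => // x _.
exists (Num.truncn `|x|).+1 => //= i; rewrite mxE subr0.
apply: le_lt_trans (truncnS_gt _).
exact: coord_le_norm.
Qed.

Lemma lebesgue_rV_sigma_finite (n : nat) : sigma_finite setT (@lebesgue_rV R n).
Proof.
exists (fun k => cube 0 k%:R); first by rewrite cube_cover.
by move=> k; split; [exact: measurable_cube | rewrite lebesgue_rV_cube// ltry].
Qed.

HB.instance Definition _ (n : nat) := @Measure_isSigmaFinite.Build _ _ _
  (@lebesgue_rV R n) (@lebesgue_rV_sigma_finite n).

End affine_change.

(** * Borel sets and translations *)

Section borel.
Variables (R : realType) (n : nat).
Local Notation mu := (@lebesgue_rV R n).

(** The measurable sets are generated by the coordinates; an open set is the
    countable union of the cubes that it contains among those with rational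
    centre and half-side 1/(k+1). *)
Lemma open_measurable_rV (U : set 'rV[R]_n) : open U -> measurable U.
Proof.
move=> oU.
pose F (m : nat) : set 'rV[R]_n :=
  if @unpickle ('rV[rat]_n * nat)%type m is Some p then
    (if `[< cube (map_mx ratr p.1) p.2.+1%:R^-1 `<=` U >] then
      cube (map_mx ratr p.1) p.2.+1%:R^-1 else set0) else set0.
rewrite (_ : U = \bigcup_m F m).
  apply: bigcup_measurable => m _; rewrite /F; case: unpickle => // p.
  by case: asboolP => // _; exact: measurable_cube.
apply/seteqP; split => x; last first.
  by move=> [m _]; rewrite /F; case: unpickle => // p; case: asboolP => // H; exact: H.
move=> Ux.
have /nbhs_ballP[e /= e0 eU] : nbhs x U by exact: open_nbhs_nbhs.
have [k ke] : exists k, k.+1%:R^-1 < e / 2.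
  have [k _] := @near_infty_natSinv_lt R (PosNum (divr_gt0 e0 (ltr0Sn _ 1))) .
  by move=> /(_ k (leqnn k)) /= ?; exists k.
have /choice[q qP] : forall i, exists q : rat, `|x ord0 i - ratr q| < k.+1%:R^-1.
  move=> i; have kp : (0 : R) < k.+1%:R^-1 by rewrite invr_gt0 ltr0n.
  have lt : x ord0 i < x ord0 i + k.+1%:R^-1 by rewrite ltrDl.
  have [q] := rat_in_itvoo lt.
  rewrite in_itv /= => /andP[q1 q2].
  by exists q; rewrite distrC gtr0_norm ?subr_gt0// ltrBlDl.
exists (pickle ((\row_i q i : 'rV[rat]_n), k)) => //.
rewrite /F pickleK /= asboolT; first by move=> i; rewrite !mxE.
move=> y yq; apply: eU; split => // i j; rewrite ord1.
rewrite /ball /=.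
have := yq j; rewrite !mxE; have := qP j; move: ke; set t := _^-1 => ke' H1 H2.
rewrite (_ : _ - _ = (x ord0 j - ratr (q j)) + (ratr (q j) - y ord0 j)); last by ring.
rewrite (le_lt_trans (ler_normD _ _))// [X in _ + X]distrC; lra.
Qed.

Lemma continuous_measurable_rV (f : 'rV[R]_n -> R) :
  continuous f -> measurable_fun setT f.
Proof.
move=> /continuousP cf; apply: (measurability _ (RGenOpens.measurableE R)).
move=> _ [_ [a [b ->] <-]]; rewrite setTI; apply: open_measurable_rV.
exact/cf/interval_open.
Qed.

Lemma cube_ball (z : 'rV[R]_n) (r : R) : 0 < r -> cube z r = ball z r.
Proof.
move=> r0; apply/seteqP; split => x.
  by move=> xz; split => // i j; rewrite ord1 /ball /= distrC; exact: xz.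
by move=> [_ xz] i; have := xz ord0 i; rewrite /ball /= distrC.
Qed.

Definition ccube (z : 'rV[R]_n) (r : R) : set 'rV[R]_n :=
  [set x | forall i, `|x ord0 i - z ord0 i| <= r].

Lemma compact_ccube z r : compact (ccube z r).
Proof.
have := @rV_compact R n (fun i => `[z ord0 i - r, z ord0 i + r]%classic).
rewrite (_ : [set v | _] = ccube z r); first by apply=> i; exact: segment_compact.
by apply/seteqP; split => x /= H i; have := H i; rewrite in_itv /= ler_distl.
Qed.

Lemma measurable_ccube z r : measurable (ccube z r).
Proof.
apply: (@measurable_coord_forall R n (fun i => [set t | `|t - z ord0 i| <= r]%R)) => i.
rewrite (_ : [set _ | _] = `[z ord0 i - r, z ord0 i + r]%classic); first exact: measurable_itv.
by apply/seteqP; split => t /=; rewrite in_itv /= ler_distl.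
Qed.

Lemma sub_cube (z w : 'rV[R]_n) r s : (forall i, `|w ord0 i - z ord0 i| + r <= s) -> cube w r `<=` cube z s.
Proof.
move=> H x xw i; have := xw i; have := H i => H1 H2.
rewrite (_ : x ord0 i - _ = (x ord0 i - w ord0 i) + (w ord0 i - z ord0 i)); last by ring.
rewrite (le_lt_trans (ler_normD _ _))//; lra.
Qed.

Lemma measurable_translate (z : 'rV[R]_n) :
  measurable_fun setT (fun x : 'rV[R]_n => x + z).
Proof.
rewrite (_ : (fun x => x + z) = (fun x => 1 *: x + z)); first exact: measurable_affine.
by apply/funext => x; rewrite scale1r.
Qed.

Lemma measurable_translate_preimage (z : 'rV[R]_n) A : measurable A ->
  measurable ((fun x : 'rV[R]_n => x + z) @^-1` A).
Proof. by move=> mA; rewrite -[X in measurable X]setTI; exact: measurable_translate. Qed.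

Lemma lebesgue_rV_translate (z : 'rV[R]_n) A : measurable A ->
  mu ((fun x : 'rV[R]_n => x + z) @^-1` A) = mu A.
Proof.
move=> mA; have := lebesgue_rV_affine z ltr01 mA.
rewrite invr1 expr1n mul1e => <-; congr (mu _).
by apply/seteqP; split => x /=; rewrite scale1r.
Qed.

Lemma ge0_integral_translate (z : 'rV[R]_n) (f : 'rV[R]_n -> \bar R) :
  measurable_fun setT f -> (forall x, 0 <= f x)%E ->
  (\int[mu]_x f (x + z)%R = \int[mu]_x f x)%E.
Proof.
move=> mf f0; have := ge0_integral_affine z ltr01 mf f0.
rewrite invr1 expr1n mul1e => <-; apply: eq_integral => x _.
by rewrite scale1r.
Qed.

(** Symmetric difference of A and its translate by - z. *)
Definition translate_diff (A : set 'rV[R]_n) (z : 'rV[R]_n) : set 'rV[R]_n :=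
  let A' := (fun x : 'rV[R]_n => x + z) @^-1` A in (A' `\` A) `|` (A `\` A').

Lemma measurable_translate_diff A z : measurable A -> measurable (translate_diff A z).
Proof.
move=> mA; have := measurable_translate_preimage z mA => mA'.
by apply: measurableU; exact: measurableD.
Qed.

(** Translating A by a small vector changes it little in measure inside a given
    cube. Sets with this property form a sigma-algebra, so that it holds for all
    measurable sets once it holds for generators; continuity of translations in
    L^1 and L^p then follows by way of simple functions. *)
Definition translation_continuous (A : set 'rV[R]_n) := measurable A /\
  forall (c : 'rV[R]_n) (r e : R), 0 < r -> 0 < e -> exists2 d : R, 0 < d &
    forall z : 'rV[R]_n, `|z| < d -> (mu (cube c r `&` translate_diff A z) <= e%:E)%E.

Lemma translation_continuous0 : translation_continuous set0.
Proof.
split=> // c r e r0 e0; exists 1 => // z _.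
rewrite (_ : translate_diff _ _ = set0) ?setI0 ?measure0 ?lee_fin ?ltW//.
by apply/seteqP; split => // x /= [[]|[]].
Qed.

Lemma translation_continuousC A : translation_continuous A -> translation_continuous (~` A).
Proof.
move=> [mA H]; split; first exact: measurableC.
move=> c r e r0 e0; have [d d0 dP] := H c r e r0 e0; exists d => // z zd.
rewrite (_ : translate_diff _ _ = translate_diff A z); first exact: dP.
apply/seteqP; split => x /=; rewrite /translate_diff /setC /=.
  by move=> [[H1 /contrapT H2]|[H1 /contrapT H2]]; [right|left].
by move=> [[H1 H2]|[H1 H2]]; [right|left]; split => //; exact.
Qed.

Lemma translation_continuousU A B : translation_continuous A -> translation_continuous B -> translation_continuous (A `|` B).
Proof.
move=> [mA HA] [mB HB]; split; first exact: measurableU.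
move=> c r e r0 e0; have e20 : 0 < e / 2 by rewrite divr_gt0.
have [d d0 dP] := HA c r _ r0 e20; have [d' d'0 d'P] := HB c r _ r0 e20.
exists (Num.min d d'); first by rewrite lt_min d0.
move=> z; rewrite lt_min => /andP[zd zd'].
have mtA := measurable_translate_diff z mA; have mtB := measurable_translate_diff z mB.
have mc := measurable_cube c r.
apply: (@le_trans _ _ (mu ((cube c r `&` translate_diff A z) `|` (cube c r `&` translate_diff B z)))).
  apply: le_measure; rewrite ?inE.
  - by apply: measurableI => //; apply: measurable_translate_diff; exact: measurableU.
  - by apply: measurableU; exact: measurableI.
  - rewrite -setIUr; apply: setIS => x; rewrite /translate_diff /=; tauto.
apply: le_trans (measureU2 _ _ _) _; [exact: measurableI|exact: measurableI|].
rewrite (splitr e) EFinD; apply: leeD; [exact: dP|exact: d'P].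
Qed.

(** Inside a cube a countable union is a finite one up to a set of small
    measure. This remainder is estimated in the cube of half-side r + 1, which
    contains the translates of cube c r by vectors shorter than 1. *)
Lemma translation_continuous_bigcup (F : (set 'rV[R]_n)^nat) :
  (forall i, translation_continuous (F i)) -> translation_continuous (\bigcup_i F i).
Proof.
move=> HF.
have mF i : measurable (F i) by have [] := HF i.
split; first exact: bigcup_measurable.
set A := \bigcup_i F i; have mA : measurable A by exact: bigcup_measurable.
move=> c r e r0 e0; have e40 : 0 < e / 3 by rewrite divr_gt0.
pose G N := \big[setU/set0]_(k < N) F k.
have GT N : translation_continuous (G N).
  by apply: big_ind => //; [exact: translation_continuous0|exact: translation_continuousU].
have mG N : measurable (G N) by have [] := GT N.
pose B := cube c (r + 1).
have mB : measurable B by exact: measurable_cube.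
have : mu (B `&` (A `\` G N)) @[N --> \oo] --> 0%E.
  rewrite -(@measure0 _ _ _ mu) (_ : set0 = \bigcap_N (B `&` (A `\` G N))).
    apply: nonincreasing_cvg_mu.
    - apply: le_lt_trans (_ : (mu B < +oo)%E); last by rewrite lebesgue_rV_cube ?ltry ?addr_ge0// ltW.
      by apply: le_measure; rewrite ?inE//; apply: measurableI => //; exact: measurableD.
    - by move=> N; apply: measurableI => //; exact: measurableD.
    - by apply: bigcap_measurable => // N _; apply: measurableI => //; exact: measurableD.
    - move=> N N' NN'; apply/subsetPset; apply: setIS; apply: setDS.
      exact: subset_bigsetU.
  apply/seteqP; split => // x /= H.
  have [_ [[k _ Fk] _]] := H 0%N I.
  have [_ [_]] := H k.+1 I; apply.
  by rewrite /G big_ord_recr /=; right.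
move=> /fine_cvgP[_ /cvgrPdist_lt /(_ _ e40)[N _ NP]].
have muN : (mu (B `&` (A `\` G N)) <= (e / 3)%:E)%E.
  have fB : (mu B < +oo)%E by rewrite lebesgue_rV_cube ?ltry ?addr_ge0// ltW.
  have ffin : mu (B `&` (A `\` G N)) \is a fin_num.
    rewrite ge0_fin_numE ?measure_ge0//; apply: le_lt_trans fB.
    by apply: le_measure; rewrite ?inE//; apply: measurableI => //; exact: measurableD.
  have := NP N (leqnn N); rewrite /= sub0r normrN => H.
  rewrite -(fineK ffin) lee_fin; apply: le_trans (ltW H); exact: ler_norm.
have [d d0 dP] := (GT N).2 c r _ r0 e40.
exists (Num.min d 1); first by rewrite lt_min d0 /=.
move=> z; rewrite lt_min => /andP[zd z1].
have mc := measurable_cube c r.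
pose E := A `\` G N; have mE : measurable E by exact: measurableD.
pose E' := (fun x : 'rV[R]_n => x + z) @^-1` E.
have mE' : measurable E' by exact: measurable_translate_preimage.
have mtA := measurable_translate_diff z mA; have mtG := measurable_translate_diff z (mG N).
have GA : G N `<=` A.
  rewrite /G => x; rewrite -bigcup_mkord => -[k _ Fk]; by exists k.
apply: (@le_trans _ _ (mu ((cube c r `&` translate_diff (G N) z) `|` ((B `&` E) `|` (cube c r `&` E'))))).
  apply: le_measure; rewrite ?inE.
  - exact: measurableI.
  - by apply: measurableU; [exact: measurableI|apply: measurableU; exact: measurableI].
  - move=> x [cx tx]; rewrite /translate_diff /E' /E /=.
    have Bx : B x by apply: sub_cube cx => i; rewrite subrr normr0 add0r lerDl.
    have := GA x; have := GA (x + z).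
    move: tx; rewrite /translate_diff /=.
    have [?|?] := pselect (G N x); have [?|?] := pselect (G N (x + z)); tauto.
apply: le_trans (measureU2 _ _ _) _; [exact: measurableI|by apply: measurableU; exact: measurableI|].
rewrite (_ : e = e / 3 + (e / 3 + e / 3)); last by field.
rewrite EFinD; apply: leeD; first exact: dP.
apply: le_trans (measureU2 _ _ _) _; [exact: measurableI|exact: measurableI|].
rewrite EFinD; apply: leeD; first exact: muN.
apply: le_trans muN.
rewrite -(lebesgue_rV_translate z (_ : measurable (B `&` E))); last exact: measurableI.
apply: le_measure; rewrite ?inE.
- exact: measurableI.
- by apply: measurable_translate_preimage; exact: measurableI.
- move=> x [cx Ex]; split => //= i; rewrite !mxE.
  have := cx i; have := coord_le_norm z i; have := z1.
  rewrite [X in `|X| < r + 1](_ : _ = (x ord0 i - c ord0 i) + z ord0 i); last by ring.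
  move=> a1 a2 a3; rewrite (le_lt_trans (ler_normD _ _))//; lra.
Qed.

End borel.

(** * Continuity of translations in Lebesgue spaces *)

Section translation_continuity.
Variables (R : realType) (n : nat).
Local Notation mu := (@lebesgue_rV R n).

Lemma measurable_strip (i : 'I_n) (a d : R) :
  measurable [set x : 'rV[R]_n | `|x ord0 i - a| <= d].
Proof.
rewrite (_ : [set _ | _] = [set x : 'rV[R]_n | (`[a - d, a + d]%classic : set (measurableTypeR R)) (x ord0 i)]).
  by apply: (@measurable_coord_preimage R n i `[a - d, a + d]%classic); exact: measurable_itv.
by apply/seteqP; split => x /=; rewrite in_itv /= ler_distl.
Qed.

Lemma strip_measure (c : 'rV[R]_n) (r : R) (i : 'I_n) : 0 < r ->
  exists2 P : R, 0 <= P & forall a d : R, 0 <= d ->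
   (mu (cube c r `&` [set x | (`|x ord0 i - a| <= d)%R]) <= (2 * d * P)%:E)%E.
Proof.
move=> r0; exists (\prod_(j | j != i) (2 * r)); first by apply: prodr_ge0 => j _; rewrite mulr_ge0 ?ltW.
move=> a d d0.
pose B (j : 'I_n) : set (measurableTypeR R) :=
  if j == i then `[a - d, a + d]%classic else ball (c ord0 j) r.
have mB j : measurable (B j).
  by rewrite /B; case: ifP => _; [exact: measurable_itv|exact: measurable_ball].
have lB j : @lebesgue_measure R (B j) = (if j == i then 2 * d else 2 * r)%:E.
  rewrite /B; case: ifP => _; last by rewrite lebesgue_measure_ball ?mulr_natl// ltW.
  rewrite lebesgue_measure_itv /= lte_fin -EFinD; case: ifPn => h; congr EFin; first by ring.
  apply/eqP; rewrite eq_sym mulf_eq0 pnatr_eq0 /=; apply/eqP; lra.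
have := lebesgue_rV_box mB lB; rewrite (bigD1 i)//= eqxx.
rewrite (eq_bigr (fun=> 2 * r)); last by move=> j /negbTE ->.
move=> <-; apply: le_measure; rewrite ?inE.
- by apply: measurableI; [exact: measurable_cube|exact: measurable_strip].
- exact: measurable_coord_forall.
- move=> x [cx /= xi] j; rewrite /B; case: eqP => [->|_].
    by rewrite /= in_itv /= -ler_distl.
  by have := cx j; rewrite /ball /= distrC.
Qed.

(** It suffices to treat the preimage of a half-open interval under a
    coordinate: translating it by z alters it only within |z| of the two
    bounding hyperplanes. *)
Lemma translation_continuous_measurable (A : set 'rV[R]_n) : measurable A -> translation_continuous A.
Proof.
pose coord (i : 'I_n) (x : 'rV[R]_n) : measurableTypeR R := x ord0 i.
suff : g_sigma_preimage coord `<=` @translation_continuous R n by apply.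
apply: smallest_sub => /=.
  split=> [|B mB|F mF] /=; first exact: translation_continuous0.
  - by rewrite setTD; exact: translation_continuousC.
  - exact: translation_continuous_bigcup.
rewrite -bigcup_seq => _ [i _ [C mC <-]] /=; rewrite setTI.
have : <<s (@ocitv R) >> `<=` [set C | translation_continuous (coord i @^-1` C)].
  apply: smallest_sub => /=.
    split=> [|B mB|F mF] /=; first by rewrite preimage_set0; exact: translation_continuous0.
    - by rewrite setTD preimage_setC; exact: translation_continuousC.
    - by rewrite preimage_bigcup; exact: translation_continuous_bigcup.
  move=> _ [[a b]] _ <- /=; split.
    by apply: (@measurable_coord_preimage R n i `]a, b]%classic); exact: measurable_itv.
  move=> c r e r0 e0; have [P P0 HP] := strip_measure c i r0.
  pose d := e / (4 * (P + 1)).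
  have d0 : 0 < d by rewrite divr_gt0// mulr_gt0// ltr_wpDl.
  exists d => // z zd.
  have dP : 2 * d * P <= e / 2.
    rewrite /d (_ : 2 * _ * P = e / 2 * (P / (P + 1))); last by field; rewrite gt_eqF// ltr_wpDl.
    have P1 : P / (P + 1) <= 1 by rewrite ler_pdivrMr ?ltr_wpDl// mul1r lerDl.
    by rewrite ler_piMr// ltW// divr_gt0.
  have zi : `|z ord0 i| < d by apply: le_lt_trans zd; exact: coord_le_norm.
  have mS a' : measurable (cube c r `&` [set x : 'rV[R]_n | `|x ord0 i - a'| <= d]).
    by apply: measurableI; [exact: measurable_cube|exact: measurable_strip].
  apply: (@le_trans _ _ (mu ((cube c r `&` [set x | `|x ord0 i - a| <= d]) `|`
                             (cube c r `&` [set x | `|x ord0 i - b| <= d])))).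
    apply: le_measure; rewrite ?inE.
    - apply: measurableI; first exact: measurable_cube.
      apply: measurable_translate_diff; apply: (@measurable_coord_preimage R n i `]a, b]%classic); exact: measurable_itv.
    - by apply: measurableU; exact: mS.
    - move=> x [cx]; rewrite /translate_diff /coord /= !in_itv /= !mxE => H.
      suff [?|?] : `|x ord0 i - a| <= d \/ `|x ord0 i - b| <= d by [left|right].
      rewrite !ler_distl.
      have /andP[z1 z2] : - d < z ord0 i < d by rewrite -ltr_norml.
      move: H; have [|] := lerP (x ord0 i) b; have [|] := ltrP a (x ord0 i);
      have [|] := lerP (x ord0 i + z ord0 i) b; have [|] := ltrP a (x ord0 i + z ord0 i) => /=; try lra;
      move=> *; first [left; apply/andP; split; lra | right; apply/andP; split; lra|tauto].
  apply: le_trans (measureU2 _ _ _) _; [exact: mS|exact: mS|].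
  rewrite (splitr e) EFinD; apply: leeD; apply: le_trans (HP _ _ (ltW d0)) _; by rewrite lee_fin.
by apply; exact: mC.
Qed.

Lemma translate_diff_indic (A : set 'rV[R]_n) x z :
  `|\1_A (x + z) - \1_A x| = \1_(translate_diff A z) x :> R.
Proof.
rewrite !indicE.
have [h1|h1] := pselect (A (x + z)); have [h2|h2] := pselect (A x).
- rewrite (mem_set h1) (mem_set h2) memNset ?subrr ?normr0//; rewrite /translate_diff /=; tauto.
- rewrite (mem_set h1) (memNset h2) mem_set ?subr0 ?normr1//; rewrite /translate_diff /=; tauto.
- rewrite (memNset h1) (mem_set h2) mem_set ?sub0r ?normrN ?normr1//; rewrite /translate_diff /=; tauto.
- rewrite (memNset h1) (memNset h2) memNset ?subrr ?normr0//; rewrite /translate_diff /=; tauto.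
Qed.

Lemma uniform_translation_continuous (l : seq (set 'rV[R]_n)) (c : 'rV[R]_n) (r e : R) : 0 < r -> 0 < e ->
  (forall A, A \in l -> measurable A) -> exists2 d : R, 0 < d &
    forall z : 'rV[R]_n, `|z| < d -> forall A, A \in l -> (mu (cube c r `&` translate_diff A z) <= e%:E)%E.
Proof.
move=> r0 e0; elim: l => [|A l IH] ml; first by exists 1.
have [|d d0 dP] := IH; first by move=> B Bl; apply: ml; rewrite inE Bl orbT.
have /translation_continuous_measurable[_ /(_ c r e r0 e0)[d' d'0 d'P]] : measurable A by apply: ml; rewrite inE eqxx.
exists (Num.min d d'); first by rewrite lt_min d0.
move=> z; rewrite lt_min => /andP[zd zd'] B; rewrite inE => /orP[/eqP ->|Bl].
  exact: d'P.
exact: dP.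
Qed.

Import HBSimple.

(** Reduction to finitely many sets: the indicator of A changes under
    translation exactly on translate_diff A z. *)
Lemma sfun_translate (s : {sfun 'rV[R]_n >-> R}) (c : 'rV[R]_n) (r e : R) : 0 < r -> 0 < e ->
  exists2 d : R, 0 < d & forall z : 'rV[R]_n, `|z| < d ->
   (\int[mu]_(x in cube c r) (`|s (x + z)%R - s x|%R)%:E <= e%:E)%E.
Proof.
move=> r0 e0.
pose l := finmap.enum_fset (fset_set (range s)).
pose K := \sum_(t <- l) `|t|.
have K0 : 0 <= K by apply: sumr_ge0.
have e10 : 0 < e / (K + 1) by rewrite divr_gt0// ltr_wpDl.
have [|d d0 dP] := @uniform_translation_continuous [seq s @^-1` [set t] | t <- l] c r _ r0 e10.
  by move=> A /mapP[t _ ->]; exact: measurable_sfunP.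
exists d => // z zd.
have sE x : s x = \sum_(t <- l) t * \1_(s @^-1` [set t]) x.
  by rewrite fimfunE fsbig_finite//; exact: fimfunP.
have le x : `|s (x + z) - s x| <= \sum_(t <- l) `|t| * \1_(translate_diff (s @^-1` [set t]) z) x.
  rewrite !sE -sumrB; apply: le_trans (ler_norm_sum _ _ _) _; apply: ler_sum => t _.
  by rewrite -mulrBr normrM translate_diff_indic.
have mt t : measurable (translate_diff (s @^-1` [set t]) z).
  by apply: measurable_translate_diff; exact: measurable_sfunP.
apply: (@le_trans _ _ (\int[mu]_(x in cube c r) \sum_(t <- l) (`|t| * \1_(translate_diff (s @^-1` [set t]) z) x)%:E)%E).
  apply: ge0_le_integral => //.
  - exact: measurable_cube.
  - apply/measurable_EFinP/measurableT_comp => //; apply: measurable_funB.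
      by apply: measurable_funTS; apply: measurableT_comp => //; exact: measurable_translate.
    by apply: measurable_funTS.
  - under eq_fun do rewrite sumEFin; apply/measurable_EFinP; apply: measurable_sum => t.
    by apply: measurable_funM => //; exact: measurable_indic.
  - by move=> x _; rewrite sumEFin lee_fin.
have mc := measurable_cube c r.
rewrite ge0_integral_sum//; last first.
  by move=> t; apply/measurable_EFinP; apply: measurable_funM => //; exact: measurable_indic.
apply: (@le_trans _ _ (\sum_(t <- l) (`|t| * (e / (K + 1)))%:E)%E).
  rewrite !big_seq; apply: lee_sum => t tl.
  under eq_integral do rewrite EFinM.
  rewrite ge0_integralZl//; last by apply/measurable_EFinP; exact: measurable_indic.
  rewrite EFinM; apply: lee_wpmul2l; first by rewrite lee_fin.
  rewrite integral_indic//.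
  by rewrite setIC; apply: dP => //; exact: map_f.
rewrite sumEFin lee_fin -mulr_suml -/K mulrCA ler_piMr//; first exact: ltW.
by rewrite ler_pdivrMr ?ltr_wpDl// mul1r lerDl.
Qed.

(** Approximation by a simple function s, the integral of |h - s| being
    invariant under translation. *)
Lemma L1_translate (h : 'rV[R]_n -> R) (c : 'rV[R]_n) (r e : R) :
  mu.-integrable setT (EFin \o h) -> (forall x, ~ cube c r x -> h x = 0) -> 0 < r -> 0 < e ->
  exists2 d : R, 0 < d & forall z : 'rV[R]_n, `|z| < d ->
   (\int[mu]_x (`|h (x + z)%R - h x|%R)%:E <= e%:E)%E.
Proof.
move=> ih h0 r0 e0.
have [g [ig gh /fine_cvgP[gfin /cvgrPdist_lt cg]]] := approximation_sfun_integrable measurableT ih.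
have e30 : 0 < e / 3 by rewrite divr_gt0.
have [N _ NP] := filterI gfin (cg _ e30).
have [fin] := NP N (leqnn N); rewrite /= sub0r normrN => gN.
set s := g N in fin gN.
have hs : (\int[mu]_x (`|h x - s x|%R)%:E <= (e / 3)%:E)%E.
  move: fin gN; under eq_integral do rewrite -EFinB abse_EFin.
  by move=> fin gN; rewrite -(fineK fin) lee_fin; apply: le_trans (ltW gN); exact: ler_norm.
have r10 : 0 < r + 1 by rewrite addr_gt0.
have [d d0 dP] := sfun_translate s c r10 e30.
exists (Num.min d 1); first by rewrite lt_min d0 /=.
move=> z; rewrite lt_min => /andP[zd z1].
have mh : measurable_fun setT h by have /integrableP[/measurable_EFinP] := ih.
have ms : measurable_fun setT s by [].
have mT := measurable_translate z.
have mhs : measurable_fun setT (fun x => `|h x - s x|).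
  by apply: measurableT_comp => //; exact: measurable_funB.
have mhsz : measurable_fun setT (fun x : 'rV[R]_n => `|h (x + z) - s (x + z)|).
  exact: (measurableT_comp mhs mT).
have mhz : measurable_fun setT (fun x : 'rV[R]_n => `|h (x + z) - h x|).
  by apply: measurableT_comp => //; apply: measurable_funB => //; exact: (measurableT_comp mh mT).
have msz : measurable_fun setT (fun x : 'rV[R]_n => `|s (x + z) - s x|).
  by apply: measurableT_comp => //; apply: measurable_funB => //; exact: (measurableT_comp ms mT).
have mc := measurable_cube c (r + 1).
rewrite (_ : (\int[mu]_x _)%E = (\int[mu]_(x in cube c (r + 1)) (`|h (x + z)%R - h x|%R)%:E)%E); last first.
  rewrite [RHS]integral_mkcond; apply: eq_integral => x _; rewrite patchE.
  case: ifPn => // /negP; rewrite inE => nc.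
  rewrite !h0 ?subrr ?normr0//.
    by apply: contra_not nc; apply: sub_cube => i; rewrite subrr normr0 add0r lerDl.
  apply: contra_not nc => cx i; have := cx i; have := coord_le_norm z i.
  rewrite !mxE => a1 a2; rewrite (_ : _ - _ = x ord0 i + z ord0 i - c ord0 i - z ord0 i); last by ring.
  rewrite (le_lt_trans (ler_normB _ _))//; lra.
apply: (@le_trans _ _ (\int[mu]_(x in cube c (r + 1)) ((`|h (x + z)%R - s (x + z)%R|%R)%:E +
   ((`|s (x + z)%R - s x|%R)%:E + (`|h x - s x|%R)%:E)))%E).
  apply: ge0_le_integral => //.
  - by apply/measurable_EFinP; exact: measurable_funTS.
  - by apply: emeasurable_funD; [|apply: emeasurable_funD]; apply/measurable_EFinP; exact: measurable_funTS.
  - move=> x _; rewrite -!EFinD lee_fin.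
    rewrite [`|h x - s x|]distrC (_ : h (x + z) - h x = (h (x + z) - s (x + z)) + ((s (x + z) - s x) + (s x - h x))); last by ring.
    by apply: le_trans (ler_normD _ _) _; rewrite lerD2l; exact: ler_normD.
rewrite ge0_integralD//; last 3 first.
- by apply/measurable_EFinP; exact: measurable_funTS.
- by move=> x _; rewrite adde_ge0.
- by apply: emeasurable_funD; apply/measurable_EFinP; exact: measurable_funTS.
rewrite ge0_integralD//; last 2 first.
- by apply/measurable_EFinP; exact: measurable_funTS.
- by apply/measurable_EFinP; exact: measurable_funTS.
rewrite (_ : e = e / 3 + (e / 3 + e / 3)); last by field.
rewrite !EFinD; apply: leeD; last apply: leeD.
- apply: le_trans hs; rewrite -(@ge0_integral_translate R n z (fun x => (`|h x - s x|%R)%:E))//; last first.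
    exact/measurable_EFinP.
  by apply: ge0_subset_integral => //; apply/measurable_EFinP.
- exact: dP.
- by apply: le_trans hs; apply: ge0_subset_integral => //; apply/measurable_EFinP.
Qed.

Lemma exprD_superadd (x y : R) p : 0 <= x -> 0 <= y -> x ^+ p.+1 + y ^+ p.+1 <= (x + y) ^+ p.+1.
Proof.
move=> x0 y0; elim: p => [|p IH]; first by rewrite !expr1.
rewrite exprS [y ^+ _]exprS [leRHS]exprS.
apply: le_trans (_ : (x + y) * (x ^+ p.+1 + y ^+ p.+1) <= _); last first.
  by apply: ler_wpM2l IH; exact: addr_ge0.
have : 0 <= x * y ^+ p.+1 by rewrite mulr_ge0 ?exprn_ge0.
have : 0 <= y * x ^+ p.+1 by rewrite mulr_ge0 ?exprn_ge0.
rewrite mulrDr !mulrDl; lra.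
Qed.

(** The signed power a |a|^p turns increments in L^1 into increments in L^(p+1).
    *)
Lemma norm_pow_sub (a b : R) p :
  `|a - b| ^+ p.+1 <= 2 ^+ p.+1 * `|a * `|a| ^+ p - b * `|b| ^+ p|.
Proof.
have two1 : 1 <= 2 ^+ p.+1 :> R by rewrite exprn_ege1// ler1n.
wlog ba : a b / b <= a.
  move=> H; case/orP: (le_total b a) => [/H //|/H].
  by rewrite distrC [X in _ <= _ * X -> _]distrC.
have pos (x y : R) : 0 <= y -> y <= x -> `|x - y| ^+ p.+1 <= 2 ^+ p.+1 * `|x * `|x| ^+ p - y * `|y| ^+ p|.
  move=> y0 yx; have x0 : 0 <= x by exact: le_trans yx.
  rewrite !ger0_norm ?subr_ge0//; last by rewrite -!exprS lerXn2r.
  rewrite -!exprS; apply: le_trans (_ : x ^+ p.+1 - y ^+ p.+1 <= _).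
    by rewrite lerBrDr; apply: le_trans (exprD_superadd _ _ _) _; rewrite ?subr_ge0 ?subrK.
  by rewrite ler_peMl// subr_ge0 lerXn2r.
have [b0|b0] := lerP 0 b; first exact: pos.
have [a0|a0] := lerP 0 a; last first.
  have := pos (- b) (- a); rewrite !normrN oppr_ge0 lerN2 => /(_ (ltW a0) ba).
  by rewrite opprK (addrC (- b)) !mulNr opprK [in X in _ -> _ <= X]addrC.
rewrite (ger0_norm a0) (ltr0_norm b0).
have nb0 : 0 <= - b by rewrite oppr_ge0 ltW.
rewrite ger0_norm ?subr_ge0// ger0_norm; last first.
  by rewrite -mulNr addr_ge0// mulr_ge0// exprn_ge0.
pose m := Num.max a (- b).
have m0 : 0 <= m by rewrite le_max a0.
apply: le_trans (_ : (2 * m) ^+ p.+1 <= _).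
  apply: lerXn2r; rewrite ?nnegrE ?subr_ge0 ?mulr_ge0//.
  by rewrite mulr_natl mulr2n; apply: lerD; rewrite le_max lexx ?orbT.
rewrite exprMn ler_pM2l ?exprn_gt0//.
have -> : a * a ^+ p - b * (- b) ^+ p = a ^+ p.+1 + (- b) ^+ p.+1 by rewrite !exprS; ring.
by rewrite /m; case: (leP a (- b)) => _; [rewrite lerDr|rewrite lerDl]; rewrite exprn_ge0.
Qed.

(** The function g |g|^p is in L^1, and by norm_pow_sub its increments dominate
    the powers of those of g. *)
Lemma Lp_translate (p : nat) (g : 'rV[R]_n -> R) (c : 'rV[R]_n) (r e : R) :
  measurable_fun setT g -> (\int[mu]_x (`|g x| ^+ p.+1)%:E < +oo)%E ->
  (forall x, ~ cube c r x -> g x = 0) -> 0 < r -> 0 < e ->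
  exists2 d : R, 0 < d & forall z : 'rV[R]_n, `|z| < d ->
   (\int[mu]_x (`|g (x + z)%R - g x| ^+ p.+1)%:E <= e%:E)%E.
Proof.
move=> mg ig g0 r0 e0.
pose h x := g x * `|g x| ^+ p.
have mh : measurable_fun setT h.
  by apply: measurable_funM => //; apply: measurable_funX; exact: measurableT_comp.
have ih : mu.-integrable setT (EFin \o h).
  apply/integrableP; split; first exact/measurable_EFinP.
  apply: le_lt_trans ig; rewrite le_eqVlt; apply/orP; left; apply/eqP.
  by apply: eq_integral => x _; rewrite /= /h normrM normrX normr_id exprS.
have h0 x : ~ cube c r x -> h x = 0 by move=> /g0 e1; rewrite /h e1 mul0r.
have p0 : 0 < 2 ^+ p.+1 :> R by rewrite exprn_gt0.
have [d d0 dP] := L1_translate ih h0 r0 (divr_gt0 e0 p0).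
exists d => // z zd; have := dP z zd.
have mT := measurable_translate z.
rewrite -(@lee_pmul2l _ (2 ^+ p.+1)%:E)// -EFinM mulrC divfK ?gt_eqF//; apply: le_trans.
rewrite -ge0_integralZl//; last first.
  apply/measurable_EFinP; apply: measurableT_comp => //; apply: measurable_funB => //.
  exact: (measurableT_comp mh mT).
apply: ge0_le_integral => //.
- apply/measurable_EFinP; apply: measurable_funX; apply: measurableT_comp => //; apply: measurable_funB => //.
  exact: (measurableT_comp mg mT).
- apply: emeasurable_funM => //; apply/measurable_EFinP; apply: measurableT_comp => //; apply: measurable_funB => //.
  exact: (measurableT_comp mh mT).
- by move=> x _; rewrite lee_fin; exact: norm_pow_sub.
Qed.

End translation_continuity.

(** * Smooth bumps on the line *)

Section flat_exponential.
Variable R : realType.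

(** Functions of this form include exp(-1/t), extended by 0, and are stable
    under differentiation. *)
Definition flatexp (p : {poly R}) (t : R) : R :=
  if 0 < t then p.[t^-1] * expR (- t^-1) else 0.

Lemma expr_expRN_bound (m : nat) (s : R) : 0 <= s -> s ^+ m * expR (- s) <= (m`!)%:R.
Proof.
move=> s0; rewrite expRN ler_pdivrMr ?expR_gt0//.
case: m => [|m]; first by rewrite expr0 fact0 mul1r; apply: le_trans (expR_ge1Dx _); rewrite lerDl.
have := expR_ge1Dxn m s0; have f0 : (0 : R) < (m.+1`!)%:R by rewrite ltr0n fact_gt0.
rewrite -(ler_pM2l f0); apply: le_trans.
by rewrite mulrDr mulrCA divff ?gt_eqF// !mulr1 lerDr ltW.
Qed.

Lemma poly_expRN_bound (p : {poly R}) : exists2 C : R, 0 <= C &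
  forall s, 0 <= s -> `|p.[s]| * expR (- s) <= C.
Proof.
exists (\sum_(i < size p) `|p`_i| * (i`!)%:R).
  by apply: sumr_ge0 => i _; rewrite mulr_ge0.
move=> s s0; rewrite horner_coef.
apply: le_trans (_ : (\sum_(i < size p) `|p`_i * s ^+ i|) * expR (- s) <= _).
  by rewrite ler_wpM2r ?expR_ge0// ler_norm_sum.
rewrite mulr_suml; apply: ler_sum => i _.
rewrite normrM [`|s ^+ i|]ger0_norm ?exprn_ge0// -mulrA ler_wpM2l//.
exact: expr_expRN_bound.
Qed.

Lemma flatexp_bound p : exists2 C : R, 0 <= C & forall t, `|flatexp p t| <= C.
Proof.
have [C C0 HC] := poly_expRN_bound p; exists C => // t.
rewrite /flatexp; case: ifPn => t0; last by rewrite normr0.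
rewrite normrM (ger0_norm (expR_ge0 _)); apply: HC.
by rewrite invr_ge0 ltW.
Qed.

(** Trading a degree for a factor t gives continuity and differentiability at 0.
    *)
Lemma flatexp_X p t : flatexp p t = flatexp (p * 'X) t * t.
Proof.
rewrite /flatexp; case: ifPn => t0; last by rewrite mul0r.
by rewrite hornerM hornerX; field; rewrite gt_eqF.
Qed.

Lemma flatexp_le0 p t : t <= 0 -> flatexp p t = 0.
Proof. by rewrite /flatexp leNgt => /negbTE ->. Qed.

Lemma flatexp_cont0 (p : {poly R}) : {for (0 : R), continuous (flatexp p)}.
Proof.
have [C C0 HC] := flatexp_bound (p * 'X).
have C1 : 0 < C + 1 by rewrite ltr_wpDl.
rewrite /prop_for /continuous_at (flatexp_le0 _ (lexx 0)); apply/cvgr0Pnorm_le => e e0.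
have d0 : 0 < (C + 1)^-1 * e by rewrite mulr_gt0// invr_gt0.
exists ((C + 1)^-1 * e) => // t; rewrite /ball_ /= sub0r normrN => te; rewrite flatexp_X normrM.
apply: le_trans (_ : (C + 1) * `|t| <= _).
  by rewrite ler_wpM2r// (le_trans (HC t))// lerDl.
by rewrite -ler_pdivlMl// ltW.
Qed.

Lemma flatexp_derive (p : {poly R}) (t : R) :
  is_derive t 1 (flatexp p) (flatexp ((p - p^`()) * 'X^2) t).
Proof.
have [t0|t0|->] := ltgtP t 0.
- rewrite flatexp_le0 ?ltW//.
  have H : {near t, cst 0 =1 flatexp p}.
    have := @lt_nbhsl _ t 0 t0; apply: filterS => s /ltW s0.
    by rewrite flatexp_le0.
  split; first by apply: near_eq_derivable H _; exact: derivable_cst.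
  by rewrite -(near_eq_derive _ H) ?derive_cst//.
- have H : {near t, (horner p \o GRing.inv) * (expR \o (fun s => - s^-1)) =1 flatexp p}.
    near=> s; have s0 : 0 < s by near: s; exact: lt_nbhsr.
    by rewrite /flatexp s0.
  have tn0 : t != 0 by rewrite gt_eqF.
  have dV : is_derive t 1 (@GRing.inv R) (- t ^- 2).
    have := @is_deriveV R id t 1 1 tn0 (is_derive_id _ _).
    by rewrite /GRing.scale/= mulr1.
  have dNV : is_derive t 1 (fun s => - s^-1) (t ^- 2).
    by have := is_deriveN dV; rewrite opprK.
  have D1 := is_derive1_comp (is_derive_poly p t^-1) dV.
  have D2 := @is_derive1_comp _ expR (fun s => - s^-1) _ _ _ (is_derive_expR (- t^-1)) dNV.
  have [D D'] := is_deriveM D1 D2.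
  split; first exact: near_eq_derivable H D.
  rewrite -(near_eq_derive _ H)// D' /flatexp t0 /= /GRing.scale /=.
  rewrite hornerM hornerXn hornerD hornerN exprVn; ring.
- rewrite flatexp_le0//; apply/is_derive1_caratheodory.
  exists (flatexp (p * 'X)); split => [z||].
  + by rewrite (flatexp_le0 _ (lexx 0)) !subr0; exact: flatexp_X.
  + exact: flatexp_cont0.
  + by rewrite flatexp_le0.
Unshelve. all: by end_near. Qed.

(** D m is the m-th derivative of D 0. Carrying the sequence of all derivatives,
    with bounds, avoids iterating a differential operator. *)
Definition smooth_seq (D : nat -> R -> R) : Prop :=
  (forall m (t : R), is_derive t 1 (D m) (D m.+1 t)) /\
  (forall m, exists2 C : R, 0 <= C & forall t, `|D m t| <= C).

Lemma flatexp_smooth_seq : exists2 D, D 0%N = flatexp 1 &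
  smooth_seq D /\ forall m t, t <= 0 -> D m t = 0.
Proof.
pose P m := iter m (fun p : {poly R} => (p - p^`()) * 'X^2) 1.
exists (fun m => flatexp (P m)) => //; split; last by move=> m t; exact: flatexp_le0.
by split=> [m t|m]; [exact: flatexp_derive|exact: flatexp_bound].
Qed.

Lemma smooth_seq_affine D a b : smooth_seq D ->
  smooth_seq (fun m t => a ^+ m * D m (a * t + b)).
Proof.
move=> [dD bD]; split=> [m t|m].
  have H : is_derive t 1 (fun s => a * s + b) a.
    have H1 := is_deriveZ a (is_derive_id t (1 : R)).
    have := is_deriveD H1 (is_derive_cst b t 1).
    by rewrite addr0 /GRing.scale/= mulr1.
  have := is_deriveZ (a ^+ m) (@is_derive1_comp _ (D m) (fun s => a * s + b) _ _ _ (dD m (a * t + b)) H).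
  by rewrite /GRing.scale /= [_ * a]mulrC mulrA -exprSr.
have [C C0 HC] := bD m; exists (`|a| ^+ m * C); first by rewrite mulr_ge0 ?exprn_ge0.
by move=> t; rewrite normrM normrX ler_wpM2l ?exprn_ge0.
Qed.

(** A list of pairs of orders (a, b) stands for the sum of the products D a * E
    b; this is the derivation on such lists. *)
Fixpoint leibniz (l : seq (nat * nat)) : seq (nat * nat) :=
  if l is p :: l' then [:: (p.1.+1, p.2), (p.1, p.2.+1) & leibniz l'] else [::].

(** The last clause keeps track of supports at all orders of derivation. *)
Lemma smooth_seqM D E : smooth_seq D -> smooth_seq E ->
  exists2 F, F 0%N = (fun t => D 0%N t * E 0%N t) &
    smooth_seq F /\ forall t, (forall m, D m t = 0) \/ (forall m, E m t = 0) ->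
      forall m, F m t = 0.
Proof.
move=> [dD bD] [dE bE].
pose S l t := \sum_(p <- l) D p.1 t * E p.2 t.
have dS l (t : R) : is_derive t 1 (S l) (S (leibniz l) t).
  elim: l => [|p l IH].
    rewrite /S /= big_nil (_ : (fun _ => _) = cst 0) ?is_derive_cst//; last first.
      by apply/funext => s; rewrite big_nil.
    exact: is_derive_cst.
  rewrite (_ : S (p :: l) = D p.1 * E p.2 + S l); last first.
    by apply/funext => s; rewrite /S big_cons.
  have := is_deriveD (is_deriveM (dD p.1 t) (dE p.2 t)) IH.
  rewrite /S /= !big_cons /= /GRing.scale /= => H.
  by apply: is_derive_eq H _; ring.
have bS l : exists2 C : R, 0 <= C & forall t, `|S l t| <= C.
  elim: l => [|p l [C C0 IH]].
    by exists 0 => // t; rewrite /S big_nil normr0.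
  have [A A0 HA] := bD p.1; have [B B0 HB] := bE p.2.
  exists (A * B + C); first by rewrite addr_ge0 ?mulr_ge0.
  move=> t; rewrite /S big_cons (le_trans (ler_normD _ _))//.
  by apply: lerD; [rewrite normrM ler_pM|exact: IH].
exists (fun m => S (iter m leibniz [:: (0%N, 0%N)])).
  by apply/funext => t; rewrite /S /= big_seq1.
split; first by split=> [m t|m]; [exact: dS|exact: bS].
move=> t H m; rewrite /S big1// => p _.
by case: H => ->; rewrite ?mul0r ?mulr0.
Qed.

(** exp(-1/(e + t)) exp(-1/(e - t)) on ]-e, e[, extended by 0. *)
Lemma bump_exists (e : R) : 0 < e -> exists D, [/\ smooth_seq D,
  forall m t, e <= `|t| -> D m t = 0, forall t, 0 <= D 0%N t &
  forall t, `|t| < e -> 0 < D 0%N t].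
Proof.
move=> e0; have [D D0 [sD zD]] := flatexp_smooth_seq.
have [F F0 [sF zF]] := smooth_seqM (smooth_seq_affine 1 e sD) (smooth_seq_affine (-1) e sD).
exists F; split => //.
- move=> m t et; apply: zF; move: et; rewrite ler_normr => /orP[et|et]; [right|left] => k;
  by rewrite zD ?mulr0//; lra.
- move=> t; rewrite F0 !expr0 !mul1r D0 mulr_ge0// /flatexp; case: ifP => // _; rewrite hornerC mul1r expR_ge0//.
- move=> t; rewrite ltr_norml => /andP[t1 t2]; rewrite F0 !expr0 !mul1r D0 /flatexp.
  have -> : 0 < t + e by lra.
  have -> : 0 < -1 * t + e by lra.
  by rewrite !hornerC !mul1r mulr_gt0// expR_gt0.
Qed.

End flat_exponential.

(** * Tensor products of functions of one variable *)

Section tensor_products.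
Variables (R : realType) (n : nat).
Implicit Types (D : 'I_n -> nat -> R -> R) (m : 'I_n -> nat).

(** Directional derivatives are derivatives along lines, which makes the rules
    of one-variable calculus available. *)
Lemma is_derive_lineP (f : 'rV[R]_n -> R) (x v : 'rV[R]_n) (t df : R) :
  is_derive t 1 (fun h : R => f (h *: v + x)) df <-> is_derive (t *: v + x) v f df.
Proof.
have E : (fun h : R => h^-1 *: (((fun h0 : R => f (h0 *: v + x)) \o shift t) (h *: 1) - f (t *: v + x)))
   = (fun h : R => h^-1 *: ((f \o shift (t *: v + x)) (h *: v) - f (t *: v + x))).
  apply/funext => h; congr (_ *: (_ - _)).
  have -> : h *: (1 : R) = h by exact: mulr1.
  by rewrite /= scalerDl addrA.
split=> -[H1 H2]; split; move: H1 H2; by rewrite /derivable /derive E.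
Qed.

Lemma is_derive_line (f : 'rV[R]_n -> R) (x v : 'rV[R]_n) (df : R) :
  is_derive (0 : R) 1 (fun h : R => f (h *: v + x)) df -> is_derive x v f df.
Proof. by move=> /is_derive_lineP; rewrite scale0r add0r. Qed.

Lemma is_derive_prod_seq (I : eqType) (g : I -> R -> R) (dg : I -> R) (t : R) (r : seq I) :
  uniq r -> (forall k, is_derive t 1 (g k) (dg k)) ->
  is_derive t 1 (fun s => \prod_(k <- r) g k s)
    (\sum_(j <- r) \prod_(k <- r) (if k == j then dg k else g k t)).
Proof.
move=> + H; elim: r => [_|a r IH /= /andP[ar ur]].
  rewrite big_nil (_ : (fun _ => _) = cst 1); first exact: is_derive_cst.
  by apply/funext => s; rewrite big_nil.
rewrite (_ : (fun s => _) = g a * (fun s => \prod_(k <- r) g k s)); last first.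
  by apply/funext => s; rewrite big_cons.
have := is_deriveM (H a) (IH ur).
rewrite /GRing.scale /= => H'; apply: is_derive_eq H' _.
rewrite big_cons big_cons eqxx addrC mulrC; congr (_ * _ + _).
  rewrite big_seq [RHS]big_seq; apply: eq_bigr => k kr.
  by case: eqP => // e; rewrite -e kr in ar.
rewrite mulr_sumr; apply: eq_big_seq => j jr.
rewrite big_cons; case: eqP => // e; by rewrite e jr in ar.
Qed.

(** When D k is a sequence of successive derivatives, this is the derivative of
    multi-order m of the tensor product of the functions D k 0. *)
Definition prodf D m (x : 'rV[R]_n) : R := \prod_k D k (m k) (x ord0 k).

(** The multi-index m + e_j. *)
Definition incr m (j : 'I_n) : 'I_n -> nat := fun k => (m k + (k == j))%N.

Lemma incrC m i j : incr (incr m i) j = incr (incr m j) i.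
Proof. by apply/funext => k; rewrite /incr addnAC. Qed.

Lemma prodf_derive_at D m (x v : 'rV[R]_n) :
  (forall k (t : R), is_derive t 1 (D k (m k)) (D k (m k).+1 t)) ->
  is_derive x v (prodf D m) (\sum_j v ord0 j * prodf D (incr m j) x).
Proof.
move=> dD; apply: is_derive_line.
pose g k (s : R) := D k (m k) (s * v ord0 k + x ord0 k).
have H k : is_derive (0 : R) 1 (g k) (D k (m k).+1 (x ord0 k) * v ord0 k).
  have Ha : is_derive (0 : R) 1 (fun s : R => v ord0 k * s + x ord0 k) (v ord0 k).
    have := is_deriveD (is_deriveZ (v ord0 k) (is_derive_id (0 : R) (1 : R))) (is_derive_cst (x ord0 k) (0 : R) 1).
    by rewrite addr0 /GRing.scale/= mulr1.
  have := @is_derive1_comp _ (D k (m k)) (fun s => v ord0 k * s + x ord0 k) _ _ _ (dD k _) Ha.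
  rewrite mulr0 add0r; congr is_derive.
  by apply/funext => s; rewrite /g /= mulrC.
rewrite (_ : (fun h : R => _) = fun s => \prod_k g k s); last first.
  by apply/funext => h; apply: eq_bigr => k _; rewrite !mxE.
apply: is_derive_eq (is_derive_prod_seq (index_enum_uniq _) H) _.
apply: eq_bigr => j _; rewrite (bigD1 j)//= eqxx /prodf [in RHS](bigD1 j)//= /incr eqxx addn1.
rewrite [D j _ _ * _]mulrC -mulrA; congr (_ * (_ * _)); apply: eq_bigr => k /negbTE ->.
by rewrite addn0 /g mul0r add0r.
Qed.

Lemma prodf_derive D m (x v : 'rV[R]_n) : (forall k, smooth_seq (D k)) ->
  is_derive x v (prodf D m) (\sum_j v ord0 j * prodf D (incr m j) x).
Proof. by move=> sD; apply: prodf_derive_at => k t; have [] := sD k. Qed.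

Lemma smooth_seq_cont (D : nat -> R -> R) k : smooth_seq D -> continuous (D k).
Proof.
move=> [dD _] t; apply: differentiable_continuous; apply/derivable1_diffP.
exact: ex_derive.
Qed.

Lemma continuous_coord (f : R -> R) (k : 'I_n) : continuous f ->
  continuous (fun x : 'rV[R]_n => f (x ord0 k)).
Proof.
move=> cf x; apply: (@continuous_comp _ _ _ (fun x : 'rV[R]_n => x ord0 k) f); last exact: cf.
exact: coord_continuous.
Qed.

Lemma continuous_prod_seq (T : topologicalType) (I : Type) (f : I -> T -> R) (r : seq I) :
  (forall k, continuous (f k)) -> continuous (fun x : T => \prod_(k <- r) f k x).
Proof.
move=> cf; elim: r => [|a r IH].
  rewrite (_ : (fun _ => _) = cst 1); first exact: cst_continuous.
  by apply/funext => s; rewrite big_nil.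
rewrite (_ : (fun s => _) = f a \* (fun s => \prod_(k <- r) f k s)); last first.
  by apply/funext => s; rewrite big_cons.
by move=> x; apply: continuousM; [exact: cf|exact: IH].
Qed.

Lemma continuous_sum_seq (T : topologicalType) (I : Type) (f : I -> T -> R) (r : seq I) :
  (forall k, continuous (f k)) -> continuous (fun x : T => \sum_(k <- r) f k x).
Proof.
move=> cf; elim: r => [|a r IH].
  rewrite (_ : (fun _ => _) = cst 0); first exact: cst_continuous.
  by apply/funext => s; rewrite big_nil.
rewrite (_ : (fun s => _) = f a \+ (fun s => \sum_(k <- r) f k s)); last first.
  by apply/funext => s; rewrite big_cons.
by move=> x; apply: continuousD; [exact: cf|exact: IH].
Qed.

Lemma prodf_cont D m : (forall k, smooth_seq (D k)) -> continuous (prodf D m).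
Proof.
move=> sD; apply: continuous_prod_seq => k; apply: continuous_coord.
exact: smooth_seq_cont.
Qed.

Lemma prodf_bound D m : (forall k, smooth_seq (D k)) ->
  exists2 C : R, 0 <= C & forall x, `|prodf D m x| <= C.
Proof.
move=> sD.
have /choice[C HC] : forall k, exists C : R, 0 <= C /\ forall t, `|D k (m k) t| <= C.
  by move=> k; have [_ /(_ (m k))[C C0 CP]] := sD k; exists C.
exists (\prod_k C k); first by apply: prodr_ge0 => k _; have [] := HC k.
move=> x; rewrite /prodf normr_prod; apply: ler_prod => k _.
by rewrite normr_ge0; have [_ ->] := HC k.
Qed.

Lemma partial_prodf D m j : (forall k, smooth_seq (D k)) ->
  partial j (prodf D m) = prodf D (incr m j).
Proof.
move=> sD; apply/funext => x; rewrite /partial.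
rewrite (derive_val (is_derive := prodf_derive m x (delta_mx ord0 j) sD)).
rewrite (bigD1 j)//= big1 ?addr0 ?mxE ?eqxx ?mul1r// => k /negbTE kj.
by rewrite mxE kj andbF mul0r.
Qed.

(** Every iterated partial derivative of a tensor product is again of the form
    prodf D m. *)
Lemma prodf_test_function D (U : set 'rV[R]_n) (c : 'rV[R]_n) (e : R) :
  (forall k, smooth_seq (D k)) ->
  (forall k (m : nat) t, e <= `|t - c ord0 k| -> D k m t = 0) ->
  ccube c e `<=` U -> test_function U (prodf D (fun=> 0%N)).
Proof.
move=> sD zD cU.
have supp : closure [set x | prodf D (fun=> 0%N) x != 0] `<=` ccube c e.
  have cl : closed (ccube c e).
    by apply: compact_closed => //; exact: compact_ccube.
  rewrite [X in _ `<=` X](iffLR (closure_id _) cl).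
  apply: closure_subset => x /= + k; rewrite leNgt => nz.
  apply/negP => ek; move: nz; rewrite /prodf (bigD1 k)//= zD ?mul0r ?eqxx//.
  exact: ltW.
split.
- move=> s /=.
  have [m ->] : exists m, foldr (@partial R n) (prodf D (fun=> 0%N)) s = prodf D m.
    elim: s => [|j s [m IH]]; first by exists (fun=> 0%N).
    by exists (incr m j); rewrite /= IH partial_prodf.
  split; first exact: prodf_cont.
  by move=> j x; case: (prodf_derive m x (delta_mx ord0 j) sD).
- apply: (subclosed_compact _ (@compact_ccube R n c e) supp); exact: closed_closure.
- exact: subset_trans supp cU.
Qed.

End tensor_products.

(** * Convolution with a smooth kernel *)

Section parametric_integrals.
Variables (R : realType) (n : nat).
Local Notation mu := (@lebesgue_rV R n).
Implicit Types (D : 'I_n -> nat -> R -> R) (m : 'I_n -> nat).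

(** The one-parameter theorem, applied along the line x + t v. *)
Lemma is_derive_under_integral (Phi dPhi : 'rV[R]_n -> 'rV[R]_n -> R) (G : 'rV[R]_n -> R)
    (x v : 'rV[R]_n) :
  (forall t : R, mu.-integrable setT (EFin \o Phi (t *: v + x))) ->
  (forall (t : R) y, is_derive (t *: v + x) v (Phi^~ y) (dPhi (t *: v + x) y)) ->
  (forall (t : R) y, `|t| < 1 -> `|dPhi (t *: v + x) y| <= G y) ->
  mu.-integrable setT (EFin \o G) ->
  is_derive x v (fun x' => \int[mu]_y Phi x' y) (\int[mu]_y dPhi x y).
Proof.
move=> iPhi dPhiP bG iG.
pose f (t : R) (y : 'rV[R]_n) := Phi (t *: v + x) y.
have df (t : R) y : is_derive t 1 (f^~ y) (dPhi (t *: v + x) y).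
  exact/(is_derive_lineP (Phi^~ y)).
have d1 t y : partial1of2 f t y = dPhi (t *: v + x) y.
  by rewrite partial1of2E; apply: derive_val.
have H := @cvg_differentiation_under_integral R _ _ mu f setT measurableT 0 (-1) 1.
have {}H := H _ (fun t _ => iPhi t) (fun t y _ _ => let: DeriveDef d _ := df t y in d) G.
have G0 y : 0 <= G y.
  by apply: le_trans (bG 0 y _); rewrite ?normr0.
have {}H := H _ G0 iG _.
have {H} : h^-1 *: (\int[mu]_(y in setT) f (h + 0) y - \int[mu]_(y in setT) f 0 y) @[h --> 0^'] -->
       \int[mu]_(y in setT) partial1of2 f 0 y.
  apply: H; first by rewrite /= in_itv /= ltrN10 ltr01.
  by move=> t y; rewrite /= in_itv /= -ltr_norml => t1 _; rewrite d1; exact: bG.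
have -> : \int[mu]_y partial1of2 f 0 y = \int[mu]_y dPhi x y.
  by apply: eq_Rintegral => y _; rewrite d1 scale0r add0r.
move=> H; apply: is_derive_line.
have E : (fun h : R => h^-1 *: (\int[mu]_y f (h + 0) y - \int[mu]_y f 0 y)) =
  (fun h : R => h^-1 *: (((fun h0 : R => \int[mu]_y Phi (h0 *: v + x) y) \o shift 0) (h *: 1)
     - \int[mu]_y Phi (0 *: v + x) y)).
  apply/funext => h; rewrite /= /f; have -> : h *: (1 : R) = h by exact: mulr1.
  by [].
rewrite E in H; split; first by apply/cvg_ex; eexists; exact: H.
exact: cvg_lim H.
Qed.

Lemma le_Rintegral_abs (f : 'rV[R]_n -> R) : mu.-integrable setT (EFin \o f) ->
  (`|\int[mu]_x f x|%:E <= \int[mu]_x (`|f x|)%:E)%E.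
Proof.
move=> fi; rewrite EFin_normr_Rintegral//.
by apply: le_abse_integral => //; exact: measurable_int fi.
Qed.

Lemma integrable_bounded_mul (g psi : 'rV[R]_n -> R) (C : R) :
  mu.-integrable setT (EFin \o g) -> measurable_fun setT psi -> (forall x, `|psi x| <= C) ->
  mu.-integrable setT (EFin \o (fun x => g x * psi x)).
Proof.
move=> ig mpsi bpsi.
have C0 : 0 <= C by apply: le_trans (bpsi 0).
have mg : measurable_fun setT g by apply/measurable_EFinP; exact: measurable_int ig.
apply: (@le_integrable _ _ _ mu setT measurableT _ (fun x => C%:E * (EFin \o g) x)%E).
- by apply/measurable_EFinP; exact: measurable_funM.
- move=> x _ /=; rewrite lee_fin !normrM mulrC ler_wpM2r//.
  by rewrite (ger0_norm C0).
- exact: integrableZl.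
Qed.

Lemma measurable_sub (x : 'rV[R]_n) : measurable_fun setT (fun y : 'rV[R]_n => x - y).
Proof.
apply: measurable_fun_rV => i.
rewrite (_ : _ \o _ = (fun y : 'rV[R]_n => (x ord0 i - (y ord0 i : measurableTypeR R))%R)).
  by apply: measurable_funB => //; exact: measurable_coord.
by apply/funext => y /=; rewrite !mxE.
Qed.

(** Convolution of g with psi. *)
Definition convol (g psi : 'rV[R]_n -> R) (x : 'rV[R]_n) : R := \int[mu]_y (g y * psi (x - y)).

Lemma convol_integrable (g psi : 'rV[R]_n -> R) (C : R) x :
  mu.-integrable setT (EFin \o g) -> measurable_fun setT psi -> (forall x, `|psi x| <= C) ->
  mu.-integrable setT (EFin \o (fun y => g y * psi (x - y))).
Proof.
move=> ig mpsi bpsi; apply: (@integrable_bounded_mul _ (fun y => psi (x - y)) C) => //.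
exact: (measurableT_comp mpsi (measurable_sub x)).
Qed.

Lemma convol_bound (g psi : 'rV[R]_n -> R) (C : R) x :
  mu.-integrable setT (EFin \o g) -> measurable_fun setT psi -> (forall x, `|psi x| <= C) ->
  `|convol g psi x| <= C * \int[mu]_y `|g y|.
Proof.
move=> ig mpsi bpsi; have ii := convol_integrable x ig mpsi bpsi.
apply: le_trans (le_normr_Rintegral _ ii) _ => //.
have ig' : mu.-integrable setT (EFin \o (fun y => `|g y|)) by exact: integrable_norm ig.
rewrite -RintegralZl//; apply: le_Rintegral => //.
- exact: integrable_norm ii.
- exact: integrableZl ig'.
- by move=> y _; rewrite normrM mulrC ler_wpM2r.
Qed.

Lemma RintegralZ_sum (I : Type) (r : seq I) (a : I -> R) (f : I -> 'rV[R]_n -> R) :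
  (forall i, mu.-integrable setT (EFin \o f i)) ->
  \int[mu]_y (\sum_(i <- r) a i * f i y) = \sum_(i <- r) a i * \int[mu]_y f i y.
Proof.
move=> fi; elim: r => [|i r IH].
  rewrite big_nil (_ : (fun _ => _) = cst 0); first by rewrite Rintegral_cst// mul0r.
  by apply/funext => y; rewrite big_nil.
rewrite big_cons -IH -RintegralZl//.
under eq_Rintegral do rewrite big_cons.
rewrite RintegralD//; last 2 first.
  exact: (integrableZl measurableT (a i) (fi i)).
rewrite (_ : EFin \o _ = (fun y => \sum_(j <- r) (a j)%:E * (EFin \o f j) y)%E).
  by apply: integrable_sum => // j _; exact: integrableZl.
by apply/funext => y /=; rewrite -sumEFin.
Qed.

Lemma convol_derive (g : 'rV[R]_n -> R) D m (x v : 'rV[R]_n) :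
  mu.-integrable setT (EFin \o g) -> (forall k, smooth_seq (D k)) ->
  is_derive x v (convol g (prodf D m)) (\sum_j v ord0 j * convol g (prodf D (incr m j)) x).
Proof.
move=> ig sD.
have mD m' : measurable_fun setT (prodf D m').
  by apply: continuous_measurable_rV; exact: prodf_cont.
have /choice[C HC] : forall m', exists C : R, 0 <= C /\ forall x, `|prodf D m' x| <= C.
  by move=> m'; have [C C0 CP] := prodf_bound m' sD; exists C.
have bD m' x' : `|prodf D m' x'| <= C m' by have [_] := HC m'.
pose dPhi x' y := \sum_j v ord0 j * (g y * prodf D (incr m j) (x' - y)).
have := @is_derive_under_integral (fun x y => g y * prodf D m (x - y)) dPhi
  (fun y => (\sum_j `|v ord0 j| * C (incr m j)) * `|g y|) x v.
rewrite /dPhi RintegralZ_sum; last by move=> i; apply: convol_integrable.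
apply.
- by move=> t; exact: convol_integrable.
- move=> t y.
  have H : is_derive (t *: v + x) v (fun x => prodf D m (x - y)) (\sum_j v ord0 j * prodf D (incr m j) (t *: v + x - y)).
    apply/is_derive_lineP.
    have := prodf_derive m (t *: v + x - y) v sD.
    rewrite -addrA => /is_derive_lineP; congr is_derive.
    by apply/funext => h; rewrite addrA.
  have := is_deriveZ (g y) H; congr is_derive.
  by rewrite /GRing.scale /= mulr_sumr; apply: eq_bigr => j _; rewrite mulrCA.
- move=> t y _; rewrite mulr_suml; apply: le_trans (ler_norm_sum _ _ _) _.
  apply: ler_sum => j _; rewrite !normrM [_ * `|prodf _ _ _|]mulrC mulrA ler_wpM2r// ler_wpM2l//.
- by have := integrableZl measurableT (\sum_j `|v ord0 j| * C (incr m j)) (integrable_norm ig).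
Qed.

(** Bounded partial derivatives make f Lipschitz, by the mean value theorem on
    segments. *)
Lemma bounded_derive_continuous (f : 'rV[R]_n -> R) (p : 'I_n -> 'rV[R]_n -> R) (C : R) :
  (forall x v, is_derive x v f (\sum_j v ord0 j * p j x)) ->
  (forall j x, `|p j x| <= C) -> continuous f.
Proof.
move=> df bp x.
have C0 (j : 'I_n) : 0 <= C by exact: le_trans (normr_ge0 _) (bp j x).
have lip y : `|f y - f x| <= (\sum_(j < n) C) * `|y - x|.
  have H (t : R) : is_derive t 1 (fun s : R => f (s *: (y - x) + x))
      (\sum_j (y - x) ord0 j * p j (t *: (y - x) + x)).
    by apply/(is_derive_lineP f); exact: df.
  have [|t _] := @MVT_segment R (fun s : R => f (s *: (y - x) + x)) _ 0 1 ler01 (fun t _ => H t).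
    apply: continuous_subspaceT => t; apply: differentiable_continuous.
    by apply/derivable1_diffP; case: (H t).
  rewrite scale1r subrK scale0r add0r subr0 mulr1 => ->.
  rewrite mulr_suml; apply: le_trans (ler_norm_sum _ _ _) _; apply: ler_sum => j _.
  by rewrite normrM mulrC ler_pM// coord_le_norm.
apply/(@cvgrPdist_le _ _ _ (nbhs (x : 'rV[R]_n))) => e e0.
pose K := \sum_(j < n) C + 1.
have K0 : 0 < K by rewrite ltr_wpDl//; apply: sumr_ge0 => j _; exact: C0 j.
have d0 : 0 < K^-1 * e by rewrite mulr_gt0// invr_gt0.
have H : nbhs (x : 'rV[R]_n) (ball (x : 'rV[R]_n) (K^-1 * e)) by exact: nbhsx_ballx.
apply: filterS H => y; rewrite -ball_normE /= distrC => /ltW xy.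
rewrite distrC; apply: le_trans (lip y) _.
apply: le_trans (_ : K * `|y - x| <= _); first by rewrite ler_wpM2r// lerDl.
by rewrite -ler_pdivlMl.
Qed.

Lemma convol_cont (g : 'rV[R]_n -> R) D m :
  mu.-integrable setT (EFin \o g) -> (forall k, smooth_seq (D k)) ->
  continuous (convol g (prodf D m)).
Proof.
move=> ig sD.
have mD m' : measurable_fun setT (prodf D m').
  by apply: continuous_measurable_rV; exact: prodf_cont.
have /choice[C HC] : forall j : 'I_n, exists C : R, 0 <= C /\ forall x, `|prodf D (incr m j) x| <= C.
  by move=> m'; have [C C0 CP] := prodf_bound (incr m m') sD; exists C.
have g0 : 0 <= \int[mu]_y `|g y| by apply: Rintegral_ge0.
apply: (@bounded_derive_continuous _ (fun j => convol g (prodf D (incr m j)))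
   (\sum_j (C j * \int[mu]_y `|g y|))).
  by move=> x v; exact: convol_derive.
move=> j x; have [Cj0 Cj] := HC j; apply: le_trans (@convol_bound _ _ (C j) _ _ _ _) _ => //.
rewrite (bigD1 j)//= lerDl; apply: sumr_ge0 => k _; apply: mulr_ge0 => //.
by have [] := HC k.
Qed.

(** The graph of the power p + 1 lies above its tangent at a. *)
Lemma pow_tangent (a h : R) p : 0 <= a -> 0 <= h ->
  p.+1%:R * a ^+ p * h <= h ^+ p.+1 + p%:R * a ^+ p.+1.
Proof.
move=> a0 h0; elim: p => [|p IH]; first by rewrite expr0 expr1 mul0r addr0 mulr1 mul1r.
have h1 := ler_wpM2l h0 IH.
have h2 : 0 <= p.+1%:R * a ^+ p * (a - h) ^+ 2 by rewrite mulr_ge0 ?sqr_ge0// mulr_ge0 ?exprn_ge0.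
rewrite [h ^+ p.+2]exprS ![a ^+ p.+2]exprS; move: h1 h2.
rewrite -![p.+2%:R]natr1 -![p.+1%:R]natr1 ![a ^+ p.+1]exprS.
set A := a ^+ p; set H := h ^+ p.+1; set P := p%:R : R; nra.
Qed.

End parametric_integrals.

(** * Jensen's inequality and mollifiers *)

Section jensen.
Local Open Scope ereal_scope.
Context d (T : measurableType d) (R : realType) (mu : {measure set T -> \bar R}).

(** The tangent at a, integrated against the probability density w. *)
Lemma jensen_pow (w h : T -> R) (a : R) (p : nat) :
  measurable_fun setT w -> measurable_fun setT h ->
  (forall x, 0 <= w x)%R -> (forall x, 0 <= h x)%R ->
  \int[mu]_x (w x)%:E = 1 -> (0 <= a)%R ->
  a%:E <= \int[mu]_x (h x * w x)%:E ->
  (a ^+ p.+1)%:E <= \int[mu]_x (h x ^+ p.+1 * w x)%:E.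
Proof.
move=> mw mh w0 h0 w1 a0 ale.
pose k := (p.+1%:R * a ^+ p)%R; pose l := (p%:R * a ^+ p.+1)%R.
have k0 : (0 <= k)%R by rewrite mulr_ge0 ?exprn_ge0.
have l0 : (0 <= l)%R by rewrite mulr_ge0 ?exprn_ge0.
have mhw : measurable_fun setT (fun x => (h x * w x)%:E).
  by apply/measurable_EFinP; exact: measurable_funM.
have mpw : measurable_fun setT (fun x => (h x ^+ p.+1 * w x)%:E).
  by apply/measurable_EFinP; apply: measurable_funM => //; exact: measurable_funX.
have mw' : measurable_fun setT (fun x => (w x)%:E) by exact/measurable_EFinP.
have H : k%:E * \int[mu]_x (h x * w x)%:E <= \int[mu]_x (h x ^+ p.+1 * w x)%:E + l%:E.
  rewrite -[l%:E]mule1 -w1 -ge0_integralZl//; last by move=> x _; rewrite lee_fin mulr_ge0.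
  rewrite -ge0_integralZl//; last by move=> x _; rewrite lee_fin.
  rewrite -ge0_integralD//; last 3 first.
  - by move=> x _; rewrite lee_fin mulr_ge0 ?exprn_ge0.
  - by move=> x _; rewrite -EFinM lee_fin mulr_ge0.
  - exact: emeasurable_funM.
  apply: ge0_le_integral => //.
  - by move=> x _; rewrite -EFinM lee_fin; apply: mulr_ge0 => //; exact: mulr_ge0.
  - exact: emeasurable_funM.
  - by apply: emeasurable_funD => //; exact: emeasurable_funM.
  - move=> x _; rewrite -!EFinM -EFinD lee_fin mulrA -mulrDl ler_wpM2r//.
    exact: pow_tangent.
have H2 : (k * a)%:E <= \int[mu]_x (h x ^+ p.+1 * w x)%:E + l%:E.
  by apply: le_trans H; rewrite EFinM lee_wpmul2l.
rewrite -leeBlDr// in H2; apply: le_trans H2.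
rewrite -EFinB lee_fin /k /l -natr1 exprS; set A := (a ^+ p)%R.
by rewrite le_eqVlt; apply/orP; left; apply/eqP; ring.
Qed.

End jensen.

Section mollifier.
Variables (R : realType) (n : nat).
Local Notation mu := (@lebesgue_rV R n).
Implicit Types (D : 'I_n -> nat -> R -> R) (m : 'I_n -> nat).

(** The mass is that of the reflected kernel, since a convolution integrates psi
    (x - y) in y. *)
Definition mollifier (e : R) D : Prop :=
  [/\ forall k, smooth_seq (D k), forall k (m : nat) t, e <= `|t| -> D k m t = 0,
    forall x, 0 <= prodf D (fun=> 0%N) x &
    (\int[mu]_x (prodf D (fun=> 0%N) (- x)%R)%:E = 1)%E].

Lemma measurable_opp_rV : measurable_fun setT (fun x : 'rV[R]_n => - x).
Proof.
apply: measurable_fun_rV => i.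
rewrite (_ : _ \o _ = (fun y : 'rV[R]_n => (- (y ord0 i : measurableTypeR R))%R)).
  by apply: measurable_funN; exact: measurable_coord.
by apply/funext => y /=; rewrite !mxE.
Qed.

(** A tensor product of bumps. The factor that normalises its mass is put on the
    single coordinate i0. *)
Lemma mollifier_exists (i0 : 'I_n) (e : R) : 0 < e -> exists D, mollifier e D.
Proof.
move=> e0; have [b [sb zb b0 bpos]] := bump_exists e0.
pose D0 (k : 'I_n) := b.
have sD0 k : smooth_seq (D0 k) by [].
pose psi := prodf D0 (fun=> 0%N).
have cpsi : continuous psi by exact: prodf_cont.
have psi0 x : 0 <= psi x by apply: prodr_ge0 => k _; exact: b0.
have psi_out x : ~ cube 0 e x -> psi x = 0.
  move=> nx; have [k ek] : exists k, e <= `|x ord0 k|.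
    apply: contrapT => H; apply: nx => k; rewrite mxE subr0 ltNge; apply/negP => ek.
    by apply: H; exists k.
  by rewrite /psi /prodf (bigD1 k)//= /D0 zb ?mul0r.
have mpsi : measurable_fun setT (fun x : 'rV[R]_n => psi (- x)).
  exact: (measurableT_comp (continuous_measurable_rV cpsi) measurable_opp_rV).
have [C C0 HC] := prodf_bound (fun=> 0%N) sD0.
have Zfin : (\int[mu]_x (psi (- x)%R)%:E < +oo)%E.
  apply: (@le_lt_trans _ _ (\int[mu]_(x in cube (0 : 'rV[R]_n) e) C%:E)%E).
    rewrite [leRHS]integral_mkcond; apply: ge0_le_integral => //.
    - by move=> x _; rewrite lee_fin.
    - exact/measurable_EFinP.
    - apply/(measurable_restrictT _ _).1 => //; exact: measurable_cube.
    - move=> x _; rewrite patchE; case: ifPn => [_|/negP].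
        by rewrite lee_fin; apply: le_trans (HC _); exact: ler_norm.
      rewrite inE => nx; rewrite psi_out//; apply: contra_not nx => + k => /(_ k).
      by rewrite !mxE !subr0 normrN.
  rewrite integral_cst//; last exact: measurable_cube.
  by have /= -> := lebesgue_rV_cube (0 : 'rV[R]_n) (ltW e0); rewrite -EFinM ltry.
have Zpos : (0 < \int[mu]_x (psi (- x)%R)%:E)%E.
  rewrite lt0e; apply/andP; split; last by apply: integral_ge0 => x _; rewrite lee_fin.
  apply/eqP => Z0.
  have := (@ae_eq_integral_abs _ _ _ mu setT measurableT (fun x => (psi (- x)%R)%:E) _).1.
  move=> /(_ _ _)[]; first exact/measurable_EFinP.
    by rewrite -[RHS]Z0; apply: eq_integral => x _; rewrite gee0_abs// lee_fin.
  move=> N [mN N0 subN].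
  have : (mu (cube (0%R : 'rV[R]_n) e) <= mu N)%E.
    apply: le_measure; rewrite ?inE//; first exact: measurable_cube.
    move=> x cx; apply: subN => /= /(_ I) [] /eqP; rewrite gt_eqF//.
    apply: prodr_gt0 => k _; apply: bpos; have := cx k.
    by rewrite !mxE subr0 normrN.
  rewrite leNgt => /negP; apply; rewrite N0 (lebesgue_rV_cube _ (ltW e0)).
  by rewrite lte_fin exprn_gt0// mulr_gt0.
have [Z ZE] : exists Z : R, (\int[mu]_x (psi (- x)%R)%:E = Z%:E)%E.
  exists (fine (\int[mu]_x (psi (- x)%R)%:E)%E); rewrite fineK// ge0_fin_numE//.
  exact: ltW.
have Z0 : 0 < Z by rewrite -lte_fin -ZE.
pose D (k : 'I_n) (m : nat) (t : R) := (if k == i0 then Z^-1 else 1) * b m t.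
have DE x : prodf D (fun=> 0%N) x = Z^-1 * psi x.
  rewrite /psi /prodf (bigD1 i0)//= [in RHS](bigD1 i0)//= /D eqxx -mulrA; congr (_ * (_ * _)).
  by apply: eq_bigr => k /negbTE ->; rewrite mul1r.
exists D; split.
- move=> k; have [db bb] := sb; split=> [m t|m]; first exact: is_deriveZ (db m t).
  have [B B0 HB] := bb m; exists (`|if k == i0 then Z^-1 else 1| * B); first by rewrite mulr_ge0.
  by move=> t; rewrite normrM ler_wpM2l.
- by move=> k m t et; rewrite /D zb ?mulr0.
- by move=> x; rewrite DE mulr_ge0// invr_ge0 ltW.
- under eq_integral do rewrite DE EFinM.
  rewrite ge0_integralZl//; last 3 first.
  + exact/measurable_EFinP.
  + by move=> x _; rewrite lee_fin.
  + by rewrite lee_fin invr_ge0 ltW.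
  by rewrite ZE -EFinM mulVf// gt_eqF.
Qed.

Lemma mollifier_out (e : R) D x : mollifier e D -> ~ cube 0 e x -> prodf D (fun=> 0%N) x = 0.
Proof.
move=> [_ zD _ _] nx; have [k ek] : exists k, e <= `|x ord0 k|.
  apply: contrapT => H; apply: nx => k; rewrite mxE subr0 ltNge; apply/negP => ek.
  by apply: H; exists k.
by rewrite /prodf (bigD1 k)//= zD ?mul0r.
Qed.

Lemma mollifier_meas (e : R) D : mollifier e D -> measurable_fun setT (prodf D (fun=> 0%N)).
Proof. by move=> [sD _ _ _]; apply: continuous_measurable_rV; exact: prodf_cont. Qed.

Lemma mollifier_int (e : R) D x : mollifier e D ->
  (\int[mu]_y (prodf D (fun=> 0%N) (x - y)%R)%:E = 1)%E.
Proof.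
move=> mD; have [_ _ D0 <-] := mD; have mpsi := mollifier_meas mD.
rewrite -(@ge0_integral_translate R n x (fun y => (prodf D (fun=> 0%N) (x - y)%R)%:E)).
- by apply: eq_integral => y _; rewrite opprD addrCA subrr addr0.
- by apply/measurable_EFinP; exact: (measurableT_comp mpsi (measurable_sub x)).
- by move=> y; rewrite lee_fin.
Qed.

Lemma mollifier_integrable (e : R) D x : mollifier e D ->
  mu.-integrable setT (EFin \o (fun y => prodf D (fun=> 0%N) (x - y))).
Proof.
move=> mD; have mpsi := mollifier_meas mD; have [_ _ D0 _] := mD.
apply/integrableP; split.
  by apply/measurable_EFinP; exact: (measurableT_comp mpsi (measurable_sub x)).
rewrite (eq_integral (fun y : 'rV[R]_n => (prodf D (fun=> 0%N) (x - y)%R)%:E)).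
  by rewrite (mollifier_int x mD) ltry.
by move=> y _; rewrite gee0_abs// lee_fin.
Qed.

(** The kernel has mass 1, so that c can be moved under the integral. *)
Lemma convol_sub (e : R) D (g : 'rV[R]_n -> R) x (c : R) : mollifier e D ->
  mu.-integrable setT (EFin \o g) ->
  (`|convol g (prodf D (fun=> 0%N)) x - c|%:E <=
    \int[mu]_y (`|g y - c| * prodf D (fun=> 0%N) (x - y)%R)%:E)%E.
Proof.
move=> mD ig; have mpsi := mollifier_meas mD; have [sD _ D0 _] := mD.
have [C C0 HC] := prodf_bound (fun=> 0%N) sD.
set psi := prodf D (fun=> 0%N) in mpsi D0 HC *.
have i1 := convol_integrable x ig mpsi HC.
have i2 : mu.-integrable setT (EFin \o (fun y => c * psi (x - y))).
  by have := integrableZl measurableT c (mollifier_integrable x mD).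
have i3 : mu.-integrable setT (EFin \o (fun y => g y * psi (x - y) - c * psi (x - y))).
  have := integrableB measurableT i1 i2.
  by apply: eq_integrable => // y _.
have -> : convol g psi x - c = \int[mu]_y (g y * psi (x - y) - c * psi (x - y)).
  rewrite RintegralB// RintegralZl//; last exact: mollifier_integrable mD.
  by rewrite [X in c * X]/Rintegral (mollifier_int x mD) /= mulr1.
apply: le_trans (le_Rintegral_abs i3) _.
rewrite le_eqVlt; apply/orP; left; apply/eqP; apply: eq_integral => y _.
by rewrite -mulrBl normrM (ger0_norm (D0 _)).
Qed.

(** On a bounded set 1 + |g|^(p+1) is an integrable majorant of |g|. *)
Lemma Lp_integrable (p : nat) (g : 'rV[R]_n -> R) (c : 'rV[R]_n) (r : R) :
  measurable_fun setT g -> (\int[mu]_x (`|g x| ^+ p.+1)%:E < +oo)%E ->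
  (forall x, ~ cube c r x -> g x = 0) -> 0 < r ->
  mu.-integrable setT (EFin \o g).
Proof.
move=> mg ig g0 r0; apply/integrableP; split; first exact/measurable_EFinP.
have mc := measurable_cube c r.
have mgp : measurable_fun setT (fun x => (`|g x| ^+ p.+1)%:E).
  by apply/measurable_EFinP; apply: measurable_funX; exact: measurableT_comp.
apply: (@le_lt_trans _ _ (\int[mu]_x ((\1_(cube c r) x)%:E + (`|g x| ^+ p.+1)%:E))%E).
  apply: ge0_le_integral => //.
  - by apply: measurableT_comp => //; exact/measurable_EFinP.
  - by apply: emeasurable_funD => //; apply/measurable_EFinP; exact: measurable_indic.
  - move=> x _; rewrite /= -EFinD lee_fin.
    have [cx|cx] := pselect (cube c r x); last by rewrite g0// normr0 addr_ge0// exprn_ge0.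
    rewrite indicE mem_set//=; case: (leP `|g x| 1) => [g1|/ltW g1].
      by apply: le_trans g1 _; rewrite lerDl exprn_ge0.
    by apply: le_trans (_ : `|g x| ^+ p.+1 <= _); rewrite ?ler_eXnr ?lerDr// ler_eXpr.
rewrite ge0_integralD//; last by apply/measurable_EFinP; exact: measurable_indic.
rewrite integral_indic// setIT lte_add_pinfty//.
by have /= -> := lebesgue_rV_cube c (ltW r0); rewrite ltry.
Qed.

Lemma measurable_translate2 :
  measurable_fun setT (fun p : 'rV[R]_n * 'rV[R]_n => p.2 + p.1).
Proof.
apply: measurable_fun_rV => i.
rewrite (_ : _ \o _ = (fun p : 'rV[R]_n * 'rV[R]_n => ((p.2 ord0 i : measurableTypeR R) + (p.1 ord0 i : measurableTypeR R))%R)).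
  apply: measurable_funD.
    by apply: (measurableT_comp (measurable_coord i)); exact: measurable_snd.
  by apply: (measurableT_comp (measurable_coord i)); exact: measurable_fst.
by apply/funext => y /=; rewrite !mxE.
Qed.

(** By Jensen's inequality the left-hand side is at most an average of integrals
    of |g(x + w) - g x|^(p+1) over translations w shorter than eps. *)
Lemma convol_Lp (p : nat) (g : 'rV[R]_n -> R) (c : 'rV[R]_n) (r e : R) :
  measurable_fun setT g -> (\int[mu]_x (`|g x| ^+ p.+1)%:E < +oo)%E ->
  (forall x, ~ cube c r x -> g x = 0) -> 0 < r -> 0 < e ->
  exists2 d : R, 0 < d & forall eps D, 0 < eps -> eps < d -> mollifier eps D ->
  (\int[mu]_x (`|convol g (prodf D (fun=> 0%N)) x - g x| ^+ p.+1)%:E <= e%:E)%E.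
Proof.
move=> mg ig g0 r0 e0; have gi := Lp_integrable mg ig g0 r0.
have [d d0 dP] := Lp_translate mg ig g0 r0 e0.
exists d => // eps D eps0 epsd mD.
have mpsi := mollifier_meas mD; have [sD _ D0 D1] := mD.
have cpsi : continuous (prodf D (fun=> 0%N)) by exact: prodf_cont.
have mm : measurable_fun setT (convol g (prodf D (fun=> 0%N))).
  by apply: continuous_measurable_rV; exact: convol_cont.
have out := mollifier_out mD.
have msub := convol_sub _ _ mD gi.
have mint := mollifier_int _ mD.
set psi := prodf D (fun=> 0%N) in mpsi D0 D1 cpsi mm out msub mint *.
pose F (q : 'rV[R]_n * 'rV[R]_n) : \bar R := (`|g (q.2 + q.1)%R - g q.1| ^+ p.+1 * psi (- q.2))%:E.
have F0 q : (0 <= F q)%E by rewrite lee_fin mulr_ge0 ?exprn_ge0.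
have mF : measurable_fun setT F.
  apply/measurable_EFinP; apply: measurable_funM.
    apply: measurable_funX; apply: measurableT_comp => //; apply: measurable_funB.
      exact: (measurableT_comp mg measurable_translate2).
    exact: (measurableT_comp mg measurable_fst).
  apply: (measurableT_comp mpsi); apply: (measurableT_comp measurable_opp_rV); exact: measurable_snd.
apply: (@le_trans _ _ (\int[mu]_x \int[mu]_w F (x, w))%E).
  apply: ge0_le_integral => //.
  - by apply/measurable_EFinP; apply: measurable_funX; apply: measurableT_comp => //; exact: measurable_funB.
  - exact: measurable_fun_fubini_tonelli_F.
  - move=> x _.
    have mp : measurable_fun setT (fun y : 'rV[R]_n => psi (x - y)) by exact: (measurableT_comp mpsi (measurable_sub x)).
    have mgx : measurable_fun setT (fun y => `|g y - g x|).
      by apply: measurableT_comp => //; exact: measurable_funB.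
    have := @jensen_pow _ _ R mu (fun y => psi (x - y)) (fun y => `|g y - g x|)
      `|convol g psi x - g x| p mp mgx (fun y => D0 _) (fun y => normr_ge0 _) (mint x) (normr_ge0 _) (msub x (g x)).
    move/le_trans; apply.
    rewrite -(@ge0_integral_translate R n x (fun y => (`|g y - g x| ^+ p.+1 * psi (x - y)%R)%:E)).
    + rewrite le_eqVlt; apply/orP; left; apply/eqP; apply: eq_integral => w _.
      by rewrite /F /= opprD addrCA subrr addr0.
    + by apply/measurable_EFinP; apply: measurable_funM => //; exact: measurable_funX.
    + by move=> y; rewrite lee_fin mulr_ge0 ?exprn_ge0.
rewrite (fubini_tonelli F)//.
apply: (@le_trans _ _ (\int[mu]_w (e%:E * (psi (- w)%R)%:E))%E); last first.
  rewrite ge0_integralZl//.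
  - by rewrite D1 mule1.
  - by apply/measurable_EFinP; exact: (measurableT_comp mpsi measurable_opp_rV).
  - by move=> x _; rewrite lee_fin.
  - by rewrite lee_fin ltW.
apply: ge0_le_integral => //.
- by move=> w _; apply: integral_ge0 => x _.
- exact: measurable_fun_fubini_tonelli_G.
- by apply: emeasurable_funM => //; apply/measurable_EFinP; exact: (measurableT_comp mpsi measurable_opp_rV).
- move=> w _; rewrite /F /=.
  have [wd|wd] := pselect (cube 0 eps (- w)); last first.
    rewrite out// mule0 integral0_eq// => x _; by rewrite mulr0.
  under eq_integral do rewrite EFinM muleC.
  rewrite ge0_integralZl//.
  + rewrite muleC lee_wpmul2r ?lee_fin//.
    have wd' : `|w| < d.
      apply: lt_trans epsd; move: wd; rewrite cube_ball// -ball_normE /=.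
      by rewrite sub0r opprK.
    apply: le_trans (dP w wd'); rewrite le_eqVlt; apply/orP; left; apply/eqP.
    by apply: eq_integral => x _; rewrite [w + x]addrC.
  + apply/measurable_EFinP; apply: measurable_funX; apply: measurableT_comp => //; apply: measurable_funB => //.
    have := measurable_translate w => mw.
    rewrite (_ : (fun x => _) = g \o (fun x => x + w)); first exact: (measurableT_comp mg mw).
    by apply/funext => x /=; rewrite addrC.
  + by rewrite lee_fin.
Qed.

End mollifier.

(** * Smooth approximation of weakly differentiable maps *)

Section dominated_subsequence.
Context d (T : measurableType d) (R : realType) (mu : {measure set T -> \bar R}).
Variables (A : set T) (mA : measurable A).

Lemma exprD_le2 (a b : R) p : 0 <= a -> 0 <= b ->
  (a + b) ^+ p <= 2 ^+ p * (a ^+ p + b ^+ p).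
Proof.
move=> a0 b0; pose c := Num.max a b.
have c0 : 0 <= c by rewrite le_max a0.
apply: le_trans (_ : (2 * c) ^+ p <= _).
  rewrite lerXn2r ?nnegrE ?addr_ge0 ?mulr_ge0//.
  by rewrite mulr_natl mulr2n lerD// le_max lexx ?orbT.
rewrite exprMn ler_wpM2l ?exprn_ge0//.
by rewrite /c; case: (leP a b) => _; rewrite ?lerDl ?lerDr exprn_ge0.
Qed.

(** The sum of the functions |g_k - g|^(p+1) has a finite integral, hence is
    finite almost everywhere; this makes its terms tend to 0 and yields the
    majorant. *)
Lemma fast_Lp_ae (p : nat) (g_ : nat -> T -> R) (g : T -> R) :
  (forall k, measurable_fun A (g_ k)) -> measurable_fun A g ->
  (\int[mu]_(x in A) (`|g x| ^+ p.+1)%:E < +oo)%E ->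
  (forall k, \int[mu]_(x in A) (`|g_ k x - g x| ^+ p.+1)%:E <= (1 / (2 ^ k.+1)%:R)%:E)%E ->
  exists H : T -> R, [/\ mu.-integrable A (EFin \o H),
    (forall x, A x -> 0 <= H x),
    {ae mu, forall x, A x -> g_ k x @[k --> \oo] --> g x} &
    {ae mu, forall x, A x -> forall k, `|g_ k x| ^+ p.+1 <= H x}].
Proof.
move=> mg_ mg ig ig_.
pose h k x := `|g_ k x - g x| ^+ p.+1.
have h0 k x : 0 <= h k x by rewrite exprn_ge0.
have mh k : measurable_fun A (EFin \o h k).
  by apply/measurable_EFinP; apply: measurable_funX; apply: measurableT_comp => //; exact: measurable_funB.
pose S x := (\sum_(k <oo) (h k x)%:E)%E.
have S0 x : (0 <= S x)%E by apply: nneseries_ge0 => k _; rewrite lee_fin.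
have mS : measurable_fun A S by apply: ge0_emeasurable_sum => [k x _ _|k _]; [rewrite lee_fin|exact: mh].
have iS : mu.-integrable A S.
  apply/integrableP; split => //.
  under eq_integral do rewrite gee0_abs//.
  rewrite integral_nneseries//; last by move=> k x _; rewrite lee_fin.
  apply: (@le_lt_trans _ _ 1%E); last exact: ltry.
  apply: le_trans (epsilon_trick0 xpredT (@ler01 R)).
  by apply: lee_nneseries => [k *|k *]; [apply: integral_ge0 => x _; rewrite lee_fin|exact: ig_].
have mgp : measurable_fun A (fun x => `|g x| ^+ p.+1).
  by apply: measurable_funX; exact: measurableT_comp.
have igp : mu.-integrable A (EFin \o (fun x => `|g x| ^+ p.+1)).
  apply/integrableP; split; first exact/measurable_EFinP.
  by under eq_integral do rewrite /= ger0_norm ?exprn_ge0//.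
have iSf : mu.-integrable A (EFin \o (fine \o S)).
  apply: (le_integrable mA _ _ iS).
    by apply/measurable_EFinP; apply: measurableT_comp => //.
  move=> x _ /=; have := S0 x; case: (S x) => //= r; rewrite ?normr0 ?lee_fin//.
exists (fun x => 2 ^+ p.+1 * (`|g x| ^+ p.+1 + fine (S x))).
have aeS := integrable_ae mA iS.
split.
- have := integrableZl mA (2 ^+ p.+1) (integrableD mA igp iSf).
  by apply: eq_integrable => // x _.
- by move=> x _; rewrite mulr_ge0 ?exprn_ge0// addr_ge0 ?exprn_ge0 ?fine_ge0.
- apply: filterS aeS => x + Ax => /(_ Ax) Sfin.
  have hcvg : h k x @[k --> \oo] --> 0.
    apply: cvg_series_cvg_0; apply: nnseries_is_cvg => //.
    by move: Sfin; rewrite ge0_fin_numE.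
  apply/cvgrPdist_lt => e e0.
  have ep0 : 0 < e ^+ p.+1 by rewrite exprn_gt0.
  move/cvgrPdist_lt : hcvg => /(_ _ ep0); apply: filterS => k.
  rewrite sub0r normrN ger0_norm// /h distrC ltr_pXn2r// ?nnegrE// ltW//.
- apply: filterS aeS => x + Ax k => /(_ Ax) Sfin.
  have hS : h k x <= fine (S x).
    rewrite -lee_fin fineK//.
    apply: (@le_trans _ _ (\sum_(0 <= i < k.+1) (h i x)%:E)%E); last first.
      by apply: nneseries_lim_ge => i _ _; rewrite lee_fin.
    rewrite big_nat_recr //= leeDr//; apply: sume_ge0 => i _; rewrite lee_fin//.
  rewrite -[g_ k x](subrK (g x)) addrC.
  apply: le_trans (_ : (`|g x| + `|g_ k x - g x|) ^+ p.+1 <= _).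
    by rewrite lerXn2r ?nnegrE ?addr_ge0// ler_normD.
  apply: le_trans (exprD_le2 _ _ _) _ => //.
  by rewrite ler_wpM2l ?exprn_ge0// lerD2l.
Qed.

End dominated_subsequence.

Section weak_mollification.
Variables (R : realType) (n : nat).
Local Notation mu := (@lebesgue_rV R n).
Implicit Types (D : 'I_n -> nat -> R -> R) (m : 'I_n -> nat).
Local Notation m0 := (fun _ : 'I_n => 0%N).

Lemma loc_restrict_integrable (U K : set 'rV[R]_n) (u : 'rV[R]_n -> R) :
  loc_integrable U u -> compact K -> measurable K -> K `<=` U ->
  mu.-integrable setT (EFin \o (u \_ K)).
Proof.
move=> lu cK mK KU; have := lu K cK KU.
rewrite (integrable_mkcond _ mK); apply: eq_integrable => // x _.
by rewrite /= !patchE; case: ifP.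
Qed.

(** As a function of y, the kernel at x - y is a test function, so that the
    definition of the weak derivative applies to it. *)
Lemma convol_weak (U : set 'rV[R]_n) (u g : 'rV[R]_n -> R) (j : 'I_n) (z x : 'rV[R]_n) (s rho e : R) D :
  weak_partial U j u g -> ccube z rho `<=` U -> mollifier e D -> s + e <= rho ->
  cube z s x ->
  convol (u \_ (ccube z rho)) (prodf D (incr m0 j)) x = convol (g \_ (ccube z rho)) (prodf D m0) x.
Proof.
move=> [lu lg wug] KU mD se xz.
set K := ccube z rho.
have cK : compact K by exact: compact_ccube.
have mK : measurable K by exact: measurable_ccube.
have [sD zD _ _] := mD.
pose D' k (m : nat) t := (-1) ^+ m * D k m (-1 * t + x ord0 k).
have sD' k : smooth_seq (D' k) by exact: smooth_seq_affine.
have xK : ccube x e `<=` K.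
  move=> y xy i; have := xy i; have := xz i => h1 h2.
  rewrite (_ : y ord0 i - _ = (y ord0 i - x ord0 i) + (x ord0 i - z ord0 i)); last by ring.
  rewrite (le_trans (ler_normD _ _))//; lra.
have tD' : test_function U (prodf D' m0).
  apply: (@prodf_test_function _ _ _ _ x e) => //; last exact: subset_trans xK KU.
  move=> k m t ht; rewrite /D' zD ?mulr0//.
  by rewrite mulN1r addrC distrC.
have E0 y : prodf D' m0 y = prodf D m0 (x - y).
  by apply: eq_bigr => k _; rewrite /D' expr0 mul1r !mxE mulN1r addrC.
have E1 y : prodf D' (incr m0 j) y = - prodf D (incr m0 j) (x - y).
  rewrite /prodf (bigD1 j)//= [in RHS](bigD1 j)//= /incr eqxx /= /D' expr1 !mxE.
  rewrite !mulN1r -mulNr [x ord0 j - _]addrC; congr (_ * _); apply: eq_bigr => k /negbTE ->.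
  by rewrite expr0 mul1r !mxE mulN1r addrC.
have out m y : ~ K y -> prodf D m (x - y) = 0.
  move=> nK; have [k ek] : exists k, e <= `|y ord0 k - x ord0 k|.
    apply: contrapT => H; apply: nK; apply: xK => k; rewrite leNgt; apply/negP => /ltW ek.
    by apply: H; exists k.
  by rewrite /prodf (bigD1 k)//= zD ?mul0r// !mxE distrC.
have := wug _ tD'; rewrite partial_prodf// => W.
have iu := loc_restrict_integrable lu cK mK KU.
have [C1 C10 HC1] := prodf_bound (incr m0 j) sD.
have mp1 : measurable_fun setT (prodf D (incr m0 j)).
  by apply: continuous_measurable_rV; exact: prodf_cont.
have mi := convol_integrable x iu mp1 HC1.
have Eu : convol (u \_ K) (prodf D (incr m0 j)) x =
   - fine (\int[mu]_(y in U) (u y * prodf D' (incr m0 j) y)%:E)%E.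
  have eN (a : R) : a = - (-1 * a) by ring.
  rewrite /convol [LHS]eN -RintegralZl// /Rintegral; congr (- fine _).
  rewrite [RHS]integral_mkcond; apply: eq_integral => y _.
  rewrite /= !patchE; case: ifPn => [|/negP]; rewrite inE => Ky.
    by rewrite mem_set ?E1; [congr EFin; ring|exact: KU].
  by rewrite mul0r mulr0 E1 out// oppr0 mulr0; case: ifP.
rewrite Eu W fineN opprK /convol /Rintegral; congr fine.
rewrite [LHS]integral_mkcond; apply: eq_integral => y _.
rewrite /= !patchE; case: ifPn => [|/negP]; rewrite inE => Uy.
  case: ifPn => [_|/negP]; first by rewrite E0.
  by rewrite inE => Ky; rewrite E0 out// mulr0 mul0r.
by rewrite memNset ?mul0r// => /KU.
Qed.

End weak_mollification.

Section approximation.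
Variables (R : realType) (p : nat).
Local Notation n := p.+1.
Local Notation mu := (@lebesgue_rV R n).
Local Notation m0 := (fun _ : 'I_n => 0%N).

(** Approximation of f by smooth maps on the cube of half-side s about z: U k i
    m is the derivative of multi-order m of the i-th component of the k-th map,
    and H majorises the n-th powers of all first derivatives. *)
Definition approx (f : 'rV[R]_n -> 'rV[R]_n) (Df : 'rV[R]_n -> 'M[R]_n) (z : 'rV[R]_n) (s : R)
    (U : nat -> 'I_n -> ('I_n -> nat) -> 'rV[R]_n -> R) (H : 'rV[R]_n -> R) (B : R) : Prop :=
  [/\ forall k i m (x v : 'rV[R]_n), is_derive x v (U k i m) (\sum_j v ord0 j * U k i (incr m j) x),
      forall k i m, exists2 C : R, 0 <= C & forall x, `|U k i m x| <= C,
      forall k i x, cube z s x -> `|U k i m0 x| <= B,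
      forall i x, cube z s x -> U k i m0 x @[k --> \oo] --> f x ord0 i &
      [/\ mu.-integrable (cube z s) (EFin \o H), forall x, cube z s x -> 0 <= H x,
        {ae mu, forall x, cube z s x -> forall i j, U k i (incr m0 j) x @[k --> \oo] --> Df x i j} &
        {ae mu, forall x, cube z s x -> forall k i j, `|U k i (incr m0 j) x| ^+ n <= H x}]].

Lemma coord_cont_at (f : 'rV[R]_n -> 'rV[R]_n) (Om : set 'rV[R]_n) i : open Om ->
  {within Om, continuous f} -> forall x, Om x -> {for x, continuous (fun x => f x ord0 i)}.
Proof.
move=> oO; rewrite continuous_open_subspace// => cf x Ox.
apply: (@continuous_comp _ _ _ f (fun y : 'rV[R]_n => y ord0 i)).
  by apply: cf; rewrite inE.
exact: coord_continuous.
Qed.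

Lemma coord_bounded (f : 'rV[R]_n -> 'rV[R]_n) (Om K : set 'rV[R]_n) i : open Om ->
  {within Om, continuous f} -> compact K -> K `<=` Om ->
  exists2 B : R, 0 <= B & forall x, K x -> `|f x ord0 i| <= B.
Proof.
move=> oO cf cK KO.
have cfK : {within K, continuous (fun x => f x ord0 i)}.
  apply: continuous_in_subspaceT => x; rewrite inE => Kx.
  by apply: coord_cont_at oO cf _ (KO _ Kx).
have [M [Mr HM]] := compact_bounded (continuous_compact cfK cK).
exists (`|M| + 1); first by rewrite addr_ge0.
move=> x Kx; apply: HM; last by exists x.
by rewrite (le_lt_trans (ler_norm M))// ltrDl.
Qed.

(** Mollification of f, extended by 0 outside a larger closed cube. The k-th
    radius makes the errors on all first derivatives at most 2^-(k+1) in n-th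
    power mean, so that fast_Lp_ae applies to them; the values converge by
    continuity of f. *)
Lemma approx_exists (Om : set 'rV[R]_n) (f : 'rV[R]_n -> 'rV[R]_n) (Df : 'rV[R]_n -> 'M[R]_n)
    (z : 'rV[R]_n) (s rho : R) :
  open Om -> {within Om, continuous f} -> weak_derivative Om f Df ->
  (forall i j, Ln Om (fun x => Df x i j)) ->
  0 < s -> s < rho -> ccube z rho `<=` Om ->
  exists U H B, approx f Df z s U H B.
Proof.
move=> oO cf wD lD s0 srho KO.
set K := ccube z rho in KO.
have cK : compact K by exact: compact_ccube.
have mK : measurable K by exact: measurable_ccube.
have rho0 : 0 < rho by exact: lt_trans srho.
have mOm : measurable Om by exact: open_measurable_rV.
pose A := cube z s; have mA : measurable A by exact: measurable_cube.
have AK : A `<=` K by move=> x Ax i; apply: ltW; exact: lt_trans (Ax i) srho.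
pose u i := (fun x => f x ord0 i) \_ K.
pose g i j := (fun x => Df x i j) \_ K.
have iu i : mu.-integrable setT (EFin \o u i).
  by have [l _ _] := wD i ord0; exact: loc_restrict_integrable l cK mK KO.
have mg i j : measurable_fun setT (g i j).
  have [m _] := lD i j; apply/(measurable_restrictT (fun x => Df x i j) mK).
  exact: (measurable_funS mOm KO m).
have ig i j : (\int[mu]_x (`|g i j x| ^+ n)%:E < +oo)%E.
  have [m H] := lD i j; apply: le_lt_trans H.
  rewrite [leRHS]integral_mkcond; apply: ge0_le_integral => //.
  - by apply/measurable_EFinP; apply: measurable_funX; exact: measurableT_comp.
  - apply/(measurable_restrictT (fun x => (`|Df x i j| ^+ n)%:E) mOm).
    by apply/measurable_EFinP; apply: measurable_funX; exact: measurableT_comp.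
  - move=> x _; rewrite /g !patchE; case: ifPn => [|_].
      by rewrite inE => /KO Ox; rewrite mem_set.
    by rewrite normr0 expr0n; case: ifP; rewrite // lee_fin exprn_ge0.
have g0 i j x : ~ cube z (rho + 1) x -> g i j x = 0.
  move=> nx; rewrite /g patchE memNset// => Kx; apply: nx => k.
  by apply: le_lt_trans (Kx k) _; rewrite ltrDl.
have rho10 : 0 < rho + 1 by rewrite addr_gt0.
have igg i j : mu.-integrable setT (EFin \o g i j).
  exact: Lp_integrable (mg i j) (ig i j) (g0 i j) rho10.
have step k : exists q : R * ('I_n -> nat -> R -> R),
   [/\ 0 < q.1, s + q.1 <= rho, q.1 < k.+1%:R^-1, mollifier q.1 q.2 &
    forall i j, (\int[mu]_x (`|convol (g i j) (prodf q.2 m0) x - g i j x| ^+ n)%:E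
       <= (1 / (2 ^ k.+1)%:R)%:E)%E].
  have e0 : 0 < 1 / (2 ^ k.+1)%:R :> R by rewrite divr_gt0// ltr0n expn_gt0.
  have /choice[d dP] : forall ij : 'I_n * 'I_n, exists d : R, 0 < d /\
      forall eps D, 0 < eps -> eps < d -> mollifier eps D ->
    (\int[mu]_x (`|convol (g ij.1 ij.2) (prodf D m0) x - g ij.1 ij.2 x| ^+ n)%:E
       <= (1 / (2 ^ k.+1)%:R)%:E)%E.
    move=> [i j] /=; have [d d0 H] := convol_Lp (mg i j) (ig i j) (g0 i j) rho10 e0.
    by exists d.
  pose dm := \big[Num.min/1]_ij d ij.
  have dm0 : 0 < dm by apply: lt_bigmin => // ij _; have [] := dP ij.
  pose eps := Num.min (rho - s) (Num.min (k.+1%:R^-1) dm) / 2.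
  have M0 : 0 < Num.min (rho - s) (Num.min (k.+1%:R^-1) dm).
    by rewrite !lt_min subr_gt0 srho dm0 invr_gt0 ltr0n.
  have eps0 : 0 < eps by rewrite divr_gt0.
  have [D mD] := @mollifier_exists R p.+1 ord0 eps eps0.
  have epsM : eps < Num.min (rho - s) (Num.min (k.+1%:R^-1) dm).
    by rewrite /eps ltr_pdivrMr// ltr_pMr// ltr1n.
  move: epsM; rewrite !lt_min => /and3P[e1 e2 e3].
  exists (eps, D); split => //=; first by rewrite -lerBrDl ltW.
  move=> i j; have [_ H] := dP (i, j); apply: (H eps D) => //.
  by apply: lt_le_trans e3 _; exact: bigmin_le.
have /choice[q qP] := step.
pose U k i m := convol (u i) (prodf (q k).2 m).
have UD k i j x : A x -> U k i (incr m0 j) x = convol (g i j) (prodf (q k).2 m0) x.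
  move=> Ax; have [q0 q1 _ q2 _] := qP k.
  exact: (convol_weak (wD i j) KO q2 q1 Ax).
have gD i j x : A x -> g i j x = Df x i j.
  by move=> /AK Kx; rewrite /g patchE mem_set.
have smq k c : smooth_seq ((q k).2 c) by have [_ _ _ [sD _ _ _] _] := qP k; exact: sD.
have Uder k i m (x v : 'rV[R]_n) : is_derive x v (U k i m) (\sum_j v ord0 j * U k i (incr m j) x).
  exact: convol_derive.
have Ucont k i m : continuous (U k i m) by exact: convol_cont.
have ae ij : exists Hij : 'rV[R]_n -> R, [/\ mu.-integrable A (EFin \o Hij),
    (forall x, A x -> 0 <= Hij x),
    {ae mu, forall x, A x -> U k ij.1 (incr m0 ij.2) x @[k --> \oo] --> Df x ij.1 ij.2} &
    {ae mu, forall x, A x -> forall k, `|U k ij.1 (incr m0 ij.2) x| ^+ n <= Hij x}].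
  case: ij => i j /=; apply: fast_Lp_ae => //.
  - by move=> k; apply: measurable_funTS; exact: continuous_measurable_rV.
  - have [m _] := lD i j; apply: measurable_funS m => //; exact: subset_trans AK KO.
  - have [m H] := lD i j; apply: le_lt_trans H; apply: ge0_subset_integral => //.
    + by apply/measurable_EFinP; apply: measurable_funX; exact: measurableT_comp.
    + exact: subset_trans AK KO.
  - move=> k; have [_ _ _ _ H] := qP k; apply: le_trans (H i j).
    rewrite (eq_integral (fun x => (`|convol (g i j) (prodf (q k).2 m0) x - g i j x| ^+ n)%:E)).
      apply: ge0_subset_integral => //; apply/measurable_EFinP; apply: measurable_funX.
      apply: measurableT_comp => //; apply: measurable_funB => //.
      apply: continuous_measurable_rV.
      exact: convol_cont (igg i j) (smq k).
    by move=> x; rewrite inE => Ax; rewrite UD// gD.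
have /choice[Hf HP] := ae.
have /choice[Bf BP] : forall i, exists B : R, 0 <= B /\ forall x, K x -> `|f x ord0 i| <= B.
  by move=> i; have [B B0 HB] := coord_bounded i oO cf cK KO; exists B.
have msub k i x c := convol_sub x c (let: And5 _ _ _ h _ := qP k in h) (iu i).
have near_x k (x y : 'rV[R]_n) : prodf (q k).2 m0 (x - y) != 0 -> forall l, `|y ord0 l - x ord0 l| < (q k).1.
  move=> nz l; rewrite ltNge; apply/negP => ql; move/eqP: nz; apply.
  have [_ _ _ mD _] := qP k; apply: (mollifier_out mD) => /(_ l).
  by rewrite !mxE subr0 distrC ltNge ql.
have avg k i (x : 'rV[R]_n) (c e : R) : 0 <= e -> (forall y : 'rV[R]_n, (forall l, `|y ord0 l - x ord0 l| < (q k).1) -> `|u i y - c| <= e) ->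
    `|U k i m0 x - c| <= e.
  move=> e0 He; have [_ _ _ mD _] := qP k.
  have [_ _ D0 _] := mD; have mpsi := mollifier_meas mD.
  rewrite -lee_fin; apply: le_trans (msub k i x c) _.
  apply: (@le_trans _ _ (\int[mu]_y (e%:E * (prodf (q k).2 m0 (x - y)%R)%:E))%E).
    have mu' : measurable_fun setT (u i) by apply/measurable_EFinP; exact: measurable_int (iu i).
    have mp : measurable_fun setT (fun y : 'rV[R]_n => prodf (q k).2 m0 (x - y)).
      exact: (measurableT_comp mpsi (measurable_sub x)).
    apply: ge0_le_integral => //.
    - by move=> y _; rewrite lee_fin mulr_ge0.
    - apply/measurable_EFinP; apply: measurable_funM => //; apply: measurableT_comp => //.
      exact: measurable_funB.
    - by apply: emeasurable_funM => //; exact/measurable_EFinP.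
    - move=> y _; rewrite -EFinM lee_fin.
      have [->|nz] := eqVneq (prodf (q k).2 m0 (x - y)) 0; first by rewrite !mulr0.
      by rewrite ler_wpM2r//; apply: He; exact: near_x nz.
  rewrite ge0_integralZl//.
  - by rewrite (mollifier_int x mD) mule1.
  - by apply/measurable_EFinP; exact: (measurableT_comp mpsi (measurable_sub x)).
  - by move=> y _; rewrite lee_fin.
exists U, (fun x => \sum_ij Hf ij x), (\sum_i Bf i); split => //.
- move=> k i m; have [C C0 HC] := prodf_bound m (smq k).
  exists (C * \int[mu]_y `|u i y|); first by rewrite mulr_ge0// Rintegral_ge0.
  move=> x; apply: convol_bound => //; apply: continuous_measurable_rV; exact: prodf_cont.
- move=> k i x Ax.
  have Bi : `|U k i m0 x - 0| <= Bf i.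
    have [B0 HB] := BP i; apply: avg => // y _; rewrite subr0 /u patchE.
    by case: ifPn; rewrite ?normr0// inE => Ky; exact: HB.
  rewrite subr0 in Bi; apply: le_trans Bi _.
  rewrite (bigD1 i)//= lerDl; apply: sumr_ge0 => l _; by have [] := BP l.
- move=> i x Ax; apply/cvgrPdist_le => e e0.
  have Ox : Om x by exact/KO/AK.
  have := @coord_cont_at f Om i oO cf x Ox.
  move=> /(@cvgrPdist_le _ _ _ (nbhs (x : 'rV[R]_n))) => /(_ _ e0).
  move=> /nbhs_ballP[d /= d0 Hd].
  near=> k; rewrite distrC; apply: avg; first exact: ltW.
  move=> y yq; have [q0 q1 q2 _ _] := qP k.
  have qd : (q k).1 < d.
    apply: lt_trans q2 _; near: k; exact: (near_infty_natSinv_lt (PosNum d0)).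
  have Ky : K y.
    move=> l; have := yq l; have := Ax l => h1 h2.
    rewrite (_ : y ord0 l - _ = (y ord0 l - x ord0 l) + (x ord0 l - z ord0 l)); last by ring.
    rewrite (le_trans (ler_normD _ _))//; lra.
  rewrite /u patchE mem_set// distrC; apply: Hd.
  rewrite -cube_ball// => l; exact: lt_trans (yq l) qd.
- split.
  + rewrite (_ : EFin \o _ = (fun x => \sum_ij (EFin \o Hf ij) x)%E).
      by apply: integrable_sum => // ij _; have [] := HP ij.
    by apply/funext => x /=; rewrite sumEFin.
  + by move=> x Ax; apply: sumr_ge0 => ij _; have [_ H _ _] := HP ij; exact: H.
  + have : {ae mu, forall x, forall ij : 'I_n * 'I_n, A x -> U k ij.1 (incr m0 ij.2) x @[k --> \oo] --> Df x ij.1 ij.2}.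
      by apply: filter_forall => ij; have [] := HP ij.
    by apply: filterS => x H Ax i j; exact: (H (i, j) Ax).
  + have : {ae mu, forall x, forall ij : 'I_n * 'I_n, A x -> forall k, `|U k ij.1 (incr m0 ij.2) x| ^+ n <= Hf ij x}.
      by apply: filter_forall => ij; have [] := HP ij.
    apply: filterS => x H Ax k i j; apply: le_trans (H (i, j) Ax k) _.
    rewrite (bigD1 (i, j))//= lerDl; apply: sumr_ge0 => ij _; have [_ + _ _] := HP ij.
    exact.
Unshelve. all: by end_near. Qed.

End approximation.

(** * The Jacobian determinant as a null Lagrangian *)

Section null_lagrangian.
Import fingroup perm.
Variables (R : realType) (p : nat).
Local Notation n := p.+1.
Local Notation mu := (@lebesgue_rV R n).
Local Notation m0 := (fun _ : 'I_n => 0%N).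

Definition bounded_cont (f : 'rV[R]_n -> R) : Prop :=
  continuous f /\ exists2 C : R, 0 <= C & forall x, `|f x| <= C.

Lemma bounded_cont_cst c : bounded_cont (fun=> c).
Proof. by split; [exact: cst_continuous|exists `|c|]. Qed.

Lemma bounded_contM f g : bounded_cont f -> bounded_cont g -> bounded_cont (fun x => f x * g x).
Proof.
move=> [cf [C C0 HC]] [cg [C' C'0 HC']]; split.
  by move=> x; apply: continuousM; [exact: cf|exact: cg].
exists (C * C'); first exact: mulr_ge0.
by move=> x; rewrite normrM ler_pM.
Qed.

Lemma bounded_contD f g : bounded_cont f -> bounded_cont g -> bounded_cont (fun x => f x + g x).
Proof.
move=> [cf [C C0 HC]] [cg [C' C'0 HC']]; split.
  by move=> x; apply: continuousD; [exact: cf|exact: cg].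
exists (C + C'); first exact: addr_ge0.
by move=> x; rewrite (le_trans (ler_normD _ _))// lerD.
Qed.

Lemma bounded_cont_prod (I : Type) (r : seq I) (f : I -> 'rV[R]_n -> R) :
  (forall i, bounded_cont (f i)) -> bounded_cont (fun x => \prod_(i <- r) f i x).
Proof.
move=> cf; elim: r => [|a r IH].
  rewrite (_ : (fun _ => _) = fun=> 1); first exact: bounded_cont_cst.
  by apply/funext => x; rewrite big_nil.
rewrite (_ : (fun _ => _) = fun x => f a x * \prod_(i <- r) f i x); first exact: bounded_contM.
by apply/funext => x; rewrite big_cons.
Qed.

Lemma bounded_cont_sum (I : Type) (r : seq I) (f : I -> 'rV[R]_n -> R) :
  (forall i, bounded_cont (f i)) -> bounded_cont (fun x => \sum_(i <- r) f i x).
Proof.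
move=> cf; elim: r => [|a r IH].
  rewrite (_ : (fun _ => _) = fun=> 0); first exact: bounded_cont_cst.
  by apply/funext => x; rewrite big_nil.
rewrite (_ : (fun _ => _) = fun x => f a x + \sum_(i <- r) f i x); first exact: bounded_contD.
by apply/funext => x; rewrite big_cons.
Qed.

Lemma bounded_cont_meas f : bounded_cont f -> measurable_fun setT f.
Proof. by move=> [cf _]; exact: continuous_measurable_rV. Qed.

Lemma bounded_cont_integrable f (z : 'rV[R]_n) s : 0 < s -> bounded_cont f -> (forall x, ~ cube z s x -> f x = 0) ->
  mu.-integrable setT (EFin \o f).
Proof.
move=> s0 cf f0; have [_ [C C0 HC]] := cf.
have mc := measurable_cube z s.
apply/integrableP; split; first by apply/measurable_EFinP; exact: bounded_cont_meas.
apply: (@le_lt_trans _ _ (\int[mu]_(x in cube z s) C%:E)%E).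
  rewrite [leRHS]integral_mkcond; apply: ge0_le_integral => //.
  - by apply: measurableT_comp => //; apply/measurable_EFinP; exact: bounded_cont_meas.
  - by apply/(measurable_restrictT (fun=> C%:E) mc).
  - move=> x _; rewrite patchE; have [cx|nx] := pselect (cube z s x).
      by rewrite mem_set// lee_fin.
    by rewrite memNset// /= f0// normr0.
rewrite integral_cst//; have /= -> := lebesgue_rV_cube z (ltW s0).
by rewrite -EFinM ltry.
Qed.

Lemma Rintegral_translate (f : 'rV[R]_n -> R) (z : 'rV[R]_n) : measurable_fun setT f ->
  \int[mu]_x f (x + z) = \int[mu]_x f x.
Proof.
move=> mf; rewrite /Rintegral; congr fine.
have mE : measurable_fun setT (fun x => (f x)%:E) by exact/measurable_EFinP.
have Hp := ge0_integral_translate z (measurable_funepos mE) (fun x => funepos_ge0 _ x).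
have Hn := ge0_integral_translate z (measurable_funeneg mE) (fun x => funeneg_ge0 _ x).
rewrite integralE [RHS]integralE; congr (_ - _)%E.
  by rewrite -[RHS]Hp; apply: eq_integral => x _; rewrite unlock.
by rewrite -[RHS]Hn; apply: eq_integral => x _; rewrite unlock.
Qed.

(** The integral of T (x + y) in y does not depend on x, by translation
    invariance; its derivative in x along v is the integral of T'. *)
Lemma integral_partial_eq0 (T T' : 'rV[R]_n -> R) (v z : 'rV[R]_n) (s : R) :
  0 < s -> `|v| <= 1 -> bounded_cont T -> bounded_cont T' -> (forall x, is_derive x v T (T' x)) ->
  (forall x, ~ cube z s x -> T x = 0) -> (forall x, ~ cube z s x -> T' x = 0) ->
  \int[mu]_x T' x = 0.
Proof.
move=> s0 v1 cT cT' dT T0 T'0.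
have iT := bounded_cont_integrable s0 cT T0.
have [_ [C C0 HC]] := cT'.
have mc := measurable_cube z (s + 1).
pose c1 : 'rV[R]_n -> R := \1_(cube z (s + 1)).
have ic1 : mu.-integrable setT (EFin \o c1).
  apply/integrableP; split; first by apply/measurable_EFinP; exact: measurable_indic.
  under eq_integral do rewrite gee0_abs ?lee_fin//.
  rewrite integral_indic// setIT; have /= -> := lebesgue_rV_cube z (ltW (addr_gt0 s0 ltr01)).
  exact: ltry.
have trans (x y : 'rV[R]_n) : T (x + y) = T (y + x) by rewrite addrC.
have D : is_derive (0 : 'rV[R]_n) v (fun x' => \int[mu]_y T (x' + y)) (\int[mu]_y T' (0 + y)).
  apply: (@is_derive_under_integral _ _ (fun x y => T (x + y)) (fun x y => T' (x + y)) (fun y => C * c1 y)).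
  - move=> t; apply/integrableP; split.
      apply/measurable_EFinP; under eq_fun do rewrite trans.
      exact: (measurableT_comp (bounded_cont_meas cT) (measurable_translate _)).
    have /integrableP[_] := iT.
    rewrite -(@ge0_integral_translate R n (t *: v + 0) (fun x => `|(EFin \o T) x|)%E)//.
      by move=> H; under eq_integral do rewrite /= trans.
    by apply: measurableT_comp => //; apply/measurable_EFinP; exact: bounded_cont_meas.
  - move=> t y; apply/(@is_derive_lineP R n (fun x => T (x + y)) 0 v).
    have := dT (t *: v + y); rewrite -[X in T' (X + y)]addr0 => /is_derive_lineP.
    rewrite addr0 => H; rewrite addr0.
    suff -> : (fun h : R => T (h *: v + 0 + y)) = (fun h : R => T (h *: v + y)) by [].
    by apply/funext => h; rewrite addr0.
  - move=> t y t1; rewrite addr0 /c1 indicE.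
    have [cy|cy] := pselect (cube z (s + 1) y); first by rewrite mem_set// mulr1.
    rewrite T'0 ?normr0 ?mulr_ge0//; apply: contra_not cy => H i.
    have := H i; rewrite !mxE => h1.
    have : `|t * v ord0 i| <= 1.
      by rewrite normrM mulr_ile1// ?(ltW t1)// (le_trans (coord_le_norm _ _)).
    rewrite (_ : y ord0 i - _ = (t * v ord0 i + y ord0 i - z ord0 i) - t * v ord0 i); last by ring.
    move=> h2; rewrite (le_lt_trans (ler_normB _ _))//; lra.
  - by have := integrableZl measurableT C ic1.
have : \int[mu]_y T' (0 + y) = 0.
  rewrite -(derive_val (is_derive := D)).
  rewrite (_ : (fun x' => _) = cst (\int[mu]_y T y)); first by rewrite derive_cst.
  apply/funext => x /=; under eq_Rintegral do rewrite trans.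
  by rewrite Rintegral_translate//; exact: bounded_cont_meas.
by under eq_Rintegral do rewrite add0r.
Qed.

Definition detrow (A : 'M[R]_n) (w : 'I_n -> R) : 'M[R]_n :=
  \matrix_(i, j) if i == ord0 then w j else A i j.

Lemma derive_dir (f : 'rV[R]_n -> R) (g : 'I_n -> 'rV[R]_n -> R) (x : 'rV[R]_n) j :
  (forall v : 'rV[R]_n, is_derive x v f (\sum_l v ord0 l * g l x)) ->
  is_derive x (delta_mx ord0 j) f (g j x).
Proof.
move=> H; apply: is_derive_eq (H _) _.
rewrite (bigD1 j)//= big1 ?addr0 ?mxE ?eqxx ?mul1r// => k /negbTE kj.
by rewrite mxE kj andbF mul0r.
Qed.

Section smooth_identity.
Variables (F : 'I_n -> ('I_n -> nat) -> 'rV[R]_n -> R).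
Hypothesis dF : forall i m (x v : 'rV[R]_n),
  is_derive x v (F i m) (\sum_j v ord0 j * F i (incr m j) x).
Hypothesis bF : forall i m, exists2 C : R, 0 <= C & forall x, `|F i m x| <= C.

Lemma bounded_cont_jet i m : bounded_cont (F i m).
Proof.
split; last exact: bF.
have /choice[C HC] : forall j : 'I_n, exists C : R, 0 <= C /\ forall x, `|F i (incr m j) x| <= C.
  by move=> j; have [C C0 CP] := bF i (incr m j); exists C.
apply: (@bounded_derive_continuous _ _ _ (fun j => F i (incr m j)) (\sum_j C j)) => //.
move=> j x; have [Cj0 Cj] := HC j; apply: le_trans (Cj x) _.
by rewrite (bigD1 j)//= lerDl; apply: sumr_ge0 => k _; have [] := HC k.
Qed.

Definition jacmx (x : 'rV[R]_n) : 'M[R]_n := \matrix_(i, j) F i (incr m0 j) x.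

(** G s is the product of the entries selected by the permutation s in all rows
    but the first, and the functions Gk s k are the terms of its derivative in
    the direction s ord0. *)
Let r0 := [seq i <- index_enum 'I_n | i != ord0].
Let G (s : 'S_n) x := \prod_(i <- r0) F i (incr m0 (s i)) x.
Let Gk (s : 'S_n) k x := \prod_(i <- r0)
  if i == k then F k (incr (incr m0 (s k)) (s ord0)) x else F i (incr m0 (s i)) x.

Let dG (s : 'S_n) (x : 'rV[R]_n) : is_derive x (delta_mx ord0 (s ord0)) (G s) (\sum_(k <- r0) Gk s k x).
Proof.
apply: is_derive_line.
have := @is_derive_prod_seq R _
  (fun i (h : R) => F i (incr m0 (s i)) (h *: delta_mx ord0 (s ord0) + x))
  (fun i => F i (incr (incr m0 (s i)) (s ord0)) x) 0 r0 (filter_uniq _ (index_enum_uniq _)).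
move=> H; have {}H := H _; apply: is_derive_eq.
  apply: H => i; apply/is_derive_lineP; rewrite scale0r add0r.
  by apply: (derive_dir (g := fun l => F i (incr (incr m0 (s i)) l))) => v; exact: dF.
apply: eq_bigr => k _; apply: eq_bigr => i _; rewrite scale0r add0r.
by case: eqP => // ->.
Qed.

(** Composing s with the transposition of ord0 and k exchanges the two orders of
    derivation in row k, and changes the sign. Thus the cofactors of the first
    row of a Jacobian matrix are divergence free. *)
Let cancel x : \sum_(s : 'S_n) (-1) ^+ s * \sum_(k <- r0) Gk s k x = 0.
Proof.
under eq_bigr do rewrite mulr_sumr.
rewrite exchange_big /= big_seq big1// => k; rewrite mem_filter => /andP[k0 _].
set S := \sum_s _.
suff : S = - S by move=> SN; lra.
rewrite {1}/S (reindex_inj (mulgI (tperm ord0 k))) /= -sumrN; apply: eq_bigr => s _.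
rewrite odd_permM odd_tperm eq_sym k0 /= signrN mulNr; congr (- (_ * _)).
apply: eq_big_seq => i; rewrite mem_filter => /andP[i0 _].
rewrite !permM tpermL tpermR; case: eqP => [_|/eqP ik]; first by rewrite incrC.
by rewrite tpermD// eq_sym.
Qed.

(** As the cofactors of the first row are divergence free, the determinant is a
    signed sum of directional derivatives of the compactly supported functions w
    G s. *)
Lemma det_row_integral0 (w : 'rV[R]_n -> R) (w' : 'I_n -> 'rV[R]_n -> R) (z : 'rV[R]_n) (r : R) :
  0 < r -> bounded_cont w -> (forall j, bounded_cont (w' j)) ->
  (forall x (v : 'rV[R]_n), is_derive x v w (\sum_j v ord0 j * w' j x)) ->
  (forall x, ~ cube z r x -> w x = 0) -> (forall j x, ~ cube z r x -> w' j x = 0) ->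
  \int[mu]_x \det (detrow (jacmx x) (fun j => w' j x)) = 0.
Proof.
move=> r_gt0 cw cw' dw w0 w'0.
pose T (s : 'S_n) (x : 'rV[R]_n) := w x * G s x.
pose T' (s : 'S_n) (x : 'rV[R]_n) := w' (s ord0) x * G s x + w x * \sum_(k <- r0) Gk s k x.
have cG s : bounded_cont (G s) by apply: bounded_cont_prod => i; exact: bounded_cont_jet.
have cGk s : bounded_cont (fun x => \sum_(k <- r0) Gk s k x).
  by apply: bounded_cont_sum => k; apply: bounded_cont_prod => i; case: eqP => _; exact: bounded_cont_jet.
have cT' s : bounded_cont (T' s) by apply: bounded_contD; exact: bounded_contM.
have dT (s : 'S_n) (x : 'rV[R]_n) : is_derive x (delta_mx ord0 (s ord0)) (T s) (T' s x).
  have := is_deriveM (derive_dir (s ord0) (dw x)) (dG s x).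
  by rewrite /GRing.scale /= => H; apply: is_derive_eq H _; rewrite /T'; ring.
have T'0 s x : ~ cube z r x -> T' s x = 0.
  by move=> nx; rewrite /T' w'0// w0// !mul0r addr0.
have iT' s : mu.-integrable setT (EFin \o T' s) by exact: bounded_cont_integrable r_gt0 (cT' s) (T'0 s).
have I0 s : \int[mu]_x T' s x = 0.
  apply: (@integral_partial_eq0 (T s) (T' s) (delta_mx ord0 (s ord0)) z r) => //.
  - rewrite [leLHS]/Num.norm /= mx_normrE; apply/bigmax_leP; split => // ij _.
    by rewrite mxE; case: (_ && _); rewrite ?normr1 ?normr0.
  - exact: bounded_contM.
  - by move=> x nx; rewrite /T w0// mul0r.
  - by move=> x; exact: T'0.
transitivity (\int[mu]_x (\sum_(s : 'S_n) (-1) ^+ s * T' s x)).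
  apply: eq_Rintegral => x _; rewrite /T' /determinant.
  transitivity (\sum_(s : 'S_n) ((-1) ^+ s * (w' (s ord0) x * G s x)) + w x * \sum_(s : 'S_n) (-1) ^+ s * \sum_(k <- r0) Gk s k x).
    rewrite cancel mulr0 addr0; apply: eq_bigr => s _; congr (_ * _).
    rewrite (bigD1 ord0)//= !mxE eqxx; congr (_ * _).
    by rewrite /G /r0 big_filter; apply: eq_bigr => i /negbTE i0; rewrite !mxE i0.
  rewrite mulr_sumr -big_split /=; apply: eq_bigr => s _.
  by rewrite mulrDr; congr (_ + _); rewrite mulrCA.
rewrite (@RintegralZ_sum R n _ _ (fun s : 'S_n => (-1) ^+ s) T')//.
by rewrite big1// => s _; rewrite I0 mulr0.
Qed.

End smooth_identity.

End null_lagrangian.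

(** * Integration by parts of the Jacobian of a weakly differentiable map *)

Section jacobian_limit.
Import fingroup perm.
Variables (R : realType) (p : nat).
Local Notation n := p.+1.
Local Notation mu := (@lebesgue_rV R n).
Local Notation m0 := (fun _ : 'I_n => 0%N).

Lemma prod_le_pow (a : 'I_n -> R) (h : R) : 0 <= h -> (forall i, `|a i| ^+ n <= h) ->
  `|\prod_i a i| <= h.
Proof.
move=> h0 ah; rewrite -(@ler_pXn2r _ n)// ?nnegrE// -normrX -prodrXl normr_prod.
apply: le_trans (_ : \prod_(i < n) h <= _); last by rewrite prodr_const card_ord.
by apply: ler_prod => i _; rewrite normr_ge0 normrX ah.
Qed.

Lemma det_bound (A : 'M[R]_n) (h : R) : 0 <= h -> (forall i j, `|A i j| ^+ n <= h) ->
  `|\det A| <= (n`!)%:R * h.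
Proof.
move=> h0 Ah; rewrite /determinant; apply: le_trans (ler_norm_sum _ _ _) _.
apply: le_trans (_ : \sum_(s : 'S_n) h <= _).
  apply: ler_sum => s _; rewrite normrM normrX normrN1 expr1n mul1r.
  exact: prod_le_pow.
by rewrite sumr_const card_Sn mulr_natl.
Qed.

Lemma cvg_prod_seq (I : Type) (r : seq I) (u : nat -> I -> R) (l : I -> R) :
  (forall i, u k i @[k --> \oo] --> l i) ->
  \prod_(i <- r) u k i @[k --> \oo] --> \prod_(i <- r) l i.
Proof.
move=> H; elim: r => [|a r IH].
  rewrite big_nil (_ : (fun _ => _) = fun=> 1); first exact: cvg_cst.
  by apply/funext => k; rewrite big_nil.
rewrite big_cons (_ : (fun _ => _) = (fun k => u k a * \prod_(i <- r) u k i)).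
  by apply: cvgM; [exact: H|exact: IH].
by apply/funext => k; rewrite big_cons.
Qed.

Lemma cvg_sum_seq (I : Type) (r : seq I) (u : nat -> I -> R) (l : I -> R) :
  (forall i, u k i @[k --> \oo] --> l i) ->
  \sum_(i <- r) u k i @[k --> \oo] --> \sum_(i <- r) l i.
Proof.
move=> H; elim: r => [|a r IH].
  rewrite big_nil (_ : (fun _ => _) = fun=> 0); first exact: cvg_cst.
  by apply/funext => k; rewrite big_nil.
rewrite big_cons (_ : (fun _ => _) = (fun k => u k a + \sum_(i <- r) u k i)).
  by apply: cvgD; [exact: H|exact: IH].
by apply/funext => k; rewrite big_cons.
Qed.

Lemma cvg_det (A : nat -> 'M[R]_n) (B : 'M[R]_n) :
  (forall i j, A k i j @[k --> \oo] --> B i j) -> \det (A k) @[k --> \oo] --> \det B.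
Proof.
move=> H; rewrite /determinant; apply: cvg_sum_seq => s; apply: cvgM.
  exact: cvg_cst.
by apply: cvg_prod_seq => i; exact: H.
Qed.

Lemma measurable_det (E : set 'rV[R]_n) (M : 'rV[R]_n -> 'M[R]_n) :
  (forall i j, measurable_fun E (fun x => M x i j)) -> measurable_fun E (fun x => \det (M x)).
Proof.
move=> mM; rewrite /determinant; apply: measurable_sum => s; apply: measurable_funM => //.
by apply: measurable_prod => i _; exact: mM.
Qed.

Lemma bounded_cont_det (M : 'rV[R]_n -> 'M[R]_n) :
  (forall i j, bounded_cont (fun x => M x i j)) -> bounded_cont (fun x => \det (M x)).
Proof.
move=> cM; rewrite /determinant; apply: bounded_cont_sum => t; apply: bounded_contM; first exact: bounded_cont_cst.
by apply: bounded_cont_prod => i; exact: cM.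
Qed.

Lemma det_detrow_lin (A : 'M[R]_n) (w : 'I_n -> R) (a b : R) :
  \det (detrow A (fun j => a * w j + b * A ord0 j)) = a * \det (detrow A w) + b * \det A.
Proof.
apply: (@determinant_multilinear _ _ _ _ _ ord0).
- by apply/rowP => j; rewrite !mxE eqxx.
- by apply/matrixP => i j; rewrite !mxE.
- by apply/matrixP => i j; rewrite !mxE.
Qed.

Lemma det_detrow0 (A : 'M[R]_n) (w : 'I_n -> R) : (forall j, w j = 0) -> \det (detrow A w) = 0.
Proof.
move=> w0; rewrite /determinant big1// => s _.
by rewrite (bigD1 ord0)//= mxE eqxx w0 mul0r mulr0.
Qed.

Variables (f : 'rV[R]_n -> 'rV[R]_n) (Df : 'rV[R]_n -> 'M[R]_n) (z : 'rV[R]_n) (s : R).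
Variables (U : nat -> 'I_n -> ('I_n -> nat) -> 'rV[R]_n -> R) (H : 'rV[R]_n -> R) (B : R).
Hypotheses (s0 : 0 < s) (apx : approx f Df z s U H B).
Hypothesis mf : measurable_fun (cube z s) (fun x => f x ord0 ord0).
Hypothesis mDf : forall i j, measurable_fun (cube z s) (fun x => Df x i j).
Variables (eta : 'rV[R]_n -> R) (eta' : 'I_n -> 'rV[R]_n -> R).
Hypotheses (ceta : bounded_cont eta) (ceta' : forall j, bounded_cont (eta' j)).
Hypothesis deta : forall x (v : 'rV[R]_n), is_derive x v eta (\sum_j v ord0 j * eta' j x).
Hypotheses (eta0 : forall x, ~ cube z s x -> eta x = 0)
  (eta'0 : forall j x, ~ cube z s x -> eta' j x = 0).

(** For smooth maps this is det_row_integral0 with w = (u_0 - c) eta, where the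
    product rule splits the first row of the determinant. Both sides pass to the
    limit by dominated convergence, as a determinant is bounded by the n-th
    powers of its entries. *)
Lemma jacobian_by_parts (c : R) :
  mu.-integrable (cube z s) (EFin \o (fun x => eta x * \det (Df x))) /\
  (`|\int[mu]_(x in cube z s) (eta x * \det (Df x))|%:E <=
   \int[mu]_(x in cube z s) (`|(f x ord0 ord0 - c) * \det (detrow (Df x) (eta'^~ x))|)%:E)%E.
Proof.
have [dU bU UB Uf [iH H0 aeU aeH]] := apx.
pose A := cube z s; have mA : measurable A by exact: measurable_cube.
pose M k x := jacmx (U k) x.
have cU k i m : bounded_cont (U k i m) by exact: (bounded_cont_jet (dU k) (bU k)).
have ME k x i j : M k x i j = U k i (incr m0 j) x by rewrite !mxE.
have [_ [C C0 HC]] := ceta.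
have /choice[E HE] : forall j, exists E : R, 0 <= E /\ forall x, `|eta' j x| <= E.
  by move=> j; have [_ [E E0 HE]] := ceta' j; exists E.
pose E1 := \sum_j E j.
have E10 : 0 <= E1 by apply: sumr_ge0 => j _; have [] := HE j.
have HE1 j x : `|eta' j x| <= E1.
  have [_ h] := HE j; apply: le_trans (h x) _.
  by rewrite /E1 (bigD1 j)//= lerDl; apply: sumr_ge0 => k _; have [] := HE k.
(* the integrand whose integral vanishes for the k-th smooth map *)
pose g k x := (U k ord0 m0 x - c) * \det (detrow (M k x) (eta'^~ x)) + eta x * \det (M k x).
have gE k x : g k x = \det (detrow (M k x) (fun j => (U k ord0 m0 x - c) * eta' j x + eta x * U k ord0 (incr m0 j) x)).
  rewrite /g -det_detrow_lin; congr (\det (detrow _ _)).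
  by apply/funext => j; rewrite ME.
have mM k i j : measurable_fun setT (fun x => M k x i j).
  by under eq_fun do rewrite ME; exact: bounded_cont_meas.
have metar k i j : measurable_fun setT (fun x => detrow (M k x) (eta'^~ x) i j).
  rewrite (_ : (fun x => _) = if i == ord0 then eta' j else (fun x => M k x i j)).
    by case: ifP => _ //; exact: bounded_cont_meas.
  by apply/funext => x; rewrite mxE; case: ifP.
have mg k : measurable_fun setT (g k).
  apply: measurable_funD; apply: measurable_funM.
  - by apply: measurable_funB => //; exact: bounded_cont_meas.
  - exact: measurable_det.
  - exact: bounded_cont_meas.
  - exact: measurable_det.
have g_out k x : ~ A x -> g k x = 0.
  by move=> nx; rewrite gE det_detrow0// => j; rewrite eta0// eta'0// mul0r mulr0 addr0.
have Ig k : \int[mu]_(x in A) g k x = 0.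
  rewrite Rintegral_mkcond (_ : g k \_ A = g k); last first.
    by apply/funext => x; rewrite patchE; have [h|h] := pselect (A x); [rewrite mem_set|rewrite memNset// g_out].
  rewrite -[RHS](@det_row_integral0 R p (U k) (dU k) (bU k)
     (fun x => (U k ord0 m0 x - c) * eta x)
     (fun j x => (U k ord0 m0 x - c) * eta' j x + eta x * U k ord0 (incr m0 j) x) z s)//.
  - by apply: eq_Rintegral => x _; rewrite gE.
  - by apply: bounded_contM => //; apply: bounded_contD => //; exact: bounded_cont_cst.
  - by move=> j; apply: bounded_contD; apply: bounded_contM => //; apply: bounded_contD => //; exact: bounded_cont_cst.
  - move=> x v.
    have d1 := is_deriveD (dU k ord0 m0 x v) (is_derive_cst (- c) x v).
    have := is_deriveM d1 (deta x v); rewrite /GRing.scale /= addr0.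
    move=> d2; apply: is_derive_eq d2 _.
    rewrite (_ : (U k ord0 m0 + cst (- c)) x = U k ord0 m0 x - c)//.
    rewrite [X in X + _]mulr_sumr [X in _ + X]mulr_sumr -big_split /=.
    by apply: eq_bigr => j _; ring.
  - by move=> x nx; rewrite eta0// mulr0.
  - by move=> j x nx; rewrite eta0// eta'0// mul0r mulr0 addr0.
have iH' a b : mu.-integrable A (EFin \o (fun x => a * H x + b)).
  have i1 := integrableZl mA a iH.
  have i2 : mu.-integrable A (EFin \o (fun=> b : R)).
    apply: measurable_bounded_integrable => //.
    - by have /= -> := lebesgue_rV_cube z (ltW s0); rewrite ltry.
    - by exists `|b|; split => // M' /ltW + x _; exact.
  by have := integrableD mA i1 i2; apply: eq_integrable => // x _.
have n0 : (0 : R) <= (n`!)%:R by [].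
pose J x := eta x * \det (Df x).
pose N x := (f x ord0 ord0 - c) * \det (detrow (Df x) (eta'^~ x)).
have mJ : measurable_fun A J.
  by apply: measurable_funM; [apply: measurable_funTS; exact: bounded_cont_meas|exact: measurable_det].
have mN : measurable_fun A N.
  apply: measurable_funM; first exact: measurable_funB.
  apply: measurable_det => i j.
  rewrite (_ : (fun x => _) = if i == ord0 then eta' j else (fun x => Df x i j)).
    by case: ifP => _ //; apply: measurable_funTS; exact: bounded_cont_meas.
  by apply/funext => x; rewrite mxE; case: ifP.
have iJ : mu.-integrable A (EFin \o J).
  have [] := @dominated_convergence _ _ R mu A mA (fun k => EFin \o (fun x => eta x * \det (M k x)))
    (EFin \o J) (EFin \o (fun x => C * (n`!)%:R * H x + 0)) => //.
  - move=> k; apply/measurable_EFinP; apply: measurable_funTS.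
    by apply: measurable_funM; [exact: bounded_cont_meas|exact: measurable_det].
  - exact/measurable_EFinP.
  - apply: filterS aeU => x hx Ax; apply: cvg_EFin; first exact: nearW.
    apply: cvgM; first exact: cvg_cst.
    by apply: cvg_det => i j; under eq_fun do rewrite ME; exact: hx.
  - apply: filterS aeH => x hx k Ax; rewrite /= lee_fin addr0 normrM -mulrA ler_pM//.
    by apply: det_bound => [|i j]; [exact: H0|rewrite ME; exact: hx].
have [iNJ _ lNJ] : [/\ mu.-integrable A (EFin \o (fun x => N x + J x)), True &
    (\int[mu]_(x in A) (g k x)%:E @[k --> \oo] --> \int[mu]_(x in A) (N x + J x)%:E)%E].
  have Bc x k : A x -> `|U k ord0 m0 x - c| <= B + `|c|.
    by move=> Ax; rewrite (le_trans (ler_normB _ _))// lerD2r; exact: UB.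
  have [] := @dominated_convergence _ _ R mu A mA (fun k => EFin \o g k)
    (EFin \o (fun x => N x + J x))
    (EFin \o (fun x => ((B + `|c|) * (n`!)%:R + C * (n`!)%:R) * H x + (B + `|c|) * ((n`!)%:R * E1 ^+ n))) => //.
  - by move=> k; apply/measurable_EFinP; exact: measurable_funTS.
  - by apply/measurable_EFinP; exact: measurable_funD.
  - apply: filterS aeU => x hx Ax; apply: cvg_EFin; first exact: nearW.
    apply: cvgD.
      apply: cvgM; first by apply: cvgB; [exact: Uf|exact: cvg_cst].
      apply: cvg_det => i j; rewrite mxE; under eq_fun do rewrite mxE.
      case: ifP => _; first exact: cvg_cst.
      by under eq_fun do rewrite ME; exact: hx.
    apply: cvgM; first exact: cvg_cst.
    by apply: cvg_det => i j; under eq_fun do rewrite ME; exact: hx.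
  - apply: filterS aeH => x hx k Ax; rewrite /= lee_fin.
    have h1 : `|\det (detrow (M k x) (eta'^~ x))| <= (n`!)%:R * (H x + E1 ^+ n).
      apply: det_bound => [|i j]; first by rewrite addr_ge0 ?exprn_ge0// H0.
      rewrite mxE; case: ifP => _.
        apply: le_trans (_ : E1 ^+ n <= _); last by rewrite lerDr H0.
        by rewrite lerXn2r ?nnegrE.
      rewrite ME; apply: le_trans (hx Ax k i j) _.
      by rewrite lerDl exprn_ge0.
    have h2 : `|\det (M k x)| <= (n`!)%:R * H x.
      by apply: det_bound => [|i j]; [exact: H0|rewrite ME; exact: hx].
    apply: le_trans (ler_normD _ _) _; rewrite !normrM.
    have h3 := ler_pM (normr_ge0 _) (normr_ge0 _) (Bc x k Ax) h1.
    have h4 := ler_pM (normr_ge0 _) (normr_ge0 _) (HC x) h2.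
    apply: le_trans (lerD h3 h4) _.
    by rewrite le_eqVlt; apply/orP; left; apply/eqP; ring.
split; first exact: iJ.
have ig k : mu.-integrable A (EFin \o g k).
  apply: (@integrableS _ _ _ mu setT) => //.
  apply: (bounded_cont_integrable s0 _ (g_out k)).
  rewrite (_ : g k = fun x => \det (detrow (M k x) (fun j => (U k ord0 m0 x - c) * eta' j x + eta x * U k ord0 (incr m0 j) x))); last first.
    by apply/funext => x; exact: gE.
  apply: bounded_cont_det => i j.
  rewrite (_ : (fun x => _) = if i == ord0 then (fun x => (U k ord0 m0 x - c) * eta' j x + eta x * U k ord0 (incr m0 j) x) else U k i (incr m0 j)).
    case: ifP => _ //; apply: bounded_contD; apply: bounded_contM => //.
    by apply: bounded_contD => //; exact: bounded_cont_cst.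
  by apply/funext => x; rewrite !mxE; case: ifP.
have INJ : (\int[mu]_(x in A) (N x + J x)%:E = 0)%E.
  have E0 k : (\int[mu]_(x in A) (g k x)%:E = 0)%E.
    have fi := integrable_fin_num mA (ig k).
    by rewrite -[LHS](fineK fi); have := Ig k; rewrite /Rintegral => ->.
  move: lNJ; rewrite (_ : (fun k => _) = fun=> 0%E); last by apply/funext => k; exact: E0.
  move=> lNJ.
  exact: (cvg_unique _ lNJ (cvg_cst _)).
have iN : mu.-integrable A (EFin \o N).
  have := integrableB mA iNJ iJ; apply: eq_integrable => // x _ /=.
  by rewrite -EFinB addrK.
have JN : \int[mu]_(x in A) J x = - \int[mu]_(x in A) N x.
  have : \int[mu]_(x in A) (N x + J x) = 0 by rewrite /Rintegral INJ.
  by rewrite RintegralD// => /eqP; rewrite addrC addr_eq0 => /eqP.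
rewrite JN normrN EFin_normr_Rintegral//.
by apply: le_abse_integral => //; exact/measurable_EFinP.
Qed.

End jacobian_limit.

(** * Poincare's inequality on convex sets *)

Section poincare.
Variables (R : realType) (p : nat).
Local Notation n := p.+1.
Local Notation mu := (@lebesgue_rV R n).
Local Notation leb := (@lebesgue_measure R).
Local Notation m0 := (fun _ : 'I_n => 0%N).

(** The fundamental theorem of calculus and Jensen's inequality on [0, 1]. *)
Lemma pow_increment_le_integral (h h' : R -> R) : (forall t : R, is_derive t 1 h (h' t)) ->
  continuous h' ->
  ((`|h 1 - h 0| ^+ n)%:E <= \int[leb]_(t in `[0%R, 1%R]) (`|h' t| ^+ n)%:E)%E.
Proof.
move=> dh ch'.
have ch : continuous h.
  move=> t; apply: differentiable_continuous; apply/derivable1_diffP.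
  exact: (let: DeriveDef d _ := dh t in d).
have mh' : measurable_fun setT h' by exact: continuous_measurable_fun.
have m01 : measurable (`[0%R, 1%R] : set (measurableTypeR R)) by exact: measurable_itv.
have F : (\int[leb]_(t in `[0%R, 1%R]) (h' t)%:E = (h 1)%:E - (h 0)%:E)%E.
  apply: continuous_FTC2 => //.
  - exact: continuous_subspaceT.
  - split; first by move=> t _; exact: (let: DeriveDef d _ := dh t in d).
      by apply: cvg_at_right_filter; exact: ch.
    by apply: cvg_at_left_filter; exact: ch.
  - by move=> t _; rewrite derive1E; have dt := dh t; exact: derive_val.
pose w : R -> R := \1_(`[0%R, 1%R]).
have mw : measurable_fun (setT : set (measurableTypeR R)) w by exact: measurable_indic.
have w0 t : 0 <= w t by rewrite /w indicE.
have mah : measurable_fun (setT : set (measurableTypeR R)) (fun t => `|h' t|).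
  exact: measurableT_comp.
have wE (g : R -> R) : (\int[leb]_t (g t * w t)%:E = \int[leb]_(t in `[0%R, 1%R]) (g t)%:E)%E.
  rewrite [RHS]integral_mkcond; apply: eq_integral => t _; rewrite patchE /w indicE.
  by case: ifP => _ /=; rewrite ?mulr1// mulr0.
have wI : (\int[leb]_t (w t)%:E = 1)%E.
  transitivity (\int[leb]_(t in `[0%R, 1%R]) (cst 1%E t))%E.
    transitivity (\int[leb]_t (cst 1 t * w t)%:E)%E; last exact: (wE (cst 1)).
    by apply: eq_integral => t _; rewrite /= mul1r.
  rewrite integral_cst// [X in (_ * X)%E]lebesgue_measure_itv /= lte_fin ltr01.
  by rewrite -EFinB subr0 mule1.
have := @jensen_pow _ _ R leb w (fun t => `|h' t|) `|h 1 - h 0| p mw mah w0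
  (fun t => normr_ge0 _) wI (normr_ge0 _).
rewrite !wE; apply.
rewrite (_ : (`|h 1 - h 0|%:E = `|\int[leb]_(t in `[0%R, 1%R]) (h' t)%:E|)%E).
  apply: le_abse_integral => //; apply/measurable_EFinP; exact: measurable_funTS.
by rewrite F.
Qed.

Lemma sum_pow_le (a : 'I_n -> R) q : (forall j, 0 <= a j) ->
  (\sum_j a j) ^+ q <= n%:R ^+ q * \sum_j a j ^+ q.
Proof.
move=> a0; have [j _ jP] := @arg_maxP _ _ _ ord0 xpredT a isT.
apply: le_trans (_ : (n%:R * a j) ^+ q <= _).
  rewrite lerXn2r ?nnegrE ?sumr_ge0// ?mulr_ge0//.
  by rewrite mulr_natl -[X in _ *+ X]card_ord -sumr_const ler_sum// => i _; exact: jP.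
rewrite exprMn ler_pM2l ?exprn_gt0// (bigD1 j)//= lerDl sumr_ge0// => i _.
exact: exprn_ge0.
Qed.

Lemma lebesgue_rV_square_sigma_finite : sigma_finite setT (mu \x mu)%E.
Proof.
exists (fun k => cube 0 k%:R `*` cube 0 k%:R).
  apply/esym/seteqP; split => // -[x y] _.
  have sub m k : (m <= k)%N -> cube (0 : 'rV[R]_n) m%:R `<=` cube 0 k%:R.
    by move=> mk w h i; apply: lt_le_trans (h i) _; rewrite ler_nat.
  have [i _ xi] : (\bigcup_k cube (0 : 'rV[R]_n) k%:R) x by rewrite cube_cover.
  have [j _ yj] : (\bigcup_k cube (0 : 'rV[R]_n) k%:R) y by rewrite cube_cover.
  exists (maxn i j) => //; split => /=.
    by apply: sub xi; exact: leq_maxl.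
  by apply: sub yj; exact: leq_maxr.
move=> k; have mc := measurable_cube (0 : 'rV[R]_n) k%:R.
split; first exact: measurableX.
by rewrite product_measure1E//= lebesgue_rV_cube// -EFinM ltry.
Qed.

Lemma fubini_tonelli_square d (T : measurableType d)
    (m : {sigma_finite_measure set T -> \bar R}) (F : ('rV[R]_n * 'rV[R]_n) * T -> \bar R) :
  measurable_fun setT F -> (forall q, 0 <= F q)%E ->
  (\int[mu \x mu]_q \int[m]_t F (q, t) = \int[m]_t \int[mu \x mu]_q F (q, t))%E /\
  measurable_fun setT (fun q => \int[m]_t F (q, t))%E /\
  measurable_fun setT (fun t => \int[mu \x mu]_q F (q, t))%E.
Proof.
pose m2 : {sigma_finite_measure set _ -> \bar R} := HB.pack (mu \x mu)%E
  (Measure_isSigmaFinite.Build _ _ _ (mu \x mu)%E lebesgue_rV_square_sigma_finite).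
move=> mF F0.
have := @fubini_tonelli _ _ _ _ R m2 m F mF F0.
have := @measurable_fun_fubini_tonelli_F _ _ _ _ R m F mF F0.
have := @measurable_fun_fubini_tonelli_G _ _ _ _ R m2 F mF F0.
move=> h1 h2 h3.
split; first by [].
by split.
Qed.
Lemma cvg_pow (v : nat -> R) (l : R) q : v k @[k --> \oo] --> l ->
  v k ^+ q @[k --> \oo] --> l ^+ q.
Proof.
move=> vl; elim: q => [|q IH]; first exact: cvg_cst.
rewrite exprS (_ : (fun k => _) = (fun k => v k * v k ^+ q)); first exact: cvgM.
by apply/funext => k; rewrite exprS.
Qed.

Lemma le_limn_einf (v w : (\bar R)^nat) : (forall k, v k <= w k)%E ->
  (limn_einf v <= limn_einf w)%E.
Proof.
move=> vw; rewrite !limn_einf_lim; apply: lee_lim; [exact: is_cvg_einfs|exact: is_cvg_einfs|].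
apply: nearW => k; apply: le_ereal_inf_tmp => _ [m km <-].
by apply: le_trans (vw m); apply: ereal_inf_lbound; exists m.
Qed.

Section smooth.
Variables (u : 'rV[R]_n -> R) (u' : 'I_n -> 'rV[R]_n -> R).
Hypothesis du : forall x (v : 'rV[R]_n), is_derive x v u (\sum_j v ord0 j * u' j x).
Hypothesis cu : continuous u.
Hypothesis cu' : forall j, continuous (u' j).

Let g x := \sum_j `|u' j x| ^+ n.

Lemma increment_le_integral (x y : 'rV[R]_n) (d : R) : 0 <= d ->
  (forall j, `|x ord0 j - y ord0 j| <= d) ->
  ((`|u x - u y| ^+ n)%:E <= ((d * n%:R) ^+ n)%:E *
    \int[leb]_(t in `[0%R, 1%R]) (g (t *: (x - y) + y)%R)%:E)%E.
Proof.
move=> d0 xyd.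
pose h (t : R) := u (t *: (x - y) + y).
pose h' (t : R) := \sum_j (x - y) ord0 j * u' j (t *: (x - y) + y).
have dh (t : R) : is_derive t 1 h (h' t) by apply/is_derive_lineP; exact: du.
have cl : continuous (fun t : R => t *: (x - y) + y).
  move=> t; apply: cvgD; last exact: cvg_cst.
  by apply: cvgZl; exact: cvg_id.
have cu'l j : continuous (fun t : R => u' j (t *: (x - y) + y)).
  by move=> t; apply: continuous_comp; [exact: cl|exact: cu'].
have ch' : continuous h'.
  apply: continuous_sum_seq => j t; apply: cvgM; first exact: cvg_cst.
  exact: cu'l.
have cgl : continuous (fun t : R => g (t *: (x - y) + y)).
  apply: continuous_sum_seq => j t.
  apply: (@continuous_comp _ _ _ (fun t : R => `|u' j (t *: (x - y) + y)|) (fun r => r ^+ n)).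
    by apply: cvg_norm; exact: cu'l.
  exact: exprn_continuous.
have := pow_increment_le_integral dh ch'.
rewrite /h scale1r subrK scale0r add0r => /le_trans; apply.
have m01 : measurable (`[0%R, 1%R] : set (measurableTypeR R)) by exact: measurable_itv.
have mg : measurable_fun (`[0%R, 1%R] : set (measurableTypeR R)) (fun t => g (t *: (x - y) + y)).
  by apply: measurable_funTS; exact: continuous_measurable_fun.
rewrite -ge0_integralZl//.
- apply: ge0_le_integral => //.
  + apply/measurable_EFinP; apply: measurable_funX; apply: measurableT_comp => //.
    by apply: measurable_funTS; exact: continuous_measurable_fun.
  + apply: emeasurable_funM => //; exact/measurable_EFinP.
  + move=> t _; rewrite -EFinM lee_fin exprMn -mulrA.
    apply: le_trans (_ : (d * \sum_j `|u' j (t *: (x - y) + y)|) ^+ n <= _).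
      rewrite lerXn2r ?nnegrE ?mulr_ge0 ?sumr_ge0//.
      rewrite mulr_sumr; apply: le_trans (ler_norm_sum _ _ _) _.
      by apply: ler_sum => j _; rewrite normrM ler_wpM2r// !mxE.
    rewrite exprMn ler_wpM2l ?exprn_ge0//.
    by apply: sum_pow_le.
- exact/measurable_EFinP.
- by move=> t _; rewrite lee_fin sumr_ge0// => j _; rewrite exprn_ge0.
- by rewrite lee_fin exprn_ge0// mulr_ge0.
Qed.

Variables (S : set 'rV[R]_n) (d : R).
Hypotheses (mS : measurable S) (d0 : 0 <= d).
Hypothesis convS : forall (x y : 'rV[R]_n) (t : R), S x -> S y -> 0 <= t -> t <= 1 -> S (t *: (x - y) + y).
Hypothesis diamS : forall (x y : 'rV[R]_n) j, S x -> S y -> `|x ord0 j - y ord0 j| <= d.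

Lemma measurable_segment :
  measurable_fun setT (fun q : ('rV[R]_n * 'rV[R]_n) * measurableTypeR R =>
    (q.2 : R) *: (q.1.1 - q.1.2) + q.1.2).
Proof.
apply: measurable_fun_rV => i.
rewrite (_ : _ \o _ = fun q : ('rV[R]_n * 'rV[R]_n) * measurableTypeR R =>
   ((q.2 : measurableTypeR R) * ((q.1.1 ord0 i : measurableTypeR R) - (q.1.2 ord0 i : measurableTypeR R)) + (q.1.2 ord0 i : measurableTypeR R))%R); last first.
  by apply/funext => q /=; rewrite !mxE.
have m1 : measurable_fun setT (fun q : ('rV[R]_n * 'rV[R]_n) * measurableTypeR R => (q.1.1 ord0 i : measurableTypeR R)).
  apply: (measurableT_comp (measurable_coord i)).
  exact: (measurableT_comp measurable_fst measurable_fst).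
have m2 : measurable_fun setT (fun q : ('rV[R]_n * 'rV[R]_n) * measurableTypeR R => (q.1.2 ord0 i : measurableTypeR R)).
  apply: (measurableT_comp (measurable_coord i)).
  exact: (measurableT_comp measurable_snd measurable_fst).
apply: measurable_funD => //; apply: measurable_funM; first exact: measurable_snd.
exact: measurable_funB.
Qed.

(** Integrate over S x S the bound of an increment by an integral along a
    segment. For t >= 1/2 the substitution of t (x - y) + y for x, and for t <=
    1/2 the same substitution for y, costs a factor at most 2^n; convexity keeps
    the segment in S. *)
Lemma smooth_poincare :
  (\int[mu \x mu]_q (\1_S q.1 * \1_S q.2 * `|u q.1 - u q.2| ^+ n)%:E <=
   ((d * n%:R) ^+ n * 2 ^+ n)%:E * mu S * \int[mu]_(x in S) (g x)%:E)%E.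
Proof.
have g0 x : 0 <= g x by apply: sumr_ge0 => j _; rewrite exprn_ge0.
have mg : measurable_fun setT g.
  apply: measurable_sum => j; apply: measurable_funX; apply: measurableT_comp => //.
  exact: continuous_measurable_rV.
have mu1 : measurable_fun setT u by exact: continuous_measurable_rV.
pose gS x := g x * \1_S x.
have i01 (A : set 'rV[R]_n) x : 0 <= \1_A x :> R by rewrite indicE.
have iS x : S x -> \1_S x = 1 :> R by move=> Sx; rewrite indicE mem_set.
have gS0 x : 0 <= gS x by rewrite mulr_ge0.
have mi : measurable_fun setT (\1_S : 'rV[R]_n -> R) by exact: measurable_indic.
have mgS : measurable_fun setT gS by exact: measurable_funM.
pose I01 : R -> R := \1_(`[0%R, 1%R]).
have I010 t : 0 <= I01 t by rewrite /I01 indicE.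
have m01 : measurable (`[0%R, 1%R] : set (measurableTypeR R)) by exact: measurable_itv.
have mI : measurable_fun (setT : set (measurableTypeR R)) I01 by exact: measurable_indic.
pose F (q : ('rV[R]_n * 'rV[R]_n) * measurableTypeR R) : \bar R :=
  (\1_S q.1.1 * \1_S q.1.2 * I01 q.2 * gS ((q.2 : R) *: (q.1.1 - q.1.2) + q.1.2)%R)%:E.
have F0 q : (0 <= F q)%E by rewrite lee_fin !mulr_ge0.
have mF : measurable_fun setT F.
  apply/measurable_EFinP; apply: measurable_funM; last exact: (measurableT_comp mgS measurable_segment).
  apply: measurable_funM; last exact: (measurableT_comp mI measurable_snd).
  apply: measurable_funM.
    exact: (measurableT_comp mi (measurableT_comp measurable_fst measurable_fst)).
  exact: (measurableT_comp mi (measurableT_comp measurable_snd measurable_fst)).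
have [Fub [mFF mFG]] := @fubini_tonelli_square _ _ leb F mF F0.
set C := (d * n%:R) ^+ n.
have C0 : 0 <= C by rewrite exprn_ge0// mulr_ge0.
set I := (\int[mu]_(x in S) (g x)%:E)%E.
have IE : (\int[mu]_x (gS x)%:E = I)%E.
  rewrite /I [RHS]integral_mkcond; apply: eq_integral => x _; rewrite patchE /gS indicE.
  by case: ifP => _ /=; rewrite ?mulr1// mulr0.
have I0 : (0 <= I)%E by apply: integral_ge0 => x _; rewrite lee_fin.
apply: (@le_trans _ _ (C%:E * \int[mu \x mu]_q \int[leb]_t F (q, t))%E).
  rewrite -ge0_integralZl//; last by move=> q _; exact: integral_ge0.
  apply: ge0_le_integral => //.
  - apply/measurable_EFinP; apply: measurable_funM.
      apply: measurable_funM; first exact: (measurableT_comp mi measurable_fst).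
      exact: (measurableT_comp mi measurable_snd).
    apply: measurable_funX; apply: measurableT_comp => //; apply: measurable_funB.
      exact: (measurableT_comp mu1 measurable_fst).
    exact: (measurableT_comp mu1 measurable_snd).
  - by apply: emeasurable_funM => //; exact: mFF.
  - move=> [x y] _ /=.
    have [Sx|nSx] := pselect (S x); last first.
      by rewrite [X in (X * _ * _)%:E]indicE memNset// !mul0r mule_ge0 ?lee_fin// integral_ge0.
    have [Sy|nSy] := pselect (S y); last first.
      by rewrite [X in (_ * X * _)%:E]indicE memNset// mulr0 mul0r mule_ge0 ?lee_fin// integral_ge0.
    rewrite !iS// !mul1r.
    apply: le_trans (increment_le_integral d0 (fun j => diamS j Sx Sy)) _.
    rewrite le_eqVlt; apply/orP; left; apply/eqP; congr (_ * _)%E.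
    rewrite integral_mkcond; apply: eq_integral => t _.
    rewrite patchE /F /= !iS// !mul1r /I01 indicE.
    case: ifP => /=; last by rewrite mul0r.
    rewrite inE /= in_itv /= => /andP[t0 t1].
    by rewrite /gS iS ?mulr1 ?mul1r//; exact: convS.
rewrite EFinM -!muleA lee_wpmul2l ?lee_fin//.
rewrite Fub.
set c := (_ * _)%E.
have c0 : (0 <= c)%E by rewrite !mule_ge0.
apply: (@le_trans _ _ (\int[leb]_(t in `[0%R, 1%R]) c)%E); last first.
  rewrite integral_cst// [X in (_ * X)%E]lebesgue_measure_itv /= lte_fin ltr01 -EFinB subr0.
  by rewrite mule1.
rewrite [leRHS]integral_mkcond.
apply: ge0_le_integral => //.
- by move=> t _; exact: integral_ge0.
- by apply/(measurable_restrictT (fun=> c) m01); exact: measurable_cst.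
move=> t _; rewrite patchE.
case: ifPn; last first.
  move=> tn; rewrite integral0_eq// => q _.
  by rewrite /F /= /I01 [X in _ * X * _]indicE (negbTE tn) mulr0 mul0r.
rewrite inE /= in_itv /= => /andP[t0 t1].
pose Ft q := F (q, t).
have mFt : measurable_fun setT Ft by exact: (measurableT_comp mF (measurable_pair2 t)).
have Ft0 q : (0 <= Ft q)%E by exact: F0.
have I01t : I01 t = 1 by rewrite /I01 indicE mem_set//= in_itv /= t0 t1.
have half (a : R) (b y : 'rV[R]_n) (k : 'rV[R]_n -> \bar R) : 1/2 <= a ->
   measurable_fun setT k -> (forall x, 0 <= k x)%E ->
   (forall x, k x <= (\1_S y * gS (a *: x + b))%:E)%E ->
   (\int[mu]_x k x <= (\1_S y)%:E * ((2 ^+ n)%:E * I))%E.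
  move=> a2 mk k0 kle; have a0 : 0 < a by apply: lt_le_trans a2; rewrite divr_gt0.
  have mga : measurable_fun setT (fun x : 'rV[R]_n => gS (a *: x + b)).
    exact: (measurableT_comp mgS (measurable_affine _ _)).
  apply: (@le_trans _ _ (\int[mu]_x ((\1_S y)%:E * (gS (a *: x + b))%:E))%E).
    apply: ge0_le_integral => //; apply: emeasurable_funM => //; exact/measurable_EFinP.
  rewrite ge0_integralZl//; last 2 first.
  - exact/measurable_EFinP.
  - by move=> x _; rewrite lee_fin.
  rewrite lee_wpmul2l ?lee_fin//.
  rewrite (ge0_integral_affine b a0 (f := EFin \o gS)) ?IE//; last exact/measurable_EFinP.
  have a12 : a^-1 <= 2 by rewrite -[leRHS]invrK lef_pV2 ?posrE ?invr_gt0// -div1r.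
  by rewrite lee_wpmul2r// lee_fin lerXn2r ?nnegrE ?invr_ge0// ltW.
have fin (k : 'rV[R]_n -> \bar R) : measurable_fun setT k -> (forall x, 0 <= k x)%E ->
   (forall x, k x <= (\1_S x)%:E * ((2 ^+ n)%:E * I))%E -> (\int[mu]_x k x <= c)%E.
  move=> mk k0 kle; apply: (@le_trans _ _ (\int[mu]_y ((\1_S y)%:E * ((2 ^+ n)%:E * I)))%E).
    by apply: ge0_le_integral => //; apply: emeasurable_funM => //; exact/measurable_EFinP.
  rewrite ge0_integralZr//; first last.
  - by rewrite mule_ge0 ?lee_fin.
  - exact/measurable_EFinP.
  by rewrite integral_indic// setIT muleCA.
have iS1 x : \1_S x <= 1 :> R by rewrite indicE; case: (_ \in _).
have -> : (\int[mu \x mu]_q F (q, t) = \int[mu \x mu]_q Ft q)%E by [].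
have [t2|t2] := leP (1/2) t.
- rewrite (fubini_tonelli2 Ft)//; apply: fin => [|y|y].
  + exact: measurable_fun_fubini_tonelli_G.
  + exact: integral_ge0.
  + apply: (half t (y - t *: y)) => // [|x].
      exact: (measurableT_comp mFt (measurable_pair2 y)).
    rewrite /Ft /F /= I01t mulr1 lee_fin.
    have -> : t *: x + (y - t *: y) = t *: (x - y) + y by rewrite scalerBr addrA addrAC.
    by rewrite ler_wpM2r// ler_piMl.
- rewrite (fubini_tonelli1 Ft)//; apply: fin => [|x|x].
  + exact: measurable_fun_fubini_tonelli_F.
  + exact: integral_ge0.
  + apply: (half (1 - t) (t *: x)) => // [||y].
      lra.
      exact: (measurableT_comp mFt (measurable_pair1 x)).
    rewrite /Ft /F /= I01t mulr1 lee_fin [\1_S x * _]mulrC.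
    have -> : t *: (x - y) + y = (1 - t) *: y + t *: x.
      by rewrite scalerBr scalerBl scale1r addrAC -addrA addrC.
    by rewrite ler_wpM2r// ler_piMl.
Qed.

End smooth.

Section limit.
Variables (f : 'rV[R]_n -> 'rV[R]_n) (Df : 'rV[R]_n -> 'M[R]_n) (z : 'rV[R]_n) (s : R).
Variables (U : nat -> 'I_n -> ('I_n -> nat) -> 'rV[R]_n -> R) (H : 'rV[R]_n -> R) (B : R).
Hypothesis apx : approx f Df z s U H B.
Variable i : 'I_n.
Hypothesis mf : measurable_fun (cube z s) (fun x => f x ord0 i).
Hypothesis mDf : forall j, measurable_fun (cube z s) (fun x => Df x i j).
Variables (S : set 'rV[R]_n) (d : R).
Hypotheses (mS : measurable S) (d0 : 0 <= d) (Sz : S `<=` cube z s).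
Hypothesis convS : forall (x y : 'rV[R]_n) (t : R), S x -> S y -> 0 <= t -> t <= 1 -> S (t *: (x - y) + y).
Hypothesis diamS : forall (x y : 'rV[R]_n) j, S x -> S y -> `|x ord0 j - y ord0 j| <= d.
Hypothesis muS : (mu S < +oo)%E.

Let g x := \sum_j `|Df x i j| ^+ n.

(** Fatou's lemma on the left-hand side, dominated convergence on the right-hand
    side. *)
Lemma poincare :
  (\int[mu \x mu]_q (\1_S q.1 * \1_S q.2 * `|f q.1 ord0 i - f q.2 ord0 i| ^+ n)%:E <=
   ((d * n%:R) ^+ n * 2 ^+ n)%:E * mu S * \int[mu]_(x in S) (g x)%:E)%E.
Proof.
have [dU bU UB Uf [iH H0 aeU aeH]] := apx.
have cU k m : bounded_cont (U k i m) by exact: (bounded_cont_jet (dU k) (bU k)).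
have mA : measurable (cube z s) by exact: measurable_cube.
pose gk k x := \sum_j `|U k i (incr m0 j) x| ^+ n.
have mgk k : measurable_fun setT (gk k).
  apply: measurable_sum => j; apply: measurable_funX; apply: measurableT_comp => //.
  exact: bounded_cont_meas.
have iHS : mu.-integrable S (EFin \o H) by exact: integrableS iH.
have lim_g : (\int[mu]_(x in S) (gk k x)%:E @[k --> \oo] --> \int[mu]_(x in S) (g x)%:E)%E.
  have [] := @dominated_convergence _ _ R mu S mS (fun k => EFin \o gk k) (EFin \o g)
    (EFin \o (fun x => n%:R * H x)) => //.
  - by move=> k; apply/measurable_EFinP; exact: measurable_funTS.
  - apply/measurable_EFinP; apply: measurable_sum => j; apply: measurable_funX.
    by apply: measurableT_comp => //; exact: (measurable_funS mA Sz (mDf j)).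
  - apply: filterS aeU => x hx Sx; apply: cvg_EFin; first exact: nearW.
    apply: cvg_sum_seq => j.
    by apply: cvg_pow; apply: cvg_norm; exact: (hx (Sz Sx)).
  - by have := integrableZl mS n%:R iHS; apply: eq_integrable.
  - apply: filterS aeH => x hx k Sx; rewrite /= lee_fin ger0_norm; last first.
      by apply: sumr_ge0 => j _; rewrite exprn_ge0.
    rewrite mulr_natl -[X in _ *+ X]card_ord -sumr_const; apply: ler_sum => j _.
    exact: (hx (Sz Sx)).
have i0 x : 0 <= \1_S x :> R by rewrite indicE.
have mi : measurable_fun setT (\1_S : 'rV[R]_n -> R) by exact: measurable_indic.
pose Dk k (q : 'rV[R]_n * 'rV[R]_n) : \bar R :=
  (\1_S q.1 * \1_S q.2 * `|U k i m0 q.1 - U k i m0 q.2| ^+ n)%:E.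
have mDk k : measurable_fun setT (Dk k).
  have mUk : measurable_fun setT (U k i m0) by exact: bounded_cont_meas.
  apply/measurable_EFinP; apply: measurable_funM.
    apply: measurable_funM; first exact: (measurableT_comp mi measurable_fst).
    exact: (measurableT_comp mi measurable_snd).
  apply: measurable_funX; apply: measurableT_comp => //; apply: measurable_funB.
    exact: (measurableT_comp mUk measurable_fst).
  exact: (measurableT_comp mUk measurable_snd).
have Dk0 k q : setT q -> (0 <= Dk k q)%E by move=> _; rewrite lee_fin !mulr_ge0// exprn_ge0.
have := @fatou _ _ R (mu \x mu)%E setT measurableT Dk mDk Dk0.
set C := _%:E; move=> fat.
have limR : ((C * mu S) * \int[mu]_(x in S) (gk k x)%:E @[k --> \oo] --> (C * mu S) * \int[mu]_(x in S) (g x)%:E)%E.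
  apply: cvgeZl => //; rewrite fin_numM// ge0_fin_numE//.
apply: le_trans (_ : (limn_einf (fun k => \int[mu \x mu]_q Dk k q) <= _)%E).
  apply: le_trans fat; rewrite le_eqVlt; apply/orP; left; apply/eqP.
  apply: eq_integral => q _; apply/esym.
  suff h : (Dk ^~ q k @[k --> \oo] --> (\1_S q.1 * \1_S q.2 * `|f q.1 ord0 i - f q.2 ord0 i| ^+ n)%:E)%E.
    rewrite is_cvg_limn_einfE; first exact: cvg_lim.
    by apply/cvg_ex; eexists; exact: h.
  apply: cvg_EFin; first exact: nearW.
  have [Sx|nSx] := pselect (S q.1); last first.
    rewrite (_ : (fun k => _) = fun=> 0).
      by rewrite indicE memNset// !mul0r; exact: cvg_cst.
    by apply/funext => k; rewrite /Dk /= [\1_S q.1]indicE memNset// !mul0r.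
  have [Sy|nSy] := pselect (S q.2); last first.
    rewrite (_ : (fun k => _) = fun=> 0).
      by rewrite [\1_S q.2]indicE memNset// mulr0 mul0r; exact: cvg_cst.
    by apply/funext => k; rewrite /Dk /= [\1_S q.2]indicE memNset// mulr0 mul0r.
  apply: cvgM; first exact: cvg_cst.
  apply: cvg_pow; apply: cvg_norm; apply: cvgB; apply: Uf; exact: Sz.
have limE : (limn ((fun k => C * mu S * \int[mu]_(x in S) (gk k x)%:E)) = C * mu S * \int[mu]_(x in S) (g x)%:E)%E.
  exact: cvg_lim.
rewrite -limE -is_cvg_limn_einfE; last by apply/cvg_ex; eexists; exact: limR.
have le k : (\int[mu \x mu]_q Dk k q <= C * mu S * \int[mu]_(x in S) (gk k x)%:E)%E.
  apply: (@smooth_poincare (U k i m0) (fun j => U k i (incr m0 j)) (dU k i m0) _ _ S d) => //.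
    by have [] := cU k m0.
  by move=> j; have [] := cU k (incr m0 j).
exact: le_limn_einf.
Qed.

(** Otherwise integration over y in S would contradict poincare; the term e
    makes the contradiction strict. *)
Lemma good_point (e : R) : 0 < e -> (0 < mu S)%E -> (\int[mu]_(x in S) (g x)%:E < +oo)%E ->
  exists2 y, S y & (\int[mu]_(x in S) (`|f x ord0 i - f y ord0 i| ^+ n)%:E <=
    ((d * n%:R) ^+ n * 2 ^+ n)%:E * \int[mu]_(x in S) (g x)%:E + e%:E)%E.
Proof.
move=> e0 S0; set I := (\int[mu]_(x in S) _)%E => Ioo.
have I0 : (0 <= I)%E.
  by apply: integral_ge0 => x _; rewrite lee_fin sumr_ge0// => j _; rewrite exprn_ge0.
have := poincare; set C := (_ * _).
have C0 : 0 <= C by rewrite mulr_ge0// exprn_ge0// mulr_ge0.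
set F := (fun q => _) => pF.
have mA : measurable (cube z s) by exact: measurable_cube.
pose fS := (fun x => f x ord0 i) \_ S.
have mfS : measurable_fun setT fS.
  by apply/(measurable_restrictT (fun x => f x ord0 i) mS); exact: measurable_funS mf.
have mi : measurable_fun setT (\1_S : 'rV[R]_n -> R) by exact: measurable_indic.
have FE : F = fun q => (\1_S q.1 * \1_S q.2 * `|fS q.1 - fS q.2| ^+ n)%:E.
  apply/funext => -[x y]; rewrite /F /fS !patchE /= !indicE.
  have [Sx|nSx] := pselect (S x); last by rewrite memNset// !mul0r.
  have [Sy|nSy] := pselect (S y); last by rewrite (memNset nSy)// mulr0 !mul0r.
  by rewrite !mem_set.
have mF : measurable_fun setT F.
  rewrite FE; apply/measurable_EFinP; apply: measurable_funM.
    apply: measurable_funM; first exact: (measurableT_comp mi measurable_fst).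
    exact: (measurableT_comp mi measurable_snd).
  apply: measurable_funX; apply: measurableT_comp => //; apply: measurable_funB.
    exact: (measurableT_comp mfS measurable_fst).
  exact: (measurableT_comp mfS measurable_snd).
have F0 q : (0 <= F q)%E by rewrite lee_fin !mulr_ge0// ?indicE// exprn_ge0.
apply: contrapT => nex.
have big y : S y -> (C%:E * I + e%:E <= \int[mu]_x F (x, y))%E.
  move=> Sy; rewrite (_ : \int[mu]_x F (x, y) = \int[mu]_(x in S) (`|f x ord0 i - f y ord0 i| ^+ n)%:E)%E.
    by rewrite leNgt; apply/negP => /ltW h; apply: nex; exists y.
  rewrite [RHS]integral_mkcond; apply: eq_integral => x _; rewrite patchE /F /= !indicE (mem_set Sy).
  by case: ifP => _; rewrite ?mulr1 ?mul1r// !mul0r.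
have : ((C%:E * I + e%:E) * mu S <= C%:E * mu S * I)%E.
  apply: le_trans pF; rewrite (fubini_tonelli2 F)//.
  rewrite -integral_cst// integral_mkcond; apply: ge0_le_integral => //.
  - move=> y _; rewrite patchE; case: ifP => // _.
    by rewrite /= adde_ge0 ?mule_ge0 ?lee_fin// ltW.
  - by apply/(measurable_restrictT (fun=> (C%:E * I + e%:E)%E) mS); exact: measurable_cst.
  - exact: measurable_fun_fubini_tonelli_G.
  - move=> y _; rewrite patchE; case: ifPn => [|_]; last exact: integral_ge0.
    by rewrite inE => Sy; exact: big.
have [a aE] : exists a, I = a%:E by exists (fine I); rewrite fineK// ge0_fin_numE.
have [m mE] : exists m, mu S = m%:E by exists (fine (mu S)); rewrite fineK// ge0_fin_numE.
move: S0; rewrite mE aE lte_fin => m_gt0.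
rewrite -[X in (X <= _)%E]/(((C * a + e) * m)%:E) -[X in (_ <= X)%E]/((C * m * a)%:E) lee_fin.
by rewrite mulrDl mulrAC gerDl leNgt mulr_gt0.
Qed.

End limit.
End poincare.

(** * Cut-off functions *)

Section cutoff1.
Variable R : realType.

(** A quadratic bound on the error differentiates pos2 at its kink and elsewhere
    alike. *)
Lemma is_derive_quadratic (f : R -> R) (x d : R) :
  (forall h, `|f (x + h) - f x - h * d| <= h ^+ 2) -> is_derive x 1 f d.
Proof.
move=> H.
have cd : h^-1 *: ((f \o shift x) (h *: (1 : R)) - f x) @[h --> 0^'] --> d.
  apply/cvgrPdist_le => e e0; near=> h.
  have h0 : h != 0 by near: h; exact: nbhs_dnbhs_neq.
  have he : `|h| < e by near: h; apply: dnbhs0_lt.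
  rewrite /= [h *: 1]mulr1 distrC [h + x]addrC /GRing.scale /=.
  have -> : h^-1 * (f (x + h) - f x) - d = h^-1 * (f (x + h) - f x - h * d).
    by rewrite [RHS]mulrBr mulrA mulVf// mul1r.
  rewrite normrM normfV ler_pdivrMl ?normr_gt0//.
  apply: le_trans (H h) _; rewrite -real_normK ?num_real// expr2.
  by rewrite ler_wpM2l// ltW.
split; first by apply/cvg_ex; exists d.
exact: cvg_lim cd.
Unshelve. all: by end_near. Qed.

Definition pos2 (t : R) : R := Num.max 0 t ^+ 2.

Lemma pos2_derive (t : R) : is_derive t 1 pos2 (2 * Num.max 0 t).
Proof.
apply: is_derive_quadratic => h; rewrite /pos2 ler_norml.
have [a|a] := leP 0 t; have [b|b] := leP 0 (t + h).
- apply/andP; split; nra.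
- apply/andP; split; nra.
- apply/andP; split; nra.
- apply/andP; split; nra.
Qed.

(** A function of class C^1, equal to 1 on [-1, 1] and to 0 off [-2, 2]: one
    derivative is all that a single integration by parts consumes. *)
Definition plateau (t : R) : R := pos2 (1 - pos2 (t ^+ 2 - 1)).
Definition plateau' (t : R) : R :=
  2 * Num.max 0 (1 - pos2 (t ^+ 2 - 1)) * (- (2 * Num.max 0 (t ^+ 2 - 1) * (2 * t))).

Lemma plateau_derive (t : R) : is_derive t 1 plateau (plateau' t).
Proof.
have d1 : is_derive t 1 (fun s : R => s ^+ 2 - 1) (2 * t).
  apply: is_derive_quadratic => h.
  have -> : (t + h) ^+ 2 - 1 - (t ^+ 2 - 1) - h * (2 * t) = h ^+ 2 by ring.
  by rewrite ger0_norm// sqr_ge0.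
have d2 := @is_derive1_comp _ pos2 (fun s : R => s ^+ 2 - 1) t _ _ (pos2_derive _) d1.
have d3 : is_derive t 1 (fun s : R => 1 - pos2 (s ^+ 2 - 1)) (- (2 * Num.max 0 (t ^+ 2 - 1) * (2 * t))).
  have := is_deriveB (is_derive_cst (1 : R) t 1) d2.
  by move=> h; apply: is_derive_eq h _; rewrite sub0r.
have := @is_derive1_comp _ pos2 (fun s : R => 1 - pos2 (s ^+ 2 - 1)) t _ _ (pos2_derive _) d3.
by move=> h; apply: is_derive_eq h _.
Qed.

Lemma plateau_ge0 t : 0 <= plateau t. Proof. exact: sqr_ge0. Qed.

Lemma pos2_ge0 t : 0 <= pos2 t. Proof. exact: sqr_ge0. Qed.

Lemma plateau_le1 t : plateau t <= 1.
Proof.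
rewrite /plateau {1}/pos2; have := pos2_ge0 (t ^+ 2 - 1); set a := pos2 _ => a0.
by have [b|b] := leP 0 (1 - a); nra.
Qed.

Lemma plateau_in t : `|t| <= 1 -> plateau t = 1 /\ plateau' t = 0.
Proof.
rewrite ler_norml => /andP[t1 t2].
have h : t ^+ 2 - 1 <= 0 by nra.
rewrite /plateau /plateau' /pos2 (max_l h) expr0n /= subr0 max_r// expr1n; split => //.
by rewrite mulr0 mul0r oppr0 mulr0.
Qed.

Lemma plateau_out t : 2 <= `|t| -> plateau t = 0 /\ plateau' t = 0.
Proof.
move=> t2; have t4 : 4 <= t ^+ 2.
  by rewrite -real_normK ?num_real//; nra.
have h : 1 - pos2 (t ^+ 2 - 1) <= 0.
  rewrite /pos2 max_r; first by nra.
  lra.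
by rewrite /plateau /plateau' {1}/pos2 (max_l h) expr0n /= mulr0 mul0r.
Qed.

Lemma plateau'_bound t : `|plateau' t| <= 16.
Proof.
have [t2|t2] := leP 2 `|t|; first by have [_ ->] := plateau_out t2; rewrite normr0.
have t4 : t ^+ 2 <= 4 by rewrite -real_normK ?num_real//; have := normr_ge0 t; nra.
rewrite /plateau' normrM normrN.
have [h|h] := leP (1 - pos2 (t ^+ 2 - 1)) 0; first by rewrite mulr0 normr0 mul0r.
have [h'|h'] := leP (t ^+ 2 - 1) 0; first by rewrite mulr0 mul0r normr0 mulr0.
move: h; rewrite /pos2 max_r ?(ltW h')// => h.
have h1 : t ^+ 2 - 1 <= 1 by nra.
rewrite !normrM normr_nat (ger0_norm (ltW h)) (ger0_norm (ltW h')).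
set a := t ^+ 2 - 1 in h h' h1 *.
have a1 : 1 - a ^+ 2 <= 1 by nra.
have : 2 * (1 - a ^+ 2) <= 2 by lra.
have : 2 * a * (2 * `|t|) <= 8 by have := normr_ge0 t; nra.
have : 0 <= 2 * a * (2 * `|t|) by have := normr_ge0 t; nra.
set b := 2 * a * _; set c := 2 * (1 - _) => b0 b1 c1.
have c0 : 0 <= c by rewrite /c; lra.
nra.
Qed.

Lemma continuous_pos : continuous (fun t : R => Num.max 0 t).
Proof.
rewrite (_ : (fun t => _) = (fun t : R => 2^-1 * (t + `|t|))).
  move=> t; apply: cvgM; first exact: cvg_cst.
  by apply: cvgD; [exact: cvg_id|exact: norm_continuous].
apply/funext => t; have [a|a] := leP 0 t.
  by rewrite ger0_norm//; field.
by rewrite ltr0_norm// subrr mulr0.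
Qed.

Lemma continuous_plateau' : continuous plateau'.
Proof.
have c2 : continuous (fun t : R => t ^+ 2 - 1).
  by move=> t; apply: cvgB; [exact: exprn_continuous|exact: cvg_cst].
have cm : continuous (fun t : R => Num.max 0 (t ^+ 2 - 1)).
  move=> t; apply: (@continuous_comp _ _ _ (fun t : R => t ^+ 2 - 1) (fun t : R => Num.max 0 t)).
    exact: c2.
  exact: continuous_pos.
have c1 : continuous (fun t : R => 1 - pos2 (t ^+ 2 - 1)).
  move=> t; apply: cvgB; first exact: cvg_cst.
  by rewrite /pos2; apply: cvgM; exact: cm.
have cM : continuous (fun t : R => Num.max 0 (1 - pos2 (t ^+ 2 - 1))).
  move=> t; apply: (@continuous_comp _ _ _ (fun t : R => 1 - pos2 (t ^+ 2 - 1)) (fun t : R => Num.max 0 t)).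
    exact: c1.
  exact: continuous_pos.
move=> t; apply: cvgM.
  by apply: cvgM; [exact: cvg_cst|exact: cM].
apply: cvgN; apply: cvgM; apply: cvgM; first exact: cvg_cst.
- exact: cm.
- exact: cvg_cst.
- exact: cvg_id.
Qed.

Lemma continuous_plateau : continuous plateau.
Proof.
move=> t; apply: differentiable_continuous; apply/derivable1_diffP.
by have := plateau_derive t => -[].
Qed.
End cutoff1.

Section cutoff.
Variables (R : realType) (p : nat).
Local Notation n := p.+1.
Local Notation m0 := (fun _ : 'I_n => 0%N).

(** Tensor product of rescaled plateaus: a cut-off between the two cubes whose
    gradient is of order 1/r. *)
Lemma cutoff_exists (z : 'rV[R]_n) (r : R) : 0 < r ->
  exists (eta : 'rV[R]_n -> R) (eta' : 'I_n -> 'rV[R]_n -> R),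
  [/\ bounded_cont eta /\ (forall j, bounded_cont (eta' j)),
      forall x (v : 'rV[R]_n), is_derive x v eta (\sum_j v ord0 j * eta' j x),
      forall x, ~ cube z (2 * r) x -> eta x = 0 /\ forall j, eta' j x = 0,
      forall x, cube z r x -> eta x = 1 /\ forall j, eta' j x = 0 &
      forall x, 0 <= eta x /\ forall j, `|eta' j x| <= 16 / r].
Proof.
move=> r0.
pose D (k : 'I_n) (m : nat) (t : R) := if m is 0%N then plateau (r^-1 * (t - z ord0 k))
  else plateau' (r^-1 * (t - z ord0 k)) * r^-1.
have dD k (t : R) : is_derive t 1 (D k 0%N) (D k 1%N t).
  have d1 : is_derive t 1 (fun s : R => r^-1 * (s - z ord0 k)) r^-1.
    apply: is_derive_quadratic => h.
    have -> : r^-1 * (t + h - z ord0 k) - r^-1 * (t - z ord0 k) - h * r^-1 = 0 by ring.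
    by rewrite normr0 sqr_ge0.
  have := @is_derive1_comp _ (@plateau R) (fun s : R => r^-1 * (s - z ord0 k)) t _ _ (plateau_derive _) d1.
  by [].
have cl k : continuous (fun t : R => r^-1 * (t - z ord0 k)).
  move=> t; apply: cvgM; first exact: cvg_cst.
  by apply: cvgB; [exact: cvg_id|exact: cvg_cst].
have cD k m : continuous (D k m).
  case: m => [|m] t.
    apply: (@continuous_comp _ _ _ (fun t : R => r^-1 * (t - z ord0 k)) (@plateau R)).
      exact: cl.
    exact: continuous_plateau.
  apply: cvgM; last exact: cvg_cst.
  apply: (@continuous_comp _ _ _ (fun t : R => r^-1 * (t - z ord0 k)) (@plateau' R)).
    exact: cl.
  exact: continuous_plateau'.
have D01 k t : 0 <= D k 0%N t <= 1 by rewrite plateau_ge0 plateau_le1.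
have Db k m t : `|D k m.+1 t| <= 16 / r.
  have ri : 0 < r^-1 by rewrite invr_gt0.
  by rewrite /D normrM (gtr0_norm ri) ler_pM2r// plateau'_bound.
have eta'_bound x j : `|prodf D (incr m0 j) x| <= 16 / r.
  rewrite /prodf (bigD1 j)//= normrM /incr eqxx add0n -[leRHS]mulr1.
  rewrite ler_pM//; first exact: Db.
  rewrite normr_prod; apply: le_trans (_ : \prod_(i < n | i != j) 1 <= _); last by rewrite big1.
  apply: ler_prod => k /negbTE ->; rewrite addn0; have /andP[a b] := D01 k (x ord0 k).
  by rewrite normr_ge0 ger0_norm.
exists (prodf D m0), (fun j => prodf D (incr m0 j)); split.
- have c m : continuous (prodf D m).
    by apply: continuous_prod_seq => k; apply: continuous_coord; exact: cD.
  split=> [|j]; split; [exact: c| |exact: c|].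
    exists 1 => // x; rewrite /prodf normr_prod.
    apply: le_trans (_ : \prod_(i < n) 1 <= _); last by rewrite big1.
    apply: ler_prod => k _; have /andP[a b] := D01 k (x ord0 k).
    by rewrite normr_ge0 ger0_norm.
  by exists (16 / r) => //; apply: divr_ge0 => //; exact: ltW.
- by move=> x v; apply: prodf_derive_at => k t; exact: dD.
- move=> x nx.
  have [k xk] : exists k, 2 * r <= `|x ord0 k - z ord0 k|.
    apply: contrapT => nex; apply: nx => k; rewrite ltNge; apply/negP => h.
    by apply: nex; exists k.
  have h : 2 <= `|r^-1 * (x ord0 k - z ord0 k)|.
    by rewrite normrM gtr0_norm ?invr_gt0// ler_pdivlMl// mulrC.
  have [h1 h2] := plateau_out h.
  have h3 m : D k m (x ord0 k) = 0 by case: m => [|m] /=; rewrite ?h1 ?h2 ?mul0r.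
  have z0 m : prodf D m x = 0.
    rewrite /prodf (bigD1 k) //; set T := \prod_(_ <- _ | _) _.
    exact: (etrans (congr1 (fun y => y * T) (h3 (m k))) (mul0r T)).
  by split=> [|j]; exact: z0.
- move=> x xz.
  have h k : `|r^-1 * (x ord0 k - z ord0 k)| <= 1.
    rewrite normrM gtr0_norm ?invr_gt0// ler_pdivrMl// mulr1; exact/ltW/xz.
  split=> [|j]; first by rewrite /prodf big1// => k _; have [] := plateau_in (h k).
  by rewrite /prodf (bigD1 j)//= /incr eqxx add0n /D (plateau_in (h j)).2 !mul0r.
- move=> x; split=> [|j]; last exact: eta'_bound.
  by apply: prodr_ge0 => k _; have /andP[] := D01 k (x ord0 k).
Qed.
End cutoff.

(** * Oscillation on the slabs of a cubical annulus *)

Section oscillation.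
Context d (T : measurableType d) (R : realType) (mu : {measure set T -> \bar R}).
Variables (u : T -> R) (k : nat).

Let mpow (A : set T) c : measurable_fun A u -> measurable_fun A (fun x => (`|u x - c| ^+ k)%:E).
Proof.
move=> mu1; apply/measurable_EFinP; apply: measurable_funX; apply: measurableT_comp => //.
exact: measurable_funB.
Qed.

(** On O both constants are close to u in mean, hence close to each other. *)
Lemma osc_overlap (S S' O : set T) (c c' e o : R) :
  measurable S -> measurable S' -> measurable O -> measurable_fun S u -> measurable_fun S' u ->
  O `<=` S -> O `<=` S' -> (o%:E <= mu O)%E ->
  (\int[mu]_(x in S) (`|u x - c| ^+ k)%:E <= e%:E)%E ->
  (\int[mu]_(x in S') (`|u x - c'| ^+ k)%:E <= e%:E)%E ->
  `|c - c'| ^+ k * o <= 2 ^+ k * (e + e).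
Proof.
move=> mS mS' mO uS uS' OS OS' oO h h'; rewrite -lee_fin.
have p0 (x a : R) : (0 <= (`|x - a| ^+ k)%:E)%E by rewrite lee_fin exprn_ge0.
have uO : measurable_fun O u by exact: measurable_funS uS.
have hO := le_trans (ge0_subset_integral mu mO mS (mpow c uS) (fun x _ => p0 _ _) OS) h.
have hO' := le_trans (ge0_subset_integral mu mO mS' (mpow c' uS') (fun x _ => p0 _ _) OS') h'.
apply: (@le_trans _ _ (\int[mu]_(x in O) (`|c - c'| ^+ k)%:E)%E).
  by rewrite integral_cst// EFinM lee_wpmul2l// lee_fin exprn_ge0.
apply: (@le_trans _ _ ((2 ^+ k)%:E * (\int[mu]_(x in O) ((`|u x - c| ^+ k)%:E + (`|u x - c'| ^+ k)%:E)))%E).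
  rewrite -ge0_integralZl//.
  - apply: ge0_le_integral => //.
      by apply: emeasurable_funM => //; apply: emeasurable_funD; exact: mpow.
    move=> x _; rewrite -EFinD -EFinM lee_fin; apply: le_trans (exprD_le2 _ _ _) => //.
    by rewrite lerXn2r ?nnegrE// ?addr_ge0// distrC; apply: le_trans (ler_distD (u x) _ _) _; rewrite [`|c' - _|]distrC addrC.
  - by apply: emeasurable_funD; exact: mpow.
  - by move=> x _; exact: adde_ge0.
rewrite EFinM lee_wpmul2l// ge0_integralD//; [|exact: mpow|exact: mpow].
by rewrite EFinD leeD.
Qed.

Lemma osc_shift (S : set T) (c c' e m : R) :
  measurable S -> measurable_fun S u -> (mu S <= m%:E)%E ->
  (\int[mu]_(x in S) (`|u x - c'| ^+ k)%:E <= e%:E)%E ->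
  (\int[mu]_(x in S) (`|u x - c| ^+ k)%:E <= (2 ^+ k * (e + `|c' - c| ^+ k * m))%:E)%E.
Proof.
move=> mS uS Sm h.
have p0 (x a : R) : (0 <= (`|x - a| ^+ k)%:E)%E by rewrite lee_fin exprn_ge0.
apply: (@le_trans _ _ ((2 ^+ k)%:E * (\int[mu]_(x in S) ((`|u x - c'| ^+ k)%:E + (`|c' - c| ^+ k)%:E)))%E).
  rewrite -ge0_integralZl//.
  - apply: ge0_le_integral => //; first exact: mpow.
      by apply: emeasurable_funM => //; apply: emeasurable_funD => //; exact: mpow.
    move=> x _; rewrite -EFinD -EFinM lee_fin; apply: le_trans (exprD_le2 _ _ _) => //.
    by rewrite lerXn2r ?nnegrE// ?addr_ge0//; exact: ler_distD.
  - by apply: emeasurable_funD => //; exact: mpow.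
  - by move=> x _; rewrite adde_ge0// lee_fin exprn_ge0.
rewrite EFinM lee_wpmul2l// ge0_integralD//; last exact: mpow.
rewrite EFinD leeD// integral_cst// EFinM lee_wpmul2l// lee_fin exprn_ge0//.
Qed.

End oscillation.

Section slabs.
Variables (R : realType) (p : nat).
Local Notation n := p.+2.
Local Notation mu := (@lebesgue_rV R n).

(** The slabs, one for each face, cover the annulus between cube z r and cube z
    (2 r). Unlike the annulus they are convex, so that Poincare's inequality
    holds on each of them. *)
Definition slab (z : 'rV[R]_n) (r : R) (k : 'I_n * bool) : set 'rV[R]_n :=
  [set x | cube z (2 * r) x /\ r <= (-1) ^+ k.2 * (x ord0 k.1 - z ord0 k.1)].

Lemma measurable_slab z r k : measurable (slab z r k).
Proof.
apply: measurableI; first exact: measurable_cube.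
apply: (@measurable_coord_preimage R n k.1 [set t | r <= (-1) ^+ k.2 * (t - z ord0 k.1)]).
rewrite (_ : [set _ | _] = (fun t : measurableTypeR R => (-1) ^+ k.2 * (t - z ord0 k.1)) @^-1` `[r, +oo[%classic).
  rewrite -[X in measurable X]setTI.
  suff : measurable_fun setT (fun t : measurableTypeR R => (-1) ^+ k.2 * (t - z ord0 k.1)).
    by apply => //; exact: measurable_itv.
  apply: measurable_funM => //; exact: measurable_funB.
by apply/seteqP; split => t /=; rewrite in_itv /= andbT.
Qed.

Lemma slab_cube z r k : slab z r k `<=` cube z (2 * r). Proof. by move=> x []. Qed.

Lemma slab_out z r k x : slab z r k x -> ~ cube z r x.
Proof.
move=> [_ h] /(_ k.1); rewrite ltr_norml => /andP[h1 h2].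
by move: h; case: k.2 => /=; rewrite ?expr1 ?expr0; lra.
Qed.

Lemma slab_cover z r x : cube z (2 * r) x -> ~ cube z r x -> exists k, slab z r k x.
Proof.
move=> x2 x1.
have [j xj] : exists j, r <= `|x ord0 j - z ord0 j|.
  apply: contrapT => nex; apply: x1 => j; rewrite ltNge; apply/negP => h.
  by apply: nex; exists j.
have [h|h] := leP 0 (x ord0 j - z ord0 j).
  by exists (j, false); split => //=; rewrite expr0 mul1r -(ger0_norm h).
by exists (j, true); split => //=; rewrite expr1 mulN1r -(ltr0_norm h).
Qed.

Lemma segment_lt (a b t l : R) : a < l -> b < l -> 0 <= t -> t <= 1 -> t * (a - b) + b < l.
Proof. by move=> al bl t0 t1; have [ab|ab] := leP a b; nra. Qed.

Lemma segment_gt (a b t l : R) : l < a -> l < b -> 0 <= t -> t <= 1 -> l < t * (a - b) + b.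
Proof. by move=> al bl t0 t1; have [ab|ab] := leP a b; nra. Qed.

Lemma cube_convex (z : 'rV[R]_n) r (x y : 'rV[R]_n) (t : R) :
  cube z r x -> cube z r y -> 0 <= t -> t <= 1 -> cube z r (t *: (x - y) + y).
Proof.
move=> x2 y2 t0 t1 i; have := x2 i; have := y2 i.
rewrite !mxE !ltr_distl => /andP[a b] /andP[a' b'].
by rewrite segment_gt// segment_lt.
Qed.

Lemma slab_convex z r k (x y : 'rV[R]_n) (t : R) :
  slab z r k x -> slab z r k y -> 0 <= t -> t <= 1 -> slab z r k (t *: (x - y) + y).
Proof.
move=> [x2 xk] [y2 yk] t0 t1; split.
  exact: cube_convex.
by move: xk yk; rewrite !mxE; case: k.2 => /=; rewrite ?expr1 ?expr0; nra.
Qed.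

Lemma cube_diam (z : 'rV[R]_n) r (x y : 'rV[R]_n) j :
  cube z r x -> cube z r y -> `|x ord0 j - y ord0 j| <= 2 * r.
Proof.
move=> /(_ j) + /(_ j); rewrite !ltr_norml ler_norml => /andP[a b] /andP[a' b'].
by apply/andP; split; lra.
Qed.

Lemma slab_overlap z r k k' : 0 < r -> k.1 != k'.1 ->
  exists w, cube w (r / 2) `<=` slab z r k /\ cube w (r / 2) `<=` slab z r k'.
Proof.
move=> r0 kk.
pose w : 'rV[R]_n := \row_i (z ord0 i + 3 / 2 * r * (if i == k.1 then (-1) ^+ k.2
  else if i == k'.1 then (-1) ^+ k'.2 else 0)).
have w2 : cube w (r / 2) `<=` cube z (2 * r).
  apply: sub_cube => i; rewrite mxE addrAC subrr add0r normrM.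
  rewrite [`|3 / 2 * r|]ger0_norm; last by lra.
  suff : `|if i == k.1 then (-1) ^+ k.2 else if i == k'.1 then (-1) ^+ k'.2 else 0 : R| <= 1 by nra.
  by case: ifP => _; [rewrite normrX normrN1 expr1n|case: ifP => _; [rewrite normrX normrN1 expr1n|rewrite normr0]].
have sl (k0 : 'I_n * bool) x : w ord0 k0.1 = z ord0 k0.1 + 3 / 2 * r * (-1) ^+ k0.2 -> cube w (r / 2) x -> slab z r k0 x.
  move=> wE xw; split; first exact: w2.
  have := xw k0.1; rewrite wE ltr_norml; case: k0.2 => /=; rewrite ?expr1 ?expr0 => /andP[a b]; lra.
exists w; split => x; apply: sl; rewrite mxE ?eqxx//.
by rewrite eq_sym (negbTE kk).
Qed.

Variables (u : 'rV[R]_n -> R) (z : 'rV[R]_n) (r e : R) (c : 'I_n * bool -> R) (m : nat).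
Hypotheses (r0 : 0 < r) (mu2 : measurable_fun (cube z (2 * r)) u).
Hypothesis osc : forall k, (\int[mu]_(x in slab z r k) (`|u x - c k| ^+ m)%:E <= e%:E)%E.

(** In dimension at least 2, two opposite slabs both overlap a slab in another
    direction; hence the constant of one slab serves for all of them. *)
Lemma slab_osc k0 k :
  (\int[mu]_(x in slab z r k) (`|u x - c k0| ^+ m)%:E <=
    (2 ^+ m * (e + 4 * 4 ^+ m * e / r ^+ n * (4 * r) ^+ n))%:E)%E.
Proof.
have mc : measurable (cube z (2 * r)) by exact: measurable_cube.
have mus k' : measurable_fun (slab z r k') u by apply: measurable_funS mu2; [exact: mc|exact: slab_cube].
have rn : 0 < r ^+ n by rewrite exprn_gt0.
have e0 : 0 <= e.
  by rewrite -lee_fin; apply: le_trans (osc k); apply: integral_ge0 => x _; rewrite lee_fin exprn_ge0.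
have step k1 k2 : k1.1 != k2.1 -> `|c k1 - c k2| ^+ m <= 2 ^+ m * (e + e) / r ^+ n.
  move=> kk; have [w [w1 w2]] := slab_overlap z r0 kk.
  rewrite ler_pdivlMr//.
  apply: (osc_overlap (measurable_slab z r k1) (measurable_slab z r k2)
    (measurable_cube w (r / 2)) (mus k1) (mus k2) w1 w2 _ (osc k1) (osc k2)).
  have r20 : 0 <= r / 2 by rewrite divr_ge0// ltW.
  have /= -> := lebesgue_rV_cube w r20.
  by rewrite [2 * _]mulrC divfK.
have all k1 k2 : `|c k1 - c k2| ^+ m <= 4 * 4 ^+ m * e / r ^+ n.
  have four : 4 ^+ m = 2 ^+ m * 2 ^+ m :> R by rewrite -exprMn; congr (_ ^+ _); ring.
  have t1 : 1 <= 2 ^+ m :> R by rewrite exprn_ege1// ler1n.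
  have [kk|kk] := eqVneq k1.1 k2.1; last first.
    apply: le_trans (step _ _ kk) _; rewrite ler_pM2r ?invr_gt0// four.
    have : 2 ^+ m <= 2 ^+ m * 2 ^+ m :> R by rewrite ler_peMr// (le_trans ler01).
    nra.
  have [j jk] : exists j : 'I_n, j != k1.1.
    have [->|h] := eqVneq k1.1 ord0; first by exists ord_max.
    by exists ord0; rewrite eq_sym.
  have s1 := @step k1 (j, true); have s2 := @step (j, true) k2.
  move: s1 s2; rewrite /= -kk jk eq_sym jk => /(_ isT) s1 /(_ isT) s2.
  apply: le_trans (_ : (`|c k1 - c (j, true)| + `|c (j, true) - c k2|) ^+ m <= _).
    by rewrite lerXn2r ?nnegrE ?addr_ge0//; exact: ler_distD.
  apply: le_trans (exprD_le2 _ _ _) _ => //.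
  rewrite four; apply: le_trans (_ : 2 ^+ m * (2 ^+ m * (e + e) / r ^+ n + 2 ^+ m * (e + e) / r ^+ n) <= _).
    by rewrite ler_pM2l ?exprn_gt0// lerD.
  by rewrite le_eqVlt; apply/orP; left; apply/eqP; field; rewrite gt_eqF.
apply: le_trans (osc_shift (c k0) (measurable_slab z r k) (mus k) (m := (4 * r) ^+ n) _ (osc k)) _.
  have -> : (4 * r) ^+ n = (2 * (2 * r)) ^+ n :> R by congr (_ ^+ _); ring.
  have r20 : 0 <= 2 * r by rewrite mulr_ge0// ltW.
  have /= <- := lebesgue_rV_cube z r20.
  apply: le_measure; rewrite ?inE//; [exact: measurable_slab|exact: slab_cube].
rewrite lee_fin ler_pM2l ?exprn_gt0// lerD2l ler_wpM2r//.
by rewrite exprn_ge0// mulr_ge0// ltW.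
Qed.

End slabs.

(** * The Caccioppoli estimate *)

Section caccioppoli.
Variables (R : realType) (p : nat).
Local Notation n := p.+2.
Local Notation mu := (@lebesgue_rV R n).

Definition gradpow (Df : 'rV[R]_n -> 'M[R]_n) (x : 'rV[R]_n) : R :=
  \sum_i \sum_j `|Df x i j| ^+ n.

Lemma gradpow_ge0 Df x : 0 <= gradpow Df x.
Proof. by do 2!apply: sumr_ge0 => ? _; rewrite exprn_ge0. Qed.

Lemma gradpow_row (Df : 'rV[R]_n -> 'M[R]_n) x i : \sum_j `|Df x i j| ^+ n <= gradpow Df x.
Proof.
rewrite /gradpow [leRHS](bigD1 i)//= lerDl; apply: sumr_ge0 => k _.
by apply: sumr_ge0 => j _; rewrite exprn_ge0.
Qed.

Lemma gradpow_entry (Df : 'rV[R]_n -> 'M[R]_n) x i j : `|Df x i j| ^+ n <= gradpow Df x.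
Proof.
apply: le_trans (gradpow_row Df x i); rewrite (bigD1 j)//= lerDl.
by apply: sumr_ge0 => k _; rewrite exprn_ge0.
Qed.

Lemma measurable_gradpow (A : set 'rV[R]_n) (Df : 'rV[R]_n -> 'M[R]_n) :
  (forall i j, measurable_fun A (fun x => Df x i j)) -> measurable_fun A (gradpow Df).
Proof.
move=> mD; apply: measurable_sum => i; apply: measurable_sum => j.
by apply: measurable_funX; apply: measurableT_comp => //; exact: mD.
Qed.

Lemma integral_norm_signed (A : set 'rV[R]_n) (J : 'rV[R]_n -> R) : measurable A ->
  mu.-integrable A (EFin \o J) ->
  {ae mu, forall x, A x -> 0 <= J x} \/ {ae mu, forall x, A x -> J x <= 0} ->
  (\int[mu]_(x in A) `|J x|%:E = `|\int[mu]_(x in A) J x|%:E)%E.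
Proof.
move=> mA iJ; have mJ := measurable_int _ iJ.
have mJr : measurable_fun A J by exact/measurable_EFinP.
have mnJ : measurable_fun A (fun x => `|J x|%:E).
  by apply/measurable_EFinP; exact: measurableT_comp.
have pos (I : \bar R) : (0 <= I)%E -> I \is a fin_num -> I = `|fine I|%:E.
  by move=> I0 If; rewrite ger0_norm ?fine_ge0// fineK.
have fJ := integrable_fin_num mA iJ.
case=> sg.
- have E : (\int[mu]_(x in A) `|J x|%:E = \int[mu]_(x in A) (J x)%:E)%E.
    apply: ae_eq_integral => //; apply: filterS sg => x h Ax.
    by rewrite ger0_norm// h.
  by rewrite E; apply: pos => //; rewrite -E; apply: integral_ge0 => x _; rewrite lee_fin.
- have E : (\int[mu]_(x in A) `|J x|%:E = - \int[mu]_(x in A) (J x)%:E)%E.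
    rewrite -integralN; last by rewrite fin_num_adde_defl// fin_numN integrable_neg_fin_num.
    apply: ae_eq_integral => //; first by apply/measurable_EFinP; exact: measurableT_comp.
    by apply: filterS sg => x h Ax; rewrite ler0_norm// h.
  rewrite E -normrN /Rintegral -fineN; apply: pos; last by rewrite fin_numN.
  by rewrite -E; apply: integral_ge0 => x _; rewrite lee_fin.
Qed.

(** Integration by parts against a cut-off moves the integral of the Jacobian to
    the slabs, which cover the support of the gradient of the cut-off. There the
    integrand is bounded by a multiple of |f_0 - c|^n / r^n + |Df|^n, and
    Poincare's inequality absorbs the first term into the second. *)
Lemma jacobian_estimate : exists2 C : R, 0 <= C & forall (f : 'rV[R]_n -> 'rV[R]_n) (Df : 'rV[R]_n -> 'M[R]_n) (z : 'rV[R]_n) r U H B,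
  0 < r -> approx f Df z (2 * r) U H B ->
  measurable_fun (cube z (2 * r)) (fun x => f x ord0 ord0) ->
  (forall i j, measurable_fun (cube z (2 * r)) (fun x => Df x i j)) ->
  (\int[mu]_(x in cube z (2 * r)) (gradpow Df x)%:E < +oo)%E ->
  ({ae mu, forall x, cube z (2 * r) x -> 0 <= \det (Df x)} \/
   {ae mu, forall x, cube z (2 * r) x -> \det (Df x) <= 0}) ->
  (\int[mu]_(x in cube z r) `|\det (Df x)|%:E <=
    C%:E * (\int[mu]_(x in cube z (2 * r) `\` cube z r) (gradpow Df x)%:E + (r ^+ n)%:E))%E.
Proof.
pose K : R := (4 * n%:R) ^+ n * 2 ^+ n + 1.
have K1 : 0 <= K by rewrite addr_ge0// mulr_ge0// exprn_ge0// mulr_ge0.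
pose C1 : R := 2 ^+ n * (1 + 4 * 4 ^+ n * 4 ^+ n) * K.
have C10 : 0 <= C1 by rewrite mulr_ge0// mulr_ge0// addr_ge0// mulr_ge0// mulr_ge0.
pose C2 : R := (n`!)%:R * (16 ^+ n * C1 + 1).
have C20 : 0 <= C2 by rewrite mulr_ge0// addr_ge0// mulr_ge0.
exists (\sum_(k : 'I_n * bool) C2); first by apply: sumr_ge0.
move=> f Df z r U H B r0 apx mf mDf Goo sgn.
set A2 := cube z (2 * r) in mf mDf Goo sgn *; set A1 := cube z r.
have mA2 : measurable A2 by exact: measurable_cube.
have mA1 : measurable A1 by exact: measurable_cube.
set A := A2 `\` A1; have mA : measurable A by exact: measurableD.
have r20 : 0 < 2 * r by rewrite mulr_gt0.
have rn : 0 < r ^+ n by rewrite exprn_gt0.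
have mG2 : measurable_fun A2 (fun x => (gradpow Df x)%:E).
  by apply/measurable_EFinP; exact: measurable_gradpow.
have G0 x : (0 <= (gradpow Df x)%:E)%E by rewrite lee_fin gradpow_ge0.
have AA2 : A `<=` A2 by exact: subDsetl.
have A12 : A1 `<=` A2.
  by apply: sub_cube => i; rewrite subrr normr0 add0r; lra.
have Afin : (\int[mu]_(x in A) (gradpow Df x)%:E < +oo)%E.
  by apply: le_lt_trans Goo; apply: ge0_subset_integral.
have Age0 : (0 <= \int[mu]_(x in A) (gradpow Df x)%:E)%E by apply: integral_ge0 => x _.
have [a aE] : exists a, (\int[mu]_(x in A) (gradpow Df x)%:E = a%:E)%E.
  by exists (fine (\int[mu]_(x in A) (gradpow Df x)%:E)); rewrite fineK// ge0_fin_numE.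
have a0 : 0 <= a by rewrite -lee_fin -aE.
rewrite aE -EFinD.
have SA k : slab z r k `<=` A by move=> x Sx; split; [exact: slab_cube Sx|exact: slab_out Sx].
have mS k : measurable (slab z r k) by exact: measurable_slab.
have SG k : (\int[mu]_(x in slab z r k) (gradpow Df x)%:E <= a%:E)%E.
  by rewrite -aE; apply: ge0_subset_integral => //; exact: measurable_funS mG2.
pose e := K * r ^+ n * (a + r ^+ n).
(* e is the bound of good_point on a slab, with slack r^n r^n *)
have /choice[c Hc] : forall k, exists c : R,
    (\int[mu]_(x in slab z r k) (`|f x ord0 ord0 - c| ^+ n)%:E <= e%:E)%E.
  move=> k.
  have muS : (mu (slab z r k) < +oo)%E.
    apply: le_lt_trans (_ : (mu A2 < +oo)%E).
      by apply: le_measure; rewrite ?inE//; exact: slab_cube.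
    have /= -> := lebesgue_rV_cube z (ltW r20); exact: ltry.
  have muS0 : (0 < mu (slab z r k))%E.
    have [j jk] : exists j : 'I_n, k.1 != j.
      have [->|h] := eqVneq k.1 ord0; first by exists ord_max.
      by exists ord0.
    have [w [w1 _]] := @slab_overlap R p z r k (j, true) r0 jk.
    have r2 : 0 <= r / 2 by rewrite divr_ge0// ltW.
    apply: (@lt_le_trans _ _ (mu (cube w (r / 2)))).
      have /= -> := lebesgue_rV_cube w r2.
      by rewrite lte_fin exprn_gt0// mulr_gt0// divr_gt0.
    by apply: le_measure; rewrite ?inE//; exact: measurable_cube.
  have gG : (\int[mu]_(x in slab z r k) (\sum_j `|Df x ord0 j| ^+ n)%:E <= a%:E)%E.
    apply: le_trans (SG k); apply: ge0_le_integral => //.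
    - by move=> x _; rewrite lee_fin sumr_ge0// => j _; rewrite exprn_ge0.
    - apply/measurable_EFinP; apply: measurable_sum => j; apply: measurable_funX.
      apply: measurableT_comp => //; apply: (measurable_funS mA2) (mDf ord0 j).
      exact: slab_cube.
    - by apply: measurable_funS mG2 => //; exact: slab_cube.
    - by move=> x _; rewrite lee_fin gradpow_row.
  have d0 : 0 <= 2 * (2 * r) by rewrite mulr_ge0// ltW.
  have rr : 0 < r ^+ n * r ^+ n by rewrite mulr_gt0.
  have [||y Sy yP] := @good_point R p.+1 f Df z (2 * r) U H B apx ord0 mf (mDf ord0)
    (slab z r k) (2 * (2 * r)) (mS k) d0 (@slab_cube _ _ z r k) (@slab_convex _ _ z r k) _ muS
    _ rr muS0.
  - by move=> x y j Sx Sy; apply: (@cube_diam _ _ z); apply: slab_cube; eassumption.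
  - exact: le_lt_trans gG (ltry _).
  exists (f y ord0 ord0); apply: le_trans yP _.
  apply: (@le_trans _ _ (((2 * (2 * r) * n%:R) ^+ n * 2 ^+ n)%:E * a%:E + (r ^+ n * r ^+ n)%:E))%E.
    by apply: leeD => //; apply: lee_wpmul2l => //; rewrite lee_fin mulr_ge0// exprn_ge0// mulr_ge0.
  rewrite -EFinM -EFinD lee_fin /e /K.
  have -> : 2 * (2 * r) * n%:R = (4 * n%:R) * r :> R by ring.
  rewrite exprMn; set X := (4 * _) ^+ n * 2 ^+ n.
  have -> : (4 * n%:R) ^+ n * r ^+ n * 2 ^+ n = X * r ^+ n :> R by rewrite /X; ring.
  have X0 : 0 <= X by rewrite mulr_ge0// exprn_ge0// mulr_ge0.
  have rn0 := ltW rn; set q := r ^+ n in rn0 *.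
  have h1 : 0 <= X * q * q by apply: mulr_ge0 => //; exact: mulr_ge0.
  have h2 : 0 <= q * a by exact: mulr_ge0.
  nra.
pose k0 : 'I_n * bool := (ord0, false).
have osc k := slab_osc r0 mf Hc k0 k.
have oscE : 2 ^+ n * (e + 4 * 4 ^+ n * e / r ^+ n * (4 * r) ^+ n) = C1 * r ^+ n * (a + r ^+ n).
  by rewrite exprMn /C1 /e; field; rewrite gt_eqF.
have [eta [eta' [[ceta ceta'] deta eout ein ebd]]] := cutoff_exists z r0.
have [iJ byparts] := @jacobian_by_parts R p.+1 f Df z (2 * r) U H B r20 apx mf mDf eta eta' ceta ceta' deta
  (fun x nx => (eout x nx).1) (fun j x nx => (eout x nx).2 j) (c k0).
(* eta is 1 on the inner cube and the Jacobian does not change sign *)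
have mJ : measurable_fun A2 (fun x => `|eta x * \det (Df x)|%:E).
  have := measurable_int _ iJ => /measurable_EFinP mm.
  by apply/measurable_EFinP; exact: measurableT_comp.
apply: (@le_trans _ _ (\int[mu]_(x in A2) `|eta x * \det (Df x)|%:E)%E).
  apply: (@le_trans _ _ (\int[mu]_(x in A1) `|eta x * \det (Df x)|%:E)%E).
    rewrite le_eqVlt; apply/orP; left; apply/eqP; apply: eq_integral => x.
    by rewrite inE => A1x; rewrite (ein x A1x).1 mul1r.
  by apply: ge0_subset_integral.
rewrite integral_norm_signed//; last first.
  case: sgn => sgn; [left|right]; apply: filterS sgn => x h /h h'.
    by rewrite mulr_ge0// (ebd x).1.
  by rewrite mulr_ge0_le0// (ebd x).1.
apply: le_trans byparts _.
(* a point may lie on several slabs: the bound is summed over all of them *)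
set c0 := c k0.
pose h x := (16 / r) ^+ n * `|f x ord0 ord0 - c0| ^+ n + gradpow Df x.
have r16 : 0 <= 16 / r by rewrite divr_ge0// ltW.
have h1 x : 0 <= (16 / r) ^+ n * `|f x ord0 ord0 - c0| ^+ n by rewrite mulr_ge0// exprn_ge0.
have h0 x : 0 <= h x by rewrite addr_ge0// gradpow_ge0.
have mh k : measurable_fun (slab z r k) h.
  apply: measurable_funD.
    apply: measurable_funM => //; apply: measurable_funX; apply: measurableT_comp => //.
    by apply: measurable_funB => //; apply: measurable_funS mf => //; exact: slab_cube.
  by apply: measurable_gradpow => i j; apply: measurable_funS (mDf i j) => //; exact: slab_cube.
have ptw x : A2 x -> `|(f x ord0 ord0 - c0) * \det (detrow (Df x) (eta'^~ x))| <=
    \sum_(k : 'I_n * bool) ((fun x => (n`!)%:R * h x) \_ (slab z r k)) x.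
  have sge0 k : 0 <= ((fun x => (n`!)%:R * h x) \_ (slab z r k)) x.
    by rewrite patchE; case: ifP => // _; rewrite mulr_ge0.
  move=> A2x; have [A1x|A1x] := pselect (A1 x).
    rewrite det_detrow0 ?mulr0 ?normr0 ?sumr_ge0// => j.
    exact: (ein x A1x).2.
  have [k Sk] := slab_cover A2x A1x.
  rewrite (bigD1 k)//= patchE mem_set// -[leLHS]addr0 lerD ?sumr_ge0//.
  have := det_detrow_lin (Df x) (eta'^~ x) (f x ord0 ord0 - c0) 0.
  rewrite mul0r addr0 => <-; apply: det_bound => // i j.
  rewrite mxE; case: ifP => _; last first.
    by apply: le_trans (gradpow_entry Df x i j) _; rewrite /h lerDr.
  rewrite mul0r addr0 normrM exprMn mulrC; apply: le_trans (_ : (16 / r) ^+ n * `|f x ord0 ord0 - c0| ^+ n <= _).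
    rewrite ler_wpM2r ?exprn_ge0// lerXn2r ?nnegrE//; exact: (ebd x).2.
  by rewrite /h lerDl gradpow_ge0.
have mnh k : measurable_fun (slab z r k) (fun x => (n`!)%:R * h x) by exact: measurable_funM.
have mpatch k : measurable_fun A2 (fun x => (((fun x => (n`!)%:R * h x) \_ (slab z r k)) x)%:E).
  apply/measurable_EFinP; apply: measurable_funTS.
  by apply/(measurable_restrictT (fun x => (n`!)%:R * h x) (mS k)).
have patch0 k x : (0 <= (((fun x => (n`!)%:R * h x) \_ (slab z r k)) x)%:E)%E.
  by rewrite lee_fin patchE; case: ifP => // _; rewrite mulr_ge0.
have mN : measurable_fun A2 (fun x => `|(f x ord0 ord0 - c0) * \det (detrow (Df x) (eta'^~ x))|%:E).
  apply/measurable_EFinP; apply: measurableT_comp => //; apply: measurable_funM.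
    exact: measurable_funB.
  apply: measurable_det => i j.
  rewrite (_ : (fun x => _) = if i == ord0 then eta' j else (fun x => Df x i j)).
    by case: ifP => _ //; apply: measurable_funTS; exact: bounded_cont_meas.
  by apply/funext => x; rewrite mxE; case: ifP.
apply: (@le_trans _ _ (\int[mu]_(x in A2)
   \sum_(k : 'I_n * bool) (((fun x => (n`!)%:R * h x) \_ (slab z r k)) x)%:E)%E).
  apply: ge0_le_integral => //.
  - by apply: emeasurable_sum.
  - by move=> x A2x; rewrite sumEFin lee_fin ptw.
rewrite ge0_integral_sum//.
rewrite -EFinM mulr_suml -sumEFin.
apply: lee_sum => k _.
have -> : (\int[mu]_(x in A2) (((fun x => (n`!)%:R * h x) \_ (slab z r k)) x)%:E =
   (n`!)%:R%:E * \int[mu]_(x in slab z r k) (h x)%:E)%E.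
  rewrite -ge0_integralZl//.
  - rewrite [RHS](_ : _ = \int[mu]_(x in slab z r k) ((n`!)%:R * h x)%:E)%E//.
    rewrite [RHS]integral_mkcond [LHS]integral_mkcond.
    apply: eq_integral => x _; rewrite !patchE; have [Sx|Sx] := pselect (slab z r k x).
      by rewrite !mem_set//; exact: slab_cube Sx.
    by rewrite (memNset Sx)//; case: ifP.
  - exact/measurable_EFinP.
  - by move=> x _; rewrite lee_fin.
rewrite /C2 -mulrA EFinM lee_wpmul2l//.
rewrite /h; under eq_integral do rewrite EFinD EFinM.
rewrite ge0_integralD//; last 2 first.
- apply: emeasurable_funM => //.
  apply/measurable_EFinP; apply: measurable_funX; apply: measurableT_comp => //.
  by apply: measurable_funB => //; apply: measurable_funS mf => //; exact: slab_cube.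
- by apply: measurable_funS mG2 => //; exact: slab_cube.
rewrite ge0_integralZl//; last 2 first.
- apply/measurable_EFinP; apply: measurable_funX; apply: measurableT_comp => //.
  by apply: measurable_funB => //; apply: measurable_funS mf => //; exact: slab_cube.
- by rewrite lee_fin exprn_ge0.
apply: (@le_trans _ _ (((16 / r) ^+ n)%:E * (C1 * r ^+ n * (a + r ^+ n))%:E + a%:E))%E.
  apply: leeD => //; apply: lee_wpmul2l; first by rewrite lee_fin exprn_ge0.
  by rewrite -oscE; exact: osc.
rewrite -EFinM -EFinD lee_fin expr_div_n.
have -> : 16 ^+ n / r ^+ n * (C1 * r ^+ n * (a + r ^+ n)) = 16 ^+ n * C1 * (a + r ^+ n).
  by field; rewrite gt_eqF.
- by rewrite mulrDl mul1r lerD2l lerDl ltW.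
- by move=> x _; rewrite -EFinM lee_fin.
Qed.

End caccioppoli.

(** * Hole filling *)

Section decay_sequences.
Variable R : realType.

Lemma bernoulli (x : R) k : 0 <= x -> x <= 1 -> 1 - k%:R * x <= (1 - x) ^+ k.
Proof.
move=> x0 x1; elim: k => [|k IH]; first by rewrite mul0r subr0 expr0.
rewrite exprS; apply: le_trans (_ : (1 - x) * (1 - k%:R * x) <= _).
  have : 0 <= k%:R * x * x by rewrite !mulr_ge0.
  rewrite -natr1; nra.
by rewrite ler_wpM2l// subr_ge0.
Qed.

(** Moving C phi k.+1 to the left-hand side gives the ratio C / (1 + C). The
    rate t is halfway between this ratio and 1, which leaves room for the error
    2^-k. *)
Lemma hole_filling_decay (C : R) : 1 <= C -> exists t : R, exists A : R,
  [/\ 2^-1 <= t, t < 1, 0 <= A & forall phi : nat -> R, (forall k, 0 <= phi k) ->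
   (forall k, phi k.+1 <= C * (phi k - phi k.+1 + 2^-1 ^+ k)) ->
   forall k, phi k <= (phi 0%N + A) * t ^+ k].
Proof.
move=> C1; pose D := 2 + 2 * C; have D0 : 0 < D by rewrite /D; lra.
pose t := (1 + 2 * C) / D.
have tD : t * D = 1 + 2 * C by rewrite /t divfK// gt_eqF.
have t2 : 2^-1 <= t by rewrite /t ler_pdivlMr// /D; lra.
have t1 : t < 1 by rewrite /t ltr_pdivrMr// /D; lra.
exists t, D; split => // [|phi phi0 H k]; first exact: ltW.
elim: k => [|k IH]; first by rewrite expr0 mulr1 lerDl ltW.
have q : 2^-1 ^+ k <= t ^+ k :> R by rewrite lerXn2r ?nnegrE//; lra.
have tk : 0 <= t ^+ k by apply: exprn_ge0; lra.
have := H k; have := phi0 k.+1; have := phi0 0%N.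
rewrite exprS; move: IH q tk; set a := phi k; set b := phi k.+1; set f := phi 0%N.
set T := t ^+ k; set Q := 2^-1 ^+ k => IH q tk f0 b0 Hk.
have h1 : (1 + C) * b <= C * ((f + D) * T + T) by nra.
have h2 : D * b <= 2 * C * ((f + D) * T + T) by set X := _ * T + T in h1 *; rewrite /D; lra.
have h3 : 2 * C * ((f + D) * T + T) <= (1 + 2 * C) * (f + D) * T.
  have : 0 <= f * T by rewrite mulr_ge0.
  by rewrite /D; nra.
rewrite -(ler_pM2l D0); apply: le_trans h2 _; apply: le_trans h3 _.
by rewrite -tD le_eqVlt; apply/orP; left; apply/eqP; ring.
Qed.

End decay_sequences.

Section hole_filling.
Variables (R : realType) (p : nat).
Local Notation n := p.+2.
Local Notation mu := (@lebesgue_rV R n).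

(** The integral of a nonnegative function is a supremum over the simple
    functions below it, whether or not it is measurable. *)
Lemma le_integral_ge0 d (T : measurableType d) (m : {measure set T -> \bar R}) (A D : set T)
    (f g : T -> \bar R) : A `<=` D ->
  (forall x, A x -> 0 <= f x)%E -> (forall x, D x -> 0 <= g x)%E ->
  (forall x, A x -> f x <= g x)%E ->
  (\int[m]_(x in A) f x <= \int[m]_(x in D) g x)%E.
Proof.
move=> AD f0 g0 fg; rewrite [leLHS]integral_mkcond [leRHS]integral_mkcond.
rewrite !ge0_integralTE.
- apply: le_ereal_sup => _ [h hf <-]; exists h => // x; apply: le_trans (hf x) _.
  rewrite !patchE; have [Ax|nAx] := pselect (A x).
    by rewrite !mem_set//; [exact: fg|exact: AD].
  rewrite (memNset nAx); case: ifPn => //; rewrite inE; exact: g0.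
- by move=> x; rewrite patchE; case: ifPn => //; rewrite inE; exact: g0.
- by move=> x; rewrite patchE; case: ifPn => //; rewrite inE; exact: f0.
Qed.

Lemma enorm_coord m (v : 'rV[R]_m) i : `|v ord0 i| <= enorm v.
Proof.
rewrite /enorm -sqrtr_sqr ler_wsqrtr// (bigD1 i)//= lerDl.
by apply: sumr_ge0 => j _; rewrite sqr_ge0.
Qed.

Lemma enorm_le_sum m (v : 'rV[R]_m) : enorm v <= \sum_i `|v ord0 i|.
Proof.
have [s0 h] : 0 <= \sum_i `|v ord0 i| /\ \sum_i v ord0 i ^+ 2 <= (\sum_i `|v ord0 i|) ^+ 2.
  elim/big_ind2 : _ => [|a b c d [b0 ab] [d0 cd]|i _].
  - by rewrite expr0n.
  - by split; [exact: addr_ge0|nra].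
  - by rewrite real_normK ?num_real.
by rewrite /enorm -[leRHS]ger0_norm// -sqrtr_sqr ler_wsqrtr.
Qed.

Lemma entry_le_opnorm m (A : 'M[R]_m) i j : `|A i j| <= opnorm A.
Proof.
have e1 : enorm (delta_mx ord0 j : 'rV[R]_m) = 1.
  rewrite /enorm (bigD1 j)//= big1 ?addr0 ?mxE ?eqxx ?expr1n ?sqrtr1// => k /negbTE kj.
  by rewrite mxE kj andbF expr0n.
apply: le_trans (_ : enorm ((delta_mx ord0 j : 'rV[R]_m) *m A^T) <= _).
  by rewrite -rowE; apply: le_trans (enorm_coord _ i); rewrite !mxE.
apply: ub_le_sup; last by exists (delta_mx ord0 j).
exists (\sum_i \sum_k `|A i k|) => _ [xi /= xi1 <-].
apply: le_trans (enorm_le_sum _) _; apply: ler_sum => k _.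
rewrite mxE; apply: le_trans (ler_norm_sum _ _ _) _; apply: ler_sum => l _.
by rewrite !mxE normrM ler_piMl// -xi1 enorm_coord.
Qed.

Lemma gradpow_opnorm (Df : 'rV[R]_n -> 'M[R]_n) x :
  gradpow Df x <= n%:R ^+ 2 * opnorm (Df x) ^+ n.
Proof.
have h i j : `|Df x i j| ^+ n <= opnorm (Df x) ^+ n.
  rewrite lerXn2r ?nnegrE//; last exact: entry_le_opnorm.
  exact: le_trans (entry_le_opnorm (Df x) i j).
apply: le_trans (_ : \sum_(i < n) \sum_(j < n) opnorm (Df x) ^+ n <= _).
  by do 2!apply: ler_sum => ? _.
by rewrite !sumr_const !card_ord expr2 -mulrA !mulr_natl.
Qed.

(** The distortion inequality turns the estimate of the Jacobian into an
    estimate of the gradient; the annulus is the difference of the two cubes. *)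
Lemma hole_filling (k1 k2 : R) : 0 <= k1 -> 0 <= k2 -> exists2 C : R, 1 <= C &
  forall (f : 'rV[R]_n -> 'rV[R]_n) (Df : 'rV[R]_n -> 'M[R]_n) (z : 'rV[R]_n) r U H B,
  0 < r -> approx f Df z (2 * r) U H B ->
  measurable_fun (cube z (2 * r)) (fun x => f x ord0 ord0) ->
  (forall i j, measurable_fun (cube z (2 * r)) (fun x => Df x i j)) ->
  (\int[mu]_(x in cube z (2 * r)) (gradpow Df x)%:E < +oo)%E ->
  ({ae mu, forall x, cube z (2 * r) x -> 0 <= \det (Df x)} \/
   {ae mu, forall x, cube z (2 * r) x -> \det (Df x) <= 0}) ->
  {ae mu, forall x, cube z (2 * r) x -> gradpow Df x <= k1 * `|\det (Df x)| + k2} ->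
  (\int[mu]_(x in cube z r) (gradpow Df x)%:E <=
    C%:E * (\int[mu]_(x in cube z (2 * r) `\` cube z r) (gradpow Df x)%:E + (r ^+ n)%:E))%E.
Proof.
move=> k10 k20; have [C C0 HC] := jacobian_estimate R p.
exists (k1 * C + k2 * 2 ^+ n + 1); first by rewrite lerDr addr_ge0// mulr_ge0// exprn_ge0.
move=> f Df z r U H B r0 apx mf mDf Goo sgn qr.
have := HC f Df z r U H B r0 apx mf mDf Goo sgn.
set A2 := cube z (2 * r) in mf mDf Goo sgn qr *; set A1 := cube z r.
have mA1 : measurable A1 by exact: measurable_cube.
have mA2 : measurable A2 by exact: measurable_cube.
have A12 : A1 `<=` A2 by apply: sub_cube => i; rewrite subrr normr0 add0r; lra.
set I := (\int[mu]_(x in _ `\` _) _)%E => HI.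
have I0 : (0 <= I)%E by apply: integral_ge0 => x _; rewrite lee_fin gradpow_ge0.
have rn : 0 <= r ^+ n by rewrite exprn_ge0// ltW.
have mD i j : measurable_fun A1 (fun x => Df x i j) by exact: measurable_funS (mDf i j).
have mdet : measurable_fun A1 (fun x => `|\det (Df x)|%:E).
  by apply/measurable_EFinP; apply: measurableT_comp => //; exact: measurable_det.
apply: (@le_trans _ _ (\int[mu]_(x in A1) (k1%:E * `|\det (Df x)|%:E + k2%:E))%E).
  apply: ae_ge0_le_integral => //.
  - by move=> x _; rewrite lee_fin gradpow_ge0.
  - by apply/measurable_EFinP; exact: measurable_gradpow.
  - by move=> x _; rewrite -EFinM -EFinD lee_fin addr_ge0// mulr_ge0.
  - by apply: emeasurable_funD => //; exact: emeasurable_funM.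
  - by apply: filterS qr => x h A1x; rewrite -EFinM -EFinD lee_fin h//; exact: A12.
rewrite ge0_integralD//; last 2 first.
- by move=> x _; rewrite mule_ge0// lee_fin.
- exact: emeasurable_funM.
rewrite ge0_integralZl// integral_cst//.
have /= -> := lebesgue_rV_cube z (ltW r0).
apply: (@le_trans _ _ (k1%:E * (C%:E * (I + (r ^+ n)%:E)) + k2%:E * ((2 * r) ^+ n)%:E))%E.
  by apply: leeD => //; apply: lee_wpmul2l; rewrite ?lee_fin.
have Ifin : (I < +oo)%E.
  apply: le_lt_trans Goo; apply: ge0_subset_integral => //.
  - exact: measurableD.
  - by apply/measurable_EFinP; exact: measurable_gradpow.
  - by move=> x _; rewrite lee_fin gradpow_ge0.
have [a aE] : exists a, I = a%:E by exists (fine I); rewrite fineK// ge0_fin_numE.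
move: I0; rewrite aE lee_fin => a0.
rewrite -[leLHS]/((k1 * (C * (a + r ^+ n)) + k2 * (2 * r) ^+ n)%:E).
rewrite -[leRHS]/(((k1 * C + k2 * 2 ^+ n + 1) * (a + r ^+ n))%:E) lee_fin exprMn.
have e0 : 0 <= 2 ^+ n :> R by exact: exprn_ge0.
have : 0 <= k2 * 2 ^+ n * a by apply: mulr_ge0 => //; exact: mulr_ge0.
move: (r ^+ n) rn (2 ^+ n) e0 => q q0 e e0; nra.
Qed.

End hole_filling.

(** * The modulus of continuity *)

Section morrey.
Variables (R : realType) (p : nat).
Local Notation n := p.+2.
Local Notation mu := (@lebesgue_rV R n).

Lemma le_dyadic (r : R) k : 0 < r -> r <= 1 ->
  [/\ 0 < r * 2^-1 ^+ k, r * 2^-1 ^+ k <= r & (r * 2^-1 ^+ k) ^+ n <= 2^-1 ^+ k].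
Proof.
move=> r0 r1; have q0 : 0 < 2^-1 ^+ k :> R by rewrite exprn_gt0// invr_gt0.
have q1 : 2^-1 ^+ k <= 1 :> R by apply: exprn_ile1; lra.
have s0 : 0 < r * 2^-1 ^+ k by rewrite mulr_gt0.
have s1 : r * 2^-1 ^+ k <= 2^-1 ^+ k by apply: ler_piMl => //; exact: ltW.
split=> //; first by apply: ler_piMr => //; exact: ltW.
rewrite exprS; apply: le_trans (s1); apply: ler_piMr; first exact: ltW.
by apply: exprn_ile1; [exact: ltW|exact: le_trans s1 q1].
Qed.

(** Hole filling on the cubes of half-side r 2^-k makes the integral of the
    gradient decay like t^k, and Poincare's inequality transfers the decay to
    the oscillation. The constants t and B depend on k1, k2 and M only. *)
Lemma good_constants (k1 k2 M : R) : 0 <= k1 -> 0 <= k2 -> 0 <= M ->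
  exists t : R, exists B : R, [/\ 2^-1 <= t, t < 1, 0 <= B &
  forall (Om : set 'rV[R]_n) (f : 'rV[R]_n -> 'rV[R]_n) (Df : 'rV[R]_n -> 'M[R]_n),
  open Om -> {within Om, continuous f} -> weak_derivative Om f Df ->
  (forall i j, Ln Om (fun x => Df x i j)) ->
  (forall i, measurable_fun Om (fun x => f x ord0 i)) ->
  (\int[mu]_(x in Om) (gradpow Df x)%:E <= M%:E)%E ->
  ({ae mu, forall x, Om x -> 0 <= \det (Df x)} \/
   {ae mu, forall x, Om x -> \det (Df x) <= 0}) ->
  {ae mu, forall x, Om x -> gradpow Df x <= k1 * `|\det (Df x)| + k2} ->
  forall (x : 'rV[R]_n) (r : R), 0 < r -> r <= 1 -> ccube x (2 * r) `<=` Om -> forall k i,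
  exists2 y, cube x (r * 2^-1 ^+ k) y &
  (\int[mu]_(w in cube x (r * 2^-1 ^+ k)) (`|f w ord0 i - f y ord0 i| ^+ n)%:E <=
    ((r * 2^-1 ^+ k) ^+ n * (B * t ^+ k))%:E)%E].
Proof.
move=> k10 k20 M0.
have [C C1 hole] := hole_filling p k10 k20.
have [t [A [t2 t1 A0 decay]]] := hole_filling_decay C1.
pose X : R := (2 * n%:R) ^+ n * 2 ^+ n.
have X0 : 0 <= X by apply: mulr_ge0; [apply: exprn_ge0; apply: mulr_ge0|apply: exprn_ge0].
exists t, (X * (M + A) + 1); split => //.
  by apply: addr_ge0 => //; apply: mulr_ge0 => //; apply: addr_ge0.
move=> Om f Df oO cf wD LD mf GM sgn qr x r r0 r1 xO.
have mO : measurable Om by exact: open_measurable_rV.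
have mDO i j : measurable_fun Om (fun x => Df x i j) by have [] := LD i j.
pose rad k : R := r * 2^-1 ^+ k.
have rad0 k : 0 < rad k by have [] := le_dyadic k r0 r1.
have radn k : rad k ^+ n <= 2^-1 ^+ k by have [] := le_dyadic k r0 r1.
have radS k : 2 * rad k.+1 = rad k by rewrite /rad exprS; field.
have radle k : rad k.+1 <= rad k by rewrite -(radS k) ler_peMl// ?ler1n// ltW.
have radr k : rad k <= r.
  by have [] := le_dyadic k r0 r1.
have QO k : cube x (rad k) `<=` Om.
  move=> w wx; apply: xO => i; apply: ltW; apply: lt_le_trans (wx i) _.
  by have := radr k; lra.
have mQ k : measurable (cube x (rad k)) by exact: measurable_cube.
have mGO : measurable_fun Om (fun x => (gradpow Df x)%:E).
  by apply/measurable_EFinP; exact: measurable_gradpow.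
have mG k : measurable_fun (cube x (rad k)) (fun x => (gradpow Df x)%:E).
  by apply: measurable_funS mGO.
have G0 w : (0 <= (gradpow Df w)%:E)%E by rewrite lee_fin gradpow_ge0.
have IM k : (\int[mu]_(w in cube x (rad k)) (gradpow Df w)%:E <= M%:E)%E.
  by apply: le_trans GM; apply: ge0_subset_integral.
have I0 k : (0 <= \int[mu]_(w in cube x (rad k)) (gradpow Df w)%:E)%E.
  by apply: integral_ge0 => w _.
pose phi k : R := fine (\int[mu]_(w in cube x (rad k)) (gradpow Df w)%:E).
have phiE k : (\int[mu]_(w in cube x (rad k)) (gradpow Df w)%:E = (phi k)%:E)%E.
  by rewrite fineK// ge0_fin_numE//; exact: le_lt_trans (IM k) (ltry _).
have phi0 k : 0 <= phi k by rewrite -lee_fin -phiE.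
have phiM k : phi k <= M by rewrite -lee_fin -phiE.
have apx k : exists U H B, approx f Df x (rad k) U H B.
  apply: (approx_exists oO cf wD LD (rad0 k) _ xO).
  by have := radr k; lra.
have phi_hole k : phi k.+1 <= C * (phi k - phi k.+1 + 2^-1 ^+ k).
  have [U [H [B ap]]] := apx k.
  have Q12 : cube x (rad k.+1) `<=` cube x (rad k).
    by apply: sub_cube => i; rewrite subrr normr0 add0r.
  have := hole f Df x (rad k.+1) U H B (rad0 _).
  rewrite radS => /(_ ap) h.
  have {h} := h (measurable_funS mO (QO k) (mf ord0)) (fun i j => measurable_funS mO (QO k) (mDO i j)).
  rewrite !phiE => /(_ (ltry _)) h.
  have {h} : ((phi k.+1)%:E <= C%:E * (\int[mu]_(w in cube x (rad k) `\` cube x (rad k.+1)) (gradpow Df w)%:E + (rad k.+1 ^+ n)%:E))%E.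
    apply: h.
      by case: sgn => s; [left|right]; apply: filterS s => w h Qw; apply: h; exact: QO Qw.
    by apply: filterS qr => w h Qw; apply: h; exact: QO Qw.
  have -> : (\int[mu]_(w in cube x (rad k) `\` cube x (rad k.+1)) (gradpow Df w)%:E = (phi k - phi k.+1)%:E)%E.
    have mD : measurable (cube x (rad k) `\` cube x (rad k.+1)) by exact: measurableD.
    have := phiE k; rewrite -{1}(setDUK Q12) ge0_integral_setU//; first last.
    - by apply/disj_setPS => w [/= Qw [_]].
    - by rewrite setDUK.
    rewrite phiE; set I := (X in (_ + X)%E); move=> E; change (I = (phi k - phi k.+1)%:E).
    case: I E => [v [<-]| |] //.
    by congr EFin; ring.
  rewrite -EFinD -EFinM lee_fin => h; apply: le_trans h _.
  rewrite ler_pM2l ?lerD2l; last by lra.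
  apply: le_trans (radn _) _; rewrite exprS.
  by rewrite ler_piMl ?exprn_ge0//; lra.
have phi_decay k : phi k <= (M + A) * t ^+ k.
  apply: le_trans (decay phi phi0 phi_hole k) _.
  by rewrite ler_wpM2r ?lerD2r// exprn_ge0//; lra.
move=> k i; have [U [H [B ap]]] := apx k.
have d0 : 0 <= 2 * rad k by have := rad0 k; lra.
have e0 : 0 < rad k ^+ n * rad k ^+ n by rewrite mulr_gt0// exprn_gt0.
have muQ := lebesgue_rV_cube x (ltW (rad0 k)); rewrite /= in muQ.
have muQ1 : (mu (cube x (rad k)) < +oo)%E by have /= -> := muQ; exact: ltry.
have muQ0 : (0 < mu (cube x (rad k)))%E.
  by have /= -> := muQ; rewrite lte_fin exprn_gt0// mulr_gt0.
have gG : (\int[mu]_(w in cube x (rad k)) (\sum_j `|Df w i j| ^+ n)%:E <= (phi k)%:E)%E.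
  rewrite -phiE; apply: ge0_le_integral => //.
  - by move=> w _; rewrite lee_fin sumr_ge0// => j _; rewrite exprn_ge0.
  - apply/measurable_EFinP; apply: measurable_sum => j; apply: measurable_funX.
    by apply: measurableT_comp => //; exact: (measurable_funS mO (QO k) (mDO i j)).
  - by move=> w _; rewrite lee_fin gradpow_row.
have [|| |y Qy yP] := @good_point R p.+1 f Df x (rad k) U H B ap i
    (measurable_funS mO (QO k) (mf i)) (fun j => measurable_funS mO (QO k) (mDO i j))
    (cube x (rad k)) (2 * rad k) (mQ k) d0 (fun w h => h) _ _ muQ1 _ e0 muQ0.
- by move=> w w' s; exact: cube_convex.
- by move=> w w' j; exact: cube_diam.
- exact: le_lt_trans gG (ltry _).
exists y => //; apply: le_trans yP _.
apply: (@le_trans _ _ (((2 * rad k * n%:R) ^+ n * 2 ^+ n)%:E * (phi k)%:E + (rad k ^+ n * rad k ^+ n)%:E))%E.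
  apply: leeD => //; apply: lee_wpmul2l => //; rewrite lee_fin.
  by apply: mulr_ge0; [apply: exprn_ge0; apply: mulr_ge0|apply: exprn_ge0].
rewrite -EFinM -EFinD lee_fin.
have -> : (2 * rad k * n%:R) ^+ n * 2 ^+ n = rad k ^+ n * X.
  by rewrite /X -(mulrAC 2) exprMn; ring.
have q0 : 0 <= rad k ^+ n by apply: exprn_ge0; exact: ltW.
have qt : rad k ^+ n <= t ^+ k.
  by apply: le_trans (radn k) _; rewrite lerXn2r ?nnegrE//; lra.
rewrite -mulrA -mulrDr ler_wpM2l// mulrDl mul1r -mulrA lerD// ler_wpM2l//.
Qed.

(** By Bernoulli's inequality 1 - (1 - t) / n is large enough, so that no n-th
    root is needed. *)
Lemma rate_root (t : R) : 2^-1 <= t -> t < 1 -> exists s : R, [/\ 0 < s, s < 1 & t <= s ^+ n].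
Proof.
move=> t2 t1; have n0 : 0 < n%:R :> R by rewrite ltr0n.
have x0 : 0 < (1 - t) / n%:R by rewrite divr_gt0// subr_gt0.
have x1 : (1 - t) / n%:R <= 2^-1.
  rewrite ler_pdivrMr//; apply: le_trans (_ : 2^-1 * 1 <= _); first lra.
  by rewrite ler_wpM2l ?ler1n//; lra.
have nx : n%:R * ((1 - t) / n%:R) = 1 - t by rewrite mulrC divfK// gt_eqF.
move: ((1 - t) / n%:R) x0 x1 nx => x x0 x1 nx.
have xle1 : x <= 1 by lra.
have := @bernoulli R x n (ltW x0) xle1; rewrite nx => h.
by exists (1 - x); split; [lra|lra|apply: le_trans h; lra].
Qed.

Lemma telescope_bound (c : nat -> R) (L s l : R) k : 0 < s -> s < 1 -> 0 <= L ->
  (forall m, (k <= m)%N -> `|c m - c m.+1| <= L * s ^+ m) ->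
  (forall e, 0 < e -> exists2 m, (k <= m)%N & `|c m - l| < e) ->
  `|c k - l| <= L / (1 - s) * s ^+ k.
Proof.
move=> s0 s1 L0 H Hl.
have s1' : 0 < 1 - s by lra.
have step j : `|c k - c (k + j)%N| <= L / (1 - s) * (s ^+ k - s ^+ (k + j)).
  elim: j => [|j IH]; first by rewrite addn0 !subrr normr0 mulr0.
  rewrite addnS; apply: le_trans (ler_distD (c (k + j)%N) _ _) _.
  apply: le_trans (lerD IH (H _ (leq_addr _ _))) _.
  rewrite exprS le_eqVlt; apply/orP; left; apply/eqP.
  by field; rewrite gt_eqF.
apply/ler_addgt0Pr => e e0; have [m km ml] := Hl e e0.
apply: le_trans (ler_distD (c m) _ _) _; apply: lerD; last exact: ltW.
have := step (m - k)%N; rewrite subnKC// => h; apply: le_trans h _.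
rewrite ler_wpM2l ?divr_ge0//; first exact: ltW.
by rewrite gerBl exprn_ge0// ltW.
Qed.

(** Good constants at consecutive scales differ by at most L s^k, even when the
    smaller cube is centred at another point y. Telescoping at x, one such
    comparison, and telescoping at y give the three terms of the bound. *)
Lemma modulus_of_continuity (k1 k2 M : R) : 0 <= k1 -> 0 <= k2 -> 0 <= M ->
  exists s : R, exists K : R, [/\ 0 < s, s < 1, 0 <= K &
  forall (Om : set 'rV[R]_n) (f : 'rV[R]_n -> 'rV[R]_n) (Df : 'rV[R]_n -> 'M[R]_n),
  open Om -> {within Om, continuous f} -> weak_derivative Om f Df ->
  (forall i j, Ln Om (fun x => Df x i j)) ->
  (forall i, measurable_fun Om (fun x => f x ord0 i)) ->
  (\int[mu]_(x in Om) (gradpow Df x)%:E <= M%:E)%E ->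
  ({ae mu, forall x, Om x -> 0 <= \det (Df x)} \/
   {ae mu, forall x, Om x -> \det (Df x) <= 0}) ->
  {ae mu, forall x, Om x -> gradpow Df x <= k1 * `|\det (Df x)| + k2} ->
  forall (x y : 'rV[R]_n) (r : R), 0 < r -> r <= 1 -> ccube x (2 * r) `<=` Om -> ccube y (2 * r) `<=` Om ->
  forall k i, cube x (r * 2^-1 ^+ k.+1) y -> `|f x ord0 i - f y ord0 i| <= K * s ^+ k].
Proof.
move=> k10 k20 M0; have [t [B [t2 t1 B0 good]]] := good_constants k10 k20 M0.
have [s [s0 s1 ts]] := rate_root t2 t1.
have n0 : 0 <= 2 ^+ n :> R by exact: exprn_ge0.
pose L : R := 1 + 2 ^+ n * (2 * B).
have LB : 0 <= 2 ^+ n * (2 * B) by apply: mulr_ge0 => //; apply: mulr_ge0.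
have L1 : 1 <= L by rewrite /L; lra.
have s1' : 0 < 1 - s by lra.
have Y0 : 0 <= L / (1 - s) by rewrite divr_ge0//; lra.
exists s, (L / (1 - s) + L + L / (1 - s)); split => //; first lra.
move=> Om f Df oO cf wD LD mf GM sgn qr x0 y0 r r0 r1 x0O y0O k0 i x0y0.
have good' x xO k := good Om f Df oO cf wD LD mf GM sgn qr x r r0 r1 xO k i.
have mO : measurable Om by exact: open_measurable_rV.
pose rad k : R := r * 2^-1 ^+ k.
have rad0 k : 0 < rad k by have [] := le_dyadic k r0 r1.
have radS k : 2 * rad k.+1 = rad k by rewrite /rad exprS; field.
have radle k : rad k.+1 <= rad k by rewrite -(radS k) ler_peMl// ?ler1n// ltW.
have radr k : rad k <= r.
  by have [] := le_dyadic k r0 r1.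
have QO x k : ccube x (2 * r) `<=` Om -> cube x (rad k) `<=` Om.
  move=> xO w wx; apply: xO => j; apply: ltW; apply: lt_le_trans (wx j) _.
  by have := radr k; lra.
(* L >= 1 gives L <= L ^+ n, which dispenses with the n-th root of L *)
have compare x y k (c c' : R) : ccube x (2 * r) `<=` Om -> ccube y (2 * r) `<=` Om ->
    cube y (rad k.+1) `<=` cube x (rad k) ->
    (\int[mu]_(w in cube x (rad k)) (`|f w ord0 i - c| ^+ n)%:E <= (rad k ^+ n * (B * t ^+ k))%:E)%E ->
    (\int[mu]_(w in cube y (rad k.+1)) (`|f w ord0 i - c'| ^+ n)%:E <= (rad k.+1 ^+ n * (B * t ^+ k.+1))%:E)%E ->
    `|c - c'| <= L * s ^+ k.
  move=> xO yO yx h h'.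
  have q0 : 0 < rad k ^+ n by exact: exprn_gt0.
  have tk0 : 0 <= t ^+ k by apply: exprn_ge0; lra.
  have h2 : (\int[mu]_(w in cube y (rad k.+1)) (`|f w ord0 i - c'| ^+ n)%:E <= (rad k ^+ n * (B * t ^+ k))%:E)%E.
    apply: le_trans h' _; rewrite lee_fin; apply: ler_pM.
    - by apply: exprn_ge0; exact: ltW.
    - by apply: mulr_ge0 => //; apply: exprn_ge0; lra.
    - by rewrite lerXn2r ?nnegrE// ltW.
    - by rewrite ler_wpM2l// exprS ler_piMl//; lra.
  have o : ((rad k ^+ n)%:E <= mu (cube y (rad k.+1)))%E.
    by have /= -> := lebesgue_rV_cube y (ltW (rad0 k.+1)); rewrite radS.
  have := osc_overlap (measurable_cube x (rad k)) (measurable_cube y (rad k.+1))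
    (measurable_cube y (rad k.+1)) (measurable_funS mO (QO x k xO) (mf i))
    (measurable_funS mO (QO y k.+1 yO) (mf i)) yx (fun w h => h) o h h2.
  have -> : 2 ^+ n * (rad k ^+ n * (B * t ^+ k) + rad k ^+ n * (B * t ^+ k)) =
    (2 ^+ n * (2 * B) * t ^+ k) * rad k ^+ n by ring.
  rewrite ler_pM2r// => h3.
  have Ls0 : 0 <= L * s ^+ k by apply: mulr_ge0; [lra|apply: exprn_ge0; exact: ltW].
  rewrite -(@ler_pXn2r _ n)// ?nnegrE//; apply: le_trans h3 _.
  rewrite exprMn -exprM mulnC exprM; apply: ler_pM => //.
    apply: le_trans (_ : L <= _); first by rewrite /L lerDr.
    by rewrite exprS ler_peMr ?exprn_ege1//; lra.
  by rewrite lerXn2r ?nnegrE//; [lra|apply: exprn_ge0; exact: ltW].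
(* c is spliced into a sequence of values f (y m), which tends to f x by continuity *)
have limit x (xO : ccube x (2 * r) `<=` Om) k (c : R) :
    (\int[mu]_(w in cube x (rad k)) (`|f w ord0 i - c| ^+ n)%:E <= (rad k ^+ n * (B * t ^+ k))%:E)%E ->
    `|c - f x ord0 i| <= L / (1 - s) * s ^+ k.
  move=> hc; have /choice[y Hy] : forall m, exists y, cube x (rad m) y /\
      (\int[mu]_(w in cube x (rad m)) (`|f w ord0 i - f y ord0 i| ^+ n)%:E <= (rad m ^+ n * (B * t ^+ m))%:E)%E.
    by move=> m; have [y ? ?] := good' x xO m; exists y.
  pose cc m := if m == k then c else f (y m) ord0 i.
  have ccP m : (\int[mu]_(w in cube x (rad m)) (`|f w ord0 i - cc m| ^+ n)%:E <= (rad m ^+ n * (B * t ^+ m))%:E)%E.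
    by rewrite /cc; case: eqP => [->//|_]; have [] := Hy m.
  have -> : c = cc k by rewrite /cc eqxx.
  apply: telescope_bound => //; first lra.
    move=> m _; apply: (compare x x) => //; apply: sub_cube => j.
    by rewrite subrr normr0 add0r.
  move=> e e0.
  have Ox : Om x by apply: xO => j; rewrite subrr normr0; lra.
  have := coord_cont_at (i := i) oO cf Ox => /cvgrPdist_lt /(_ e e0) /nbhs_ballP[d /= d0 dP].
  have [m Hm] : exists m, rad m < d.
    have /cvgrPdist_lt /(_ d d0) [m _ /(_ m (leqnn m))] : (r * 2^-1 ^+ m @[m --> \oo] --> (0 : R)).
      rewrite -[0](mulr0 r); apply: cvgM; first exact: cvg_cst.
      by apply: cvg_expr; rewrite ger0_norm ?invr_ge0// invf_lt1// ltr1n.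
    by rewrite /= sub0r normrN (gtr0_norm (rad0 m)) => h; exists m.
  exists (maxn m k.+1); first by rewrite leq_max leqnSn orbT.
  rewrite /cc gtn_eqF; last by rewrite leq_max leqnn orbT.
  rewrite distrC; apply: dP; rewrite -cube_ball// => j.
  have [Hj _] := Hy (maxn m k.+1); apply: lt_trans (Hj j) _; apply: le_lt_trans Hm.
  rewrite /rad ler_pM2l//; apply: ler_wiXn2l; last exact: leq_maxl.
    by rewrite invr_ge0.
  by rewrite invf_le1// ler1n.
have x0O' := good' x0 x0O k0; have [a Qa ha] := x0O'.
have [b Qb hb] := good' y0 y0O k0.+1.
have xy : `|f a ord0 i - f b ord0 i| <= L * s ^+ k0.
  apply: (compare x0 y0) => //; apply: sub_cube => j; have := x0y0 j.
  by move=> h; rewrite -(radS k0) mulr_natl mulr2n lerD2r; exact: ltW.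
have ha' := limit x0 x0O k0 _ ha.
have hb' := limit y0 y0O k0.+1 _ hb.
have hb'' : L / (1 - s) * s ^+ k0.+1 <= L / (1 - s) * s ^+ k0.
  by apply: ler_wpM2l => //; rewrite exprS; apply: ler_piMl; [apply: exprn_ge0|]; exact: ltW.
have -> : (L / (1 - s) + L + L / (1 - s)) * s ^+ k0 =
  L / (1 - s) * s ^+ k0 + (L * s ^+ k0 + L / (1 - s) * s ^+ k0) by ring.
rewrite distrC in ha'.
apply: le_trans (ler_distD (f a ord0 i) _ _) _; apply: lerD => //.
apply: le_trans (ler_distD (f b ord0 i) _ _) _; apply: lerD => //.
exact: le_trans hb' hb''.
Qed.

End morrey.

(** * Uniformity on compact subsets *)

Lemma compact_cube_margin (R : realType) (p : nat) (V Om : set 'rV[R]_p.+1) : open Om -> compact V ->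
  V `<=` Om -> exists2 r : R, 0 < r <= 1 & forall x, V x -> ccube x (2 * r) `<=` Om.
Proof.
move=> oO /compact_near_coveringP cV VO.
have : \forall e \near (0 : R)^'+, V `<=` (fun x => ccube x (2 * e) `<=` Om).
  apply: cV => x Vx.
  have /nbhs_ballP[d /= d0 dO] : nbhs (x : 'rV[R]_p.+1) Om by apply: open_nbhs_nbhs; split => //; exact: VO.
  have d2 : 0 < d / 2 by rewrite divr_gt0.
  exists (ball (x : 'rV[R]_p.+1) (d / 2), [set e : R | e < d / 4]).
    split => /=; first exact: nbhsx_ballx.
    by apply: nbhs_right_lt; rewrite divr_gt0.
  move=> [y e] /= []; rewrite -cube_ball// => yx ed w wy; apply: dO; rewrite -cube_ball// => i.
  have -> : w ord0 i - x ord0 i = (w ord0 i - y ord0 i) + (y ord0 i - x ord0 i) by ring.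
  by apply: le_lt_trans (ler_normD _ _) _; have := wy i; have := yx i; lra.
move=> h.
have [r [hr [r0 r1]]] := filter_ex (filterI h (filterI (nbhs_right_gt (0 : R)) (nbhs_right_lt (@ltr01 R)))).
by exists r => //; rewrite r0 ltW.
Qed.

Theorem corollary1p1 (R : realType) (n : nat) (hn : (2 <= n)%N)
  (Omega : set 'rV[R]_n) (Omega_open : open Omega)
  (Omega_connected : connected Omega) (K1 K2 M : R)
  (hK1 : 0 < K1) (hK2 : 0 <= K2) (hM : 0 <= M) :
  forall V : set 'rV[R]_n, compact V -> V `<=` Omega ->
    equi_uniformly_continuous V (qr_class Omega K1 K2 M).
Proof.
clear Omega_connected; case: n hn Omega Omega_open => [//|[//|p]] _ Omega oO V cV VO e e0.
pose n := p.+2.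
have [r /andP[r0 r1] rV] := compact_cube_margin oO cV VO.
have k10 : 0 <= n%:R ^+ 2 * K1 by rewrite mulr_ge0 ?exprn_ge0// ltW.
have k20 : 0 <= n%:R ^+ 2 * K2 by rewrite mulr_ge0 ?exprn_ge0.
have M0 : 0 <= n%:R ^+ 2 * M by rewrite mulr_ge0 ?exprn_ge0.
have [s [K [s0 s1 K0 modulus]]] := modulus_of_continuity p k10 k20 M0.
have [k Hk] : exists k, n%:R * K * s ^+ k < e.
  have /cvgrPdist_lt /(_ e e0) [k _ /(_ k (leqnn k))] : (n%:R * K * s ^+ m @[m --> \oo] --> (0 : R)).
    rewrite -[0](mulr0 (n%:R * K)); apply: cvgM; first exact: cvg_cst.
    by apply: cvg_expr; rewrite ger0_norm// ltW.
  by rewrite /= sub0r normrN => h; exists k; exact: le_lt_trans (ler_norm _) h.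
exists (r * 2^-1 ^+ k.+1); first by rewrite mulr_gt0// exprn_gt0// invr_gt0.
move=> f x y [[[wD Lf LD] sgn qr] cf GM] Vx Vy xy.
have wDf : weak_derivative Omega f (weakD Omega f) by exact: xgetPex wD.
have mO : measurable Omega by exact: open_measurable_rV.
set Df := weakD Omega f in LD sgn qr GM wDf.
have n2 : 0 < n%:R ^+ 2 :> R by rewrite exprn_gt0// ltr0n.
have mG : measurable_fun Omega (fun x => (gradpow Df x)%:E).
  by apply/measurable_EFinP; apply: measurable_gradpow => i j; have [] := LD i j.
have GM' : (\int[@lebesgue_rV R n]_(x in Omega) (gradpow Df x)%:E <= (n%:R ^+ 2 * M)%:E)%E.
  (* the constant is moved to the side of gradpow, where linearity only asks for
     the measurability of the entries of Df *)
  have : (\int[@lebesgue_rV R n]_(x in Omega) ((n%:R ^+ 2)^-1%:E * (gradpow Df x)%:E) <= M%:E)%E.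
    apply: le_trans GM; apply: le_integral_ge0 => //.
    - by move=> w _; rewrite lee_fin mulr_ge0 ?gradpow_ge0// invr_ge0 ltW.
    - move=> w _; rewrite lee_fin exprn_ge0//.
      exact: le_trans (normr_ge0 _) (entry_le_opnorm (Df w) ord0 ord0).
    - move=> w _; rewrite -EFinM lee_fin ler_pdivrMl//; exact: gradpow_opnorm.
  rewrite ge0_integralZl//; last by move=> w _; rewrite lee_fin gradpow_ge0.
  by rewrite lee_pdivrMl.
have qr' : {ae @lebesgue_rV R n, forall x, Omega x ->
    gradpow Df x <= n%:R ^+ 2 * K1 * `|\det (Df x)| + n%:R ^+ 2 * K2}.
  apply: filterS qr => w h Ow; apply: le_trans (gradpow_opnorm Df w) _.
  by rewrite -mulrA -mulrDr ler_pM2l// h.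
have mf i : measurable_fun Omega (fun x => f x ord0 i) by have [] := Lf i.
have H := modulus Omega f Df oO cf wDf LD mf GM' sgn qr' x y r r0 r1 (rV x Vx) (rV y Vy) k.
apply: le_lt_trans Hk; apply: le_trans (enorm_le_sum _) _.
rewrite mulrAC -mulrA mulr_natl -[X in _ *+ X]card_ord -sumr_const; apply: ler_sum => i _.
rewrite !mxE mulrC; apply: H => j; apply: le_lt_trans xy.
by have := enorm_coord (x - y) j; rewrite !mxE distrC.
Qed.
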